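(* Let $\alpha\in\mathbb R\setminus\{0,1\}$. Suppose either $\lambda=\alpha$ and $\alpha\notin\mathbb N$, or $\lambda=1$ and $\alpha^{-1}\notin\mathbb N$. Then the Segal–Bargmann transform $\mathrm{SB}$ intertwines the action $\pi_\lambda$ on $W_\lambda$ with the action $\rho_\lambda$ on $F_\lambda$, i.e. $$\mathrm{SB}\circ\pi_\lambda(X)=\rho_\lambda(X)\circ\mathrm{SB}\qquad\text{for all }X\in\mathfrak g.$$
   Context: $\mathbb N=\{0,1,2,\dots\}$. $\mathcal P=\mathbb C[z_1,z_2]\otimes\Lambda(z_3,z_4)$, with $z_1,z_2$ even and $z_3,z_4$ odd; $\partial_i=\partial_{z_i}$ are the (left) partial superderivatives. The Bessel operators are $\mathcal B_\lambda(z_1)=(-\lambda+z_1\partial_1+z_3\partial_3+z_4\partial_4)\partial_1-2\alpha z_2\partial_3\partial_4$, $\mathcal B_\lambda(z_2)=(-\tfrac{\lambda}{\alpha}+z_2\partial_2+z_3\partial_3+z_4\partial_4)\partial_2-2z_1\partial_3\partial_4$, $\mathcal B_\lambda(z_3)=(-2\lambda+2z_1\partial_1+2\alpha z_2\partial_2+2(1+\alpha)z_3\partial_3)\partial_4+z_3\partial_1\partial_2$, $\mathcal B_\lambda(z_4)=(2\lambda-2z_1\partial_1-2\alpha z_2\partial_2-2(1+\alpha)z_4\partial_4)\partial_3+z_4\partial_1\partial_2$. $\mathcal I_\lambda$ is the ideal generated by $2z_1z_2+z_3z_4,\ z_2^2,\ z_2z_3,\ z_2z_4$ if $\lambda=\alpha$,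 and by $2\alpha z_1z_2+z_3z_4,\ z_1^2,\ z_1z_3,\ z_1z_4$ if $\lambda=1$. The same formulas are used in real coordinates $x_1,x_2$ (even), $x_3,x_4$ (odd). $D_\alpha$ is the real Jordan superalgebra with even basis $e_1,e_2$, odd basis $\xi,\eta$ and supercommutative product $e_ie_i=e_i$, $e_1e_2=0$, $e_i\xi=\frac12\xi$, $e_i\eta=\frac12\eta$, $\xi\eta=e_1+\alpha e_2$. $L_a$ is left multiplication by $a$, $\mathrm{Der}(D_\alpha)$ the space of (super)derivations, $\mathfrak{str}(D_\alpha)=\{L_a\}\oplus\mathrm{Der}(D_\alpha)\subset\mathrm{End}(D_\alpha)$ with supercommutator bracket. $\mathfrak g=\mathrm{TKK}(D_\alpha)=D_\alpha^-\oplus\mathfrak{str}(D_\alpha)\oplus D_\alpha^+\ (\cong D(2,1;\alpha))$ with $D_\alpha^\pm$ copies of $D_\alpha$ (write $a^\pm$), and brackets $[L_a,x^+]=(ax)^+$, $[D,x^+]=(Dx)^+$, $[L_a,u^-]=-(au)^-$, $[D,u^-]=(Du)^-$, $[x^+,u^-]=2L_{xu}+2[L_x,L_u]$, $[D_\alpha^\pm,D_\alpha^\pm]=0$ ($D\in\mathrm{Der}(D_\alpha)$). Let $a\mapsto z_a$ be the linear map with $e_1,e_2,\xi,\eta\mapsto z_1,z_2,z_3,z_4$, extend $\mathcal B_\lambda(z_a)$ linearly in $a$; for $T\in\mathrm{End}(D_\alpha)$ let $\partial_T$ be the superderivation (of the parity of $T$; a first-order differential operator) with $\partial_T(z_b)=z_{T(b)}$.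 Let $\lambda(2L_{e_1})=\lambda$, $\lambda(2L_{e_2})=\lambda/\alpha$, $\lambda(L_\xi)=\lambda(L_\eta)=0$ (extended linearly). Then $\pi_\lambda(a^-)=-2\imath z_a$, $\pi_\lambda(L_a)=\lambda(L_a)-\partial_{L_a}$, $\pi_\lambda(D)=\partial_D$, $\pi_\lambda(a^+)=-\frac{\imath}{2}\mathcal B_\lambda(z_a)$; and $\rho_\lambda(a^-)=-\frac{\imath}{2}(z_a+\mathcal B_\lambda(z_a))+\imath\pi_\lambda(L_a)$, $\rho_\lambda(a^+)=-\frac{\imath}{2}(z_a+\mathcal B_\lambda(z_a))-\imath\pi_\lambda(L_a)$, $\rho_\lambda(2L_a)=z_a-\mathcal B_\lambda(z_a)$, $\rho_\lambda(D)=\partial_D$. Both preserve $\mathcal I_\lambda$. $F_\lambda$ is the $\rho_\lambda$-submodule $U(\mathfrak g)1$ of $\mathcal P/\mathcal I_\lambda$ generated by $1$ (complex span); $F_{\lambda,\mathbb R}$ is the same space in the coordinates $x$. $W_\lambda=\mathcal P(\mathbb R^{2|2})\exp(-2(x_1+x_2))\bmod\mathcal I_\lambda$, i.e. the image of $(\mathbb C[x_1,x_2]\otimes\Lambda(x_3,x_4))e^{-2(x_1+x_2)}$ in the quotient of $C^\infty(\mathbb R^2,\mathbb C)\otimes\Lambda(x_3,x_4)$ by the ideal generated by $\mathcal I_\lambda$, with $\mathfrak g$ acting by $\pi_\lambda$ (in coordinates $x$). Let $\pi_\lambda(C)^{-1}=\exp(-\frac12(\mathcal B_\lambda(x_1)+\mathcal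 B_\lambda(x_2)))\exp(-x_1-x_2)$, acting on $F_{\lambda,\mathbb R}$ modulo $\mathcal I_\lambda$ (multiply by the power series $e^{-x_1-x_2}$, then apply the exponential series of the operator, which converges coefficientwise). It is a bijection $F_{\lambda,\mathbb R}\to W_\lambda$ and $\pi_\lambda(C)$, formally $\exp(x_1+x_2)\exp(\frac12(\mathcal B_\lambda(x_1)+\mathcal B_\lambda(x_2)))$, denotes its inverse. The Segal–Bargmann transform is $\mathrm{SB}(f)(z)=\langle(\pi_\lambda(C)f)(x),\mathbb I_\lambda(z,x)\rangle_{\mathcal B(x)}$, $f\in W_\lambda$, where $\langle\cdot,\cdot\rangle_{\mathcal B(x)}$ is the Bessel–Fischer product $\langle p,q\rangle_{\mathcal B}=p(\mathcal B_\lambda)\bar q|_{0}$ in $x$ and $\mathbb I_\lambda$ is the reproducing kernel: pairing a $p\in F_{\lambda,\mathbb R}$ in the variable $x$ with $\mathbb I_\lambda(z,x)$ yields $p(z)\in F_\lambda$. Hence $\mathrm{SB}(f)(z)$ is $\pi_\lambda(C)f$ with $x$ replaced by $z$, and $\mathrm{SB}^{-1}(p)(x)=\pi_\lambda(C)^{-1}(p(x))$. *)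

(* Defs.v *)
From HB Require Import structures.
From mathcomp Require Import all_boot all_order all_algebra.
From mathcomp Require Import complex.
From mathcomp Require Import all_classical all_reals all_analysis.
From mathcomp Require mpoly.
(* The notations of mpoly clash with those of all_analysis. *)
Import -(notations) mpoly.

Set Implicit Arguments.
Unset Strict Implicit.
Unset Printing Implicit Defensive.

Import Order.TTheory GRing.Theory Num.Theory.
Import numFieldNormedType.Exports.

Local Open Scope classical_set_scope.
Local Open Scope complex_scope.
Local Open Scope ring_scope.

(* A space of "functions" of the two even variables, with the operators
   multiplication by the variable and partial derivative.  It is instantiated
   with polynomials, formal power series and smooth functions.  For smooth
   functions the carrier consists of all functions R -> R -> C, and [dom] cuts
   out the smooth ones; otherwise [dom] is everything. *)
Record evenAlg (K : nzRingType) := EvenAlg {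
  carrier :> lmodType K;
  dom : set carrier;
  mulx1 : carrier -> carrier;
  mulx2 : carrier -> carrier;
  der1 : carrier -> carrier;
  der2 : carrier -> carrier }.

Arguments dom {K} e _.
Arguments mulx1 {K} e _.
Arguments mulx2 {K} e _.
Arguments der1 {K} e _.
Arguments der2 {K} e _.

(* f : super E stands for the sum over c, d of  f c d * x3^c * x4^d. *)
Notation super E := (bool -> bool -> E).

Section Coordinates.
Variables (K : nzRingType) (E : evenAlg K).
Implicit Type f : super E.

Definition X1 f : super E := fun c d => mulx1 E (f c d).
Definition X2 f : super E := fun c d => mulx2 E (f c d).
Definition D1 f : super E := fun c d => der1 E (f c d).
Definition D2 f : super E := fun c d => der2 E (f c d).

Definition X3 f : super E := fun c d => if c then f false d else 0.
(* x4 x3 = - x3 x4 *)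
Definition X4 f : super E :=
  fun c d => if d then (-1) ^+ c *: f c false else 0.
Definition D3 f : super E := fun c d => if c then 0 else f true d.
(* left derivative: it passes over x3 with a sign *)
Definition D4 f : super E :=
  fun c d => if d then 0 else (-1) ^+ c *: f c true.

Definition Xop (i : 'I_4) : super E -> super E :=
  nth id [:: X1; X2; X3; X4] i.
Definition Dop (i : 'I_4) : super E -> super E :=
  nth id [:: D1; D2; D3; D4] i.

End Coordinates.

Section JordanSuperalgebra.
Variables (R : realType) (al : R).

(* Coordinates in the basis e1, e2, xi, eta, in this order; an endomorphism
   is a matrix acting on column vectors. *)
Definition Dal := 'cV[R]_4.

Definition o1 : 'I_4 := inord 0.
Definition o2 : 'I_4 := inord 1.
Definition o3 : 'I_4 := inord 2.
Definition o4 : 'I_4 := inord 3.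

Definition basis (i : 'I_4) : Dal := delta_mx i 0.
Definition par (i : 'I_4) : bool := (2 <= i)%N.

(* Bilinear extension of  e_i e_i = e_i,  e_1 e_2 = 0,  e_i xi = xi / 2,
   e_i eta = eta / 2,  xi eta = e_1 + al e_2 = - eta xi. *)
Definition jprod (a b : Dal) : Dal :=
  let w := a o3 0 * b o4 0 - a o4 0 * b o3 0 in
    (a o1 0 * b o1 0 + w) *: basis o1
  + (a o2 0 * b o2 0 + al * w) *: basis o2
  + (2^-1 * ((a o1 0 + a o2 0) * b o3 0 + a o3 0 * (b o1 0 + b o2 0)))
      *: basis o3
  + (2^-1 * ((a o1 0 + a o2 0) * b o4 0 + a o4 0 * (b o1 0 + b o2 0)))
      *: basis o4.

Definition Lmx (a : Dal) : 'M[R]_4 :=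
  \matrix_(i, j) (jprod a (basis j)) i 0.

(* Homogeneous superderivation of parity p. *)
Definition hom_superder (p : bool) (T : 'M[R]_4) : Prop :=
  (forall i j, T i j != 0 -> par i (+) par j = p) /\
  (forall i (b : Dal),
     T *m jprod (basis i) b =
       jprod (T *m basis i) b
       + (-1) ^+ (p && par i) *: jprod (basis i) (T *m b)).

Definition superder (T : 'M[R]_4) : Prop :=
  exists T0 T1 : 'M[R]_4,
    [/\ hom_superder false T0, hom_superder true T1 & T = T0 + T1].

(* The element  (tkk_minus)^- + (L_(tkk_L) + tkk_der) + (tkk_plus)^+  of
   D^- (+) ({L_a} (+) Der) (+) D^+. *)
Record tkk := TKK {
  tkk_minus : Dal;
  tkk_L : Dal;
  tkk_der : 'M[R]_4;
  tkk_plus : Dal;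
  tkk_derP : superder tkk_der }.

End JordanSuperalgebra.

Section Actions.
Variables (R : realType) (al lam : R).
Local Notation C := (R[i]).
Variable E : evenAlg C.
Implicit Type f : super E.

Definition bessel1 f : super E :=
  let g := D1 f in
  - (lam%:C *: g) + X1 (D1 g) + X3 (D3 g) + X4 (D4 g)
  - (2 * al)%:C *: X2 (D3 (D4 f)).

Definition bessel2 f : super E :=
  let g := D2 f in
  - ((lam / al)%:C *: g) + X2 (D2 g) + X3 (D3 g) + X4 (D4 g)
  - 2 *: X1 (D3 (D4 f)).

Definition bessel3 f : super E :=
  let g := D4 f in
  - ((2 * lam)%:C *: g) + 2 *: X1 (D1 g) + (2 * al)%:C *: X2 (D2 g)
  + (2 * (1 + al))%:C *: X3 (D3 g) + X3 (D1 (D2 f)).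

Definition bessel4 f : super E :=
  let g := D3 f in
  (2 * lam)%:C *: g - 2 *: X1 (D1 g) - (2 * al)%:C *: X2 (D2 g)
  - (2 * (1 + al))%:C *: X4 (D4 g) + X4 (D1 (D2 f)).

Definition besselop (i : 'I_4) : super E -> super E :=
  nth id [:: bessel1; bessel2; bessel3; bessel4] i.

Definition zmul (a : Dal R) f : super E :=
  \sum_(i < 4) (a i 0)%:C *: Xop i f.
Definition bessel (a : Dal R) f : super E :=
  \sum_(i < 4) (a i 0)%:C *: besselop i f.

(* The superderivation with  z_b |-> z_(T b),  i.e. the operator
   sum_j z_(T e_j) d_j. *)
Definition derT (T : 'M[R]_4) f : super E :=
  \sum_(i < 4) \sum_(j < 4) (T i j)%:C *: Xop i (Dop j f).

Definition lamL (a : Dal R) : R :=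
  a o1 0 * (lam / 2) + a o2 0 * (lam / (2 * al)).

Definition piL (a : Dal R) f : super E :=
  (lamL a)%:C *: f - derT (Lmx al a) f.

Definition piact (X : tkk al) f : super E :=
  - (2 * 'i%C) *: zmul (tkk_minus X) f
  + piL (tkk_L X) f + derT (tkk_der X) f
  - ('i%C / 2) *: bessel (tkk_plus X) f.

Definition rhoact (X : tkk al) f : super E :=
    (- ('i%C / 2) *: (zmul (tkk_minus X) f + bessel (tkk_minus X) f)
     + 'i%C *: piL (tkk_minus X) f)
  + 2^-1 *: (zmul (tkk_L X) f - bessel (tkk_L X) f)
  + derT (tkk_der X) f
  + (- ('i%C / 2) *: (zmul (tkk_plus X) f + bessel (tkk_plus X) f)
     - 'i%C *: piL (tkk_plus X) f).

(* The ideal generated by I_lam.  The generators are homogeneous, so by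
   supercommutativity their left ideal is two-sided; the branch [else] is used
   for lam = 1 != al. *)
Definition ideal : set (super E) := [set f |
  exists h1 h2 h3 h4 : super E,
    (forall c d, [/\ dom E (h1 c d), dom E (h2 c d), dom E (h3 c d)
                   & dom E (h4 c d)]) /\
    f = if lam == al then
          (2 *: X1 (X2 h1) + X3 (X4 h1))
          + X2 (X2 h2) + X2 (X3 h3) + X2 (X4 h4)
        else
          ((2 * al)%:C *: X1 (X2 h1) + X3 (X4 h1))
          + X1 (X1 h2) + X1 (X3 h3) + X1 (X4 h4)].

Definition eqmod f g : Prop := ideal (f - g).

End Actions.

Section Models.
Variable R : realType.
Local Notation C := (R[i]).
Local Notation i0 := (ord0 : 'I_2).
Local Notation i1 := (ord_max : 'I_2).

Definition polyE : evenAlg C :=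
  @EvenAlg C (mpoly.mpoly 2 C) setT
    (fun p => mpoly.mpolyX C (mpoly.mnm1 i0) * p)
    (fun p => mpoly.mpolyX C (mpoly.mnm1 i1) * p)
    (mpoly.mderiv i0) (mpoly.mderiv i1).

(* C[[x1, x2]]: s a b is the coefficient of x1^a x2^b. *)
Definition serE : evenAlg C :=
  @EvenAlg C (nat -> nat -> C^o) setT
    (fun s a b => if a is a'.+1 then s a' b else 0)
    (fun s a b => if b is b'.+1 then s a b' else 0)
    (fun s a b => s a.+1 b *+ a.+1)
    (fun s a b => s a b.+1 *+ b.+1).

Definition rpder (i : bool) (f : R -> R -> R) : R -> R -> R :=
  if i then fun x y => derive1 (f x) y
  else fun x y => derive1 (fun t => f t y) x.

Definition rsmooth (f : R -> R -> R) : Prop :=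
  forall w : seq bool, let g := foldr rpder f w in
    continuous (fun u : R * R => g u.1 u.2) /\
    forall x y, derivable (fun t => g t y) x 1 /\ derivable (g x) y 1.

Definition csmooth (f : R -> R -> C) : Prop :=
  rsmooth (fun x y => complex.Re (f x y)) /\
  rsmooth (fun x y => complex.Im (f x y)).

Definition cpder (i : bool) (f : R -> R -> C) : R -> R -> C := fun x y =>
  rpder i (fun x' y' => complex.Re (f x' y')) x y
  +i* rpder i (fun x' y' => complex.Im (f x' y')) x y.

Definition smoothE : evenAlg C :=
  @EvenAlg C (R -> R -> C^o) [set f | csmooth f]
    (fun f x y => x%:C * f x y)
    (fun f x y => y%:C * f x y)
    (cpder false) (cpder true).

Definition mono (a b : nat) : mpoly.multinom 2 := mpoly.Multinom [tuple a; b].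

Definition polymono (a b : nat) (c d : bool) : super polyE :=
  fun c' d' =>
    if (c' == c) && (d' == d) then mpoly.mpolyX C (mono a b) else 0.

Definition pone : super polyE := polymono 0 0 false false.

(* Complex conjugation of the coefficients. *)
Definition pconj (p : super polyE) : super polyE :=
  fun c d => mpoly.map_mpoly (@conjc R) (p c d).

Definition scvg (u : nat -> super serE) (s : super serE) : Prop :=
  forall c d a b,
    (fun n => complex.Re (u n c d a b)) @ \oo --> complex.Re (s c d a b) /\
    (fun n => complex.Im (u n c d a b)) @ \oo --> complex.Im (s c d a b).

Definition taylor (f : super smoothE) : super serE := fun c d a b =>
  (iter a (cpder false) (iter b (cpder true) (f c d))) 0 0
    / (a`! * b`!)%:R.

(* The power series  e^(- x1 - x2) p. *)
Definition expmul (p : super polyE) : super serE := fun c d a b =>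
  \sum_(i < a.+1) \sum_(j < b.+1)
    ((-1) ^+ (i + j) / (i`! * j`!)%:R) *
    mpoly.mcoeff (mono (a - i) (b - j)) (p c d).

(* The function  e^(-2 (x1 + x2)) p. *)
Definition expfun (p : super polyE) : super smoothE := fun c d x y =>
  mpoly.meval (fun k : 'I_2 => if k == i0 then x%:C else y%:C) (p c d)
    * (expR (- 2 * (x + y)))%:C.

End Models.

Section SegalBargmann.
Variables (R : realType) (al lam : R).
Local Notation C := (R[i]).
Local Notation P := (super (polyE R)).

(* Representatives of the elements of the rho-submodule of P / I_lam
   generated by 1. *)
Inductive inF : P -> Prop :=
| inF_one : inF (pone R)
| inF_add p q : inF p -> inF q -> inF (p + q)
| inF_scale (k : C) p : inF p -> inF (k *: p)
| inF_rho (X : tkk al) p : inF p -> inF (rhoact lam X p)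
| inF_mod p q : inF p -> eqmod al lam p q -> inF q.

(* Smooth superfunctions representing an element of W_lam. *)
Definition inW (f : super (smoothE R)) : Prop :=
  exists p : P, eqmod al lam f (expfun p).

(* q |-> p(B) q, obtained from p by  z_i |-> B_lam(z_i). *)
Definition poly_bessel (p : P) (q : P) : P :=
  \sum_(c : bool) \sum_(d : bool)
    let r := iter c (bessel3 al lam (E := polyE R))
               (iter d (bessel4 al lam (E := polyE R)) q) in
    \sum_(m <- mpoly.msupp (p c d))
      mpoly.mcoeff m (p c d) *:
        iter (m ord0) (bessel1 al lam (E := polyE R))
          (iter (m ord_max) (bessel2 al lam (E := polyE R)) r).

(* The Bessel-Fischer product  p(B) (conj q) |_0. *)
Definition BF (p q : P) : C :=
  mpoly.mcoeff (mono 0 0) (poly_bessel p (pconj q) false false).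

(* A kernel K(z, x) is a formal sum of monomials in x with coefficients in
   C[z1, z2] (x) Lambda(z3, z4); the factor in x is written on the left, so that
   p(B) acting in x meets no sign. *)
Definition kernel := nat * nat * bool * bool -> P.

(* <p, K(z, .)>_B in the variable x.  Since B lowers the degree, only finitely
   many terms are nonzero; [pconj] is the conjugation of K in its
   z-coefficients, the one on monomials in x being part of [BF]. *)
Definition BFkernel (p : P) (K : kernel) : P :=
  \sum_(m \in [set: nat * nat * bool * bool])
    BF p (polymono R m.1.1.1 m.1.1.2 m.1.2 m.2) *: pconj (K m).

Definition reproducing (K : kernel) : Prop :=
  forall p : P, inF p -> eqmod al lam (BFkernel p K) p.

Definition repker : kernel := xget (fun=> 0) [set K | reproducing K].

(* s represents the limit of the class of u n in the quotient by I_lam of the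
   formal power series superspace, for coefficientwise convergence. *)
Definition qcvg (u : nat -> super (serE R)) (s : super (serE R)) : Prop :=
  exists v : nat -> super (serE R),
    (forall n, eqmod al lam (v n) (u n)) /\ scvg v s.

(* s represents
   exp(- (B(x1) + B(x2)) / 2) exp(- x1 - x2) p  modulo I_lam. *)
Definition Cinv (p : P) (s : super (serE R)) : Prop :=
  qcvg (fun N => \sum_(n < N)
          ((- 2^-1) ^+ n / n`!%:R : C) *:
            iter n (fun g => bessel1 al lam g + bessel2 al lam g) (expmul p))
       s.

(* pi_lam(C): the inverse of the bijection F_lam -> W_lam given by [Cinv]. *)
Definition piC (f : super (smoothE R)) : P :=
  xget 0 [set p | inF p /\ Cinv p (taylor f)].

Definition SB (f : super (smoothE R)) : P := BFkernel (piC f) repker.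

End SegalBargmann.

(* Main.v *)
Require Import Defs.
From mathcomp Require Import all_boot all_order all_algebra.
From mathcomp Require Import complex.
From mathcomp Require Import all_classical all_reals all_analysis.
From mathcomp Require Import ring lra.
From mathcomp Require mpoly.
Import -(notations) mpoly.

(** Why the transform intertwines pi and rho.  Let e = e1 + e2 be the unit of the
Jordan superalgebra and B_e = B(z1) + B(z2), which is [bessel_e].  For every
lambda, and before passing to the quotient by the ideal,

  [B_e, z_a] = - 2 pi(L_a),   [B_e, pi(L_a)] = - B(z_a),
  [B_e, B(z_a)] = 0,          [B_e, d_D] = 0 for a derivation D

([bessel_e_zmul], [bessel_e_piL], [bessel_e_bessel], [bessel_e_derT]).  The
inverse transform is multiplication by e^(- x1 - x2) followed by
exp(- B_e / 2).  The first step conjugates d1 and d2 to d1 + 1 and d2 + 1; this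
replaces B(z_a) by B(z_a) - 2 pi(L_a) + z_a and pi(L_a) by pi(L_a) - z_a, and
leaves z_a and d_D alone ([expmul_rhoact]).  By the relations above, commutators
with B_e vanish after two steps, so the second step replaces z_a by
z_a + pi(L_a) + B(z_a) / 4 and pi(L_a) by pi(L_a) + B(z_a) / 2.  Substituting,
rho(X) becomes exactly pi(X) ([expsum_twrho], [Cinv_rhoact]).  For the partial
sums E_N of the exponential series the second step has the exact form

  E_(N+2) Y = Y E_(N+2) - (1/2) [B_e, Y] E_(N+1) + (1/8) [B_e, [B_e, Y]] E_N

([expsum_comm]), which passes to the limit by continuity alone.

It remains to see that the inverse transform is a bijection modulo the ideal.
All computations take place in formal power series: superpolynomials are
included there, and smooth superfunctions are sent there by their Taylor series
at 0, which commutes with the action because mixed partial derivatives are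
symmetric ([schwarz]).  The quotient of the power series by the ideal has
explicit coordinates [qcoord]; their common kernel [nullclass] is the ideal, for
series ([ideal_nullclass], [nullclass_ideal]) and for polynomials
([nullclass_toser_ideal]), and convergence modulo the ideal is convergence of
coordinates ([qcvgP]).  In these coordinates B_e acts on e^(- x1 - x2) by falling
factorials of a number mu, where mu = al if lambda = al and mu = 1 / al if
lambda = 1.  Hence the exponential series of 1 is governed by the
binomial series of (1 - 1/2)^(mu - k), and

  1 is sent to (1/2) b(mu) e^(- 2 (x1 + x2)),   b(mu) <> 0

([Cinv_one], [blim_neq0]).  Multiplication by z_a and B(z_a) are combinations of
operators rho(X) ([zmul_rho], [bessel_rho]), so 1 generates all superpolynomials
([inF_all]).  The image is stable under pi, in particular under multiplication by
the coordinates, and contains e^(- 2 (x1 + x2)), so it contains W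
([Cinv_surjective]).  The kernel is stable under z_a and B(z_a); if it contained
a nonzero class, these operators would bring this class down to a nonzero
constant, because mu is not a natural number ([K_pure], [K_lower]), and 1 is
not in the kernel ([Cinv_injective]).

So pi(C) is well defined modulo the ideal and carries pi to rho
([piC_intertwines]).  Pairing with a reproducing kernel does not change the class
of a superpolynomial ([SB_piC]), so the same holds for the transform;
without a reproducing kernel it is zero ([SB_trivial]). *)

Set Implicit Arguments.
Unset Strict Implicit.
Unset Printing Implicit Defensive.

Import Order.TTheory GRing.Theory Num.Theory.
Import numFieldNormedType.Exports.

Local Open Scope classical_set_scope.
Local Open Scope complex_scope.
Local Open Scope ring_scope.

(** * Bessel operators on formal power series *)
Section SeriesOperators.
Variable R : realType.
Local Notation C := (R[i]).
Local Notation S := (super (serE R)).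
Implicit Types (f g : S).

Lemma superP f g : (forall c d a b, f c d a b = g c d a b) -> f = g.
Proof.
move=> fg; apply/funext => c; apply/funext => d.
by apply/funext => a; apply/funext => b.
Qed.

Lemma ev_add f g c d a b : (f + g) c d a b = f c d a b + g c d a b.
Proof. by []. Qed.
Lemma ev_opp f c d a b : (- f) c d a b = - f c d a b.
Proof. by []. Qed.
Lemma ev_scale (k : C) f c d a b : (k *: f) c d a b = k * f c d a b.
Proof. by []. Qed.
Lemma ev_X1_0 f c d b : X1 f c d 0%N b = 0. Proof. by []. Qed.
Lemma ev_X1_S f c d a b : X1 f c d a.+1 b = f c d a b. Proof. by []. Qed.
Lemma ev_X2_0 f c d a : X2 f c d a 0%N = 0. Proof. by []. Qed.
Lemma ev_X2_S f c d a b : X2 f c d a b.+1 = f c d a b. Proof. by []. Qed.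
Lemma ev_D1 f c d a b : D1 f c d a b = a.+1%:R * f c d a.+1 b.
Proof. by rewrite mulr_natl. Qed.
Lemma ev_D2 f c d a b : D2 f c d a b = b.+1%:R * f c d a b.+1.
Proof. by rewrite mulr_natl. Qed.
Lemma ev_X3_0 f d a b : X3 f false d a b = 0. Proof. by []. Qed.
Lemma ev_X3_1 f d a b : X3 f true d a b = f false d a b. Proof. by []. Qed.
Lemma ev_D3_1 f d a b : D3 f true d a b = 0. Proof. by []. Qed.
Lemma ev_D3_0 f d a b : D3 f false d a b = f true d a b. Proof. by []. Qed.
Lemma ev_X4_0 f c a b : X4 f c false a b = 0. Proof. by []. Qed.
Lemma ev_X4_01 f a b : X4 f false true a b = f false false a b.
Proof. by rewrite /X4 expr0 scale1r. Qed.
Lemma ev_X4_11 f a b : X4 f true true a b = - f true false a b.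
Proof. by rewrite /X4 expr1 scaleN1r. Qed.
Lemma ev_D4_1 f c a b : D4 f c true a b = 0. Proof. by []. Qed.
Lemma ev_D4_00 f a b : D4 f false false a b = f false true a b.
Proof. by rewrite /D4 expr0 scale1r. Qed.
Lemma ev_D4_10 f a b : D4 f true false a b = - f true true a b.
Proof. by rewrite /D4 expr1 scaleN1r. Qed.

(** The matching is on the exponents: a component at an unknown exponent of x1
or x2 is evaluated after a case distinction between 0 and a successor. *)
Definition evE := (ev_add, ev_opp, ev_scale, ev_X1_0, ev_X1_S, ev_X2_0,
  ev_X2_S, ev_D1, ev_D2, ev_X3_0, ev_X3_1, ev_D3_0, ev_D3_1, ev_X4_0,
  ev_X4_01, ev_X4_11, ev_D4_1, ev_D4_00, ev_D4_10).

Variables al lam : R.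

Definition bessel_e f : S := bessel1 al lam f + bessel2 al lam f.

(** The operators pi(L_a) for a = e1, e2, xi, eta; they are written out so that
their commutators can be computed component by component, and [piL_pi_Lop]
identifies them with the invariant definition. *)
Definition pi_L1 f : S :=
  (lam / 2)%:C *: f - X1 (D1 f) - 2^-1 *: (X3 (D3 f) + X4 (D4 f)).
Definition pi_L2 f : S :=
  (lam / (2 * al))%:C *: f - X2 (D2 f) - 2^-1 *: (X3 (D3 f) + X4 (D4 f)).
Definition pi_L3 f : S :=
  - (2^-1 *: (X3 (D1 f) + X3 (D2 f))) - (X1 (D4 f) + al%:C *: X2 (D4 f)).
Definition pi_L4 f : S :=
  - (2^-1 *: (X4 (D1 f) + X4 (D2 f))) + (X1 (D3 f) + al%:C *: X2 (D3 f)).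
Definition pi_Lop (i : 'I_4) : S -> S := nth id [:: pi_L1; pi_L2; pi_L3; pi_L4] i.

End SeriesOperators.

Ltac ser_unfold := rewrite /bessel_e /pi_L1 /pi_L2 /pi_L3 /pi_L4 /bessel1 /bessel2 /bessel3
 /bessel4.

(** * Commutators with the Bessel operator of the unit *)
Section Commutators.
Variable R : realType.
Local Notation C := (R[i]).
Local Notation S := (super (serE R)).
Implicit Types (f g : S).
Variables al lam : R.
Hypothesis al0 : al != 0.
Local Notation Be := (bessel_e al lam).

Lemma alC_neq0 : al%:C != 0 :> C.
Proof. by rewrite (inj_eq (@complexI R)). Qed.

Ltac component a b := ser_unfold; case: a => [|a]; case: b => [|b]; rewrite !evE; ring.
Lemma bessel1_00 f a b : bessel1 al lam f false false a b =
  a.+1%:R * (a%:R - lam%:C) * f false false a.+1 b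
  + 2 * al%:C * X2 f true true a b.
Proof. component a b. Qed.
Lemma bessel1_10 f a b : bessel1 al lam f true false a b =
  a.+1%:R * (a%:R + 1 - lam%:C) * f true false a.+1 b.
Proof. component a b. Qed.
Lemma bessel1_01 f a b : bessel1 al lam f false true a b =
  a.+1%:R * (a%:R + 1 - lam%:C) * f false true a.+1 b.
Proof. component a b. Qed.
Lemma bessel1_11 f a b : bessel1 al lam f true true a b =
  a.+1%:R * (a%:R + 2 - lam%:C) * f true true a.+1 b.
Proof. component a b. Qed.

Lemma bessel2_00 f a b : bessel2 al lam f false false a b =
  b.+1%:R * (b%:R - (lam / al)%:C) * f false false a b.+1
  + 2 * X1 f true true a b.
Proof. component a b. Qed.
Lemma bessel2_10 f a b : bessel2 al lam f true false a b =
  b.+1%:R * (b%:R + 1 - (lam / al)%:C) * f true false a b.+1.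
Proof. component a b. Qed.
Lemma bessel2_01 f a b : bessel2 al lam f false true a b =
  b.+1%:R * (b%:R + 1 - (lam / al)%:C) * f false true a b.+1.
Proof. component a b. Qed.
Lemma bessel2_11 f a b : bessel2 al lam f true true a b =
  b.+1%:R * (b%:R + 2 - (lam / al)%:C) * f true true a b.+1.
Proof. component a b. Qed.

Lemma bessel3_00 f a b : bessel3 al lam f false false a b =
  2 * (a%:R + al%:C * b%:R - lam%:C) * f false true a b.
Proof. component a b. Qed.
Lemma bessel3_10 f a b : bessel3 al lam f true false a b =
  - 2 * (a%:R + al%:C * b%:R - lam%:C + 1 + al%:C) * f true true a b
  + a.+1%:R * b.+1%:R * f false false a.+1 b.+1.
Proof. component a b. Qed.
Lemma bessel3_01 f a b : bessel3 al lam f false true a b = 0.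
Proof. component a b. Qed.
Lemma bessel3_11 f a b : bessel3 al lam f true true a b =
  a.+1%:R * b.+1%:R * f false true a.+1 b.+1.
Proof. component a b. Qed.

Lemma bessel4_00 f a b : bessel4 al lam f false false a b =
  - 2 * (a%:R + al%:C * b%:R - lam%:C) * f true false a b.
Proof. component a b. Qed.
Lemma bessel4_01 f a b : bessel4 al lam f false true a b =
  - 2 * (a%:R + al%:C * b%:R - lam%:C + 1 + al%:C) * f true true a b
  + a.+1%:R * b.+1%:R * f false false a.+1 b.+1.
Proof. component a b. Qed.
Lemma bessel4_10 f a b : bessel4 al lam f true false a b = 0.
Proof. component a b. Qed.
Lemma bessel4_11 f a b : bessel4 al lam f true true a b =
  - a.+1%:R * b.+1%:R * f true false a.+1 b.+1.
Proof. component a b. Qed.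

Definition besselE := (bessel1_00, bessel1_10, bessel1_01, bessel1_11,
 bessel2_00, bessel2_10, bessel2_01, bessel2_11,
 bessel3_00, bessel3_10, bessel3_01, bessel3_11,
 bessel4_00, bessel4_10, bessel4_01, bessel4_11).

Lemma pi_L1_E f c d a b : pi_L1 lam f c d a b =
  (2^-1 * (lam%:C - (if c then 1 else 0) - (if d then 1 else 0)) - a%:R)
  * f c d a b.
Proof.
by ser_unfold; case: c; case: d; case: a => [|a]; rewrite !evE rmorphM /=
  fmorphV rmorphMn; field.
Qed.
Lemma pi_L2_E f c d a b : pi_L2 al lam f c d a b =
  (2^-1 * ((lam / al)%:C - (if c then 1 else 0) - (if d then 1 else 0)) - b%:R)
  * f c d a b.
Proof.
have E : (lam / (2 * al))%:C = 2^-1 * (lam / al)%:C :> C.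
  by rewrite invfM mulrCA rmorphM fmorphV rmorphMn.
rewrite /pi_L2 {}E; move: ((lam / al)%:C) => q.
by case: c; case: d; case: b => [|b]; rewrite !evE /=; field.
Qed.
Lemma pi_L3_00 f a b : pi_L3 al f false false a b =
  - X1 f false true a b - al%:C * X2 f false true a b.
Proof. component a b. Qed.
Lemma pi_L3_10 f a b : pi_L3 al f true false a b =
  X1 f true true a b + al%:C * X2 f true true a b
  - 2^-1 * (a.+1%:R * f false false a.+1 b + b.+1%:R * f false false a b.+1).
Proof. component a b. Qed.
Lemma pi_L3_01 f a b : pi_L3 al f false true a b = 0.
Proof. component a b. Qed.
Lemma pi_L3_11 f a b : pi_L3 al f true true a b =
  - 2^-1 * (a.+1%:R * f false true a.+1 b + b.+1%:R * f false true a b.+1).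
Proof. component a b. Qed.
Lemma pi_L4_00 f a b : pi_L4 al f false false a b =
  X1 f true false a b + al%:C * X2 f true false a b.
Proof. component a b. Qed.
Lemma pi_L4_01 f a b : pi_L4 al f false true a b =
  X1 f true true a b + al%:C * X2 f true true a b
  - 2^-1 * (a.+1%:R * f false false a.+1 b + b.+1%:R * f false false a b.+1).
Proof. component a b. Qed.
Lemma pi_L4_10 f a b : pi_L4 al f true false a b = 0.
Proof. component a b. Qed.
Lemma pi_L4_11 f a b : pi_L4 al f true true a b =
  2^-1 * (a.+1%:R * f true false a.+1 b + b.+1%:R * f true false a b.+1).
Proof. component a b. Qed.
Definition pi_LE := (pi_L1_E, pi_L2_E, pi_L3_00, pi_L3_10, pi_L3_01, pi_L3_11,
  pi_L4_00, pi_L4_10, pi_L4_01, pi_L4_11).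

Lemma bessel_e_ev f c d a b : Be f c d a b = bessel1 al lam f c d a b + bessel2 al lam f c d a b.
Proof. by []. Qed.

Definition lam_ratio := (lam / al)%:C : C.
Lemma lam_ratioE : lam%:C = al%:C * lam_ratio.
Proof. by rewrite -rmorphM mulrC divfK. Qed.

Ltac split_components c d :=
  rewrite ?(ev_add, ev_opp, ev_scale);
  case: c; case: d; rewrite ?(bessel_e_ev, besselE, pi_LE).
Ltac polynomial_identity :=
  rewrite ?evE ?(bessel_e_ev, besselE, pi_LE) ?evE;
  (* With lam written as al times lam / al the identities are polynomial. *)
  rewrite -/lam_ratio ?lam_ratioE; field; exact: alC_neq0.
(* Multiplication by x_i shifts the exponents, so that in the commutators with
   x_i the exponent 1 is special as well as 0. *)
Ltac commutator2 :=
  let c := fresh "c" in let d := fresh "d" in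
  let a := fresh "a" in let b := fresh "b" in
  apply: superP => c d a b; split_components c d;
  case: a => [|[|a]]; case: b => [|[|b]]; polynomial_identity.
Ltac commutator1 :=
  let c := fresh "c" in let d := fresh "d" in
  let a := fresh "a" in let b := fresh "b" in
  apply: superP => c d a b; split_components c d;
  case: a => [|a]; case: b => [|b]; polynomial_identity.

(** The relations of this group hold for all values of the parameter, so no
reduction modulo the ideal is involved.  They are the brackets of e^+ with a^-,
L_a, a^+ in the Lie superalgebra, up to scalars. *)
Lemma bessel_e_X1 f : Be (X1 f) = X1 (Be f) - 2 *: pi_L1 lam f.
Proof. commutator2. Qed.
Lemma bessel_e_X2 f : Be (X2 f) = X2 (Be f) - 2 *: pi_L2 al lam f.
Proof. commutator2. Qed.
Lemma bessel_e_X3 f : Be (X3 f) = X3 (Be f) - 2 *: pi_L3 al f.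
Proof. commutator2. Qed.
Lemma bessel_e_X4 f : Be (X4 f) = X4 (Be f) - 2 *: pi_L4 al f.
Proof. commutator2. Qed.
Lemma bessel_e_piL1 f : Be (pi_L1 lam f) = pi_L1 lam (Be f) - bessel1 al lam f.
Proof. commutator1. Qed.
Lemma bessel_e_piL2 f : Be (pi_L2 al lam f) = pi_L2 al lam (Be f) - bessel2 al lam f.
Proof. commutator1. Qed.
Lemma bessel_e_piL3 f : Be (pi_L3 al f) = pi_L3 al (Be f) - bessel3 al lam f.
Proof. commutator1. Qed.
Lemma bessel_e_piL4 f : Be (pi_L4 al f) = pi_L4 al (Be f) - bessel4 al lam f.
Proof. commutator1. Qed.
Lemma bessel_e_bessel1 f : Be (bessel1 al lam f) = bessel1 al lam (Be f).
Proof. commutator1. Qed.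
Lemma bessel_e_bessel2 f : Be (bessel2 al lam f) = bessel2 al lam (Be f).
Proof. commutator1. Qed.
Lemma bessel_e_bessel3 f : Be (bessel3 al lam f) = bessel3 al lam (Be f).
Proof. commutator1. Qed.
Lemma bessel_e_bessel4 f : Be (bessel4 al lam f) = bessel4 al lam (Be f).
Proof. commutator1. Qed.
End Commutators.

Lemma o1E : o1 = ord0.
Proof. by apply/val_inj; rewrite /= inordK. Qed.
Lemma o2E : o2 = lift ord0 ord0.
Proof. by apply/val_inj; rewrite /= inordK. Qed.
Lemma o3E : o3 = lift ord0 (lift ord0 ord0).
Proof. by apply/val_inj; rewrite /= inordK. Qed.
Lemma o4E : o4 = lift ord0 (lift ord0 (lift ord0 ord0)).
Proof. by apply/val_inj; rewrite /= inordK. Qed.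
Definition oE := (o1E, o2E, o3E, o4E).

Lemma forall_ord4 (P : 'I_4 -> Prop) :
  P o1 -> P o2 -> P o3 -> P o4 -> forall i, P i.
Proof.
rewrite !oE => p1 p2 p3 p4 [[|[|[|[|m]]]] lt] //;
 [move: p1|move: p2|move: p3|move: p4]; congr P; exact/val_inj.
Qed.

Section OpIndex.
Variable R : realType.
Local Notation C := (R[i]).
Variables (E : evenAlg C) (al lam : R).
Lemma Xop_o : (Xop (E := E) o1 = @X1 _ E) * (Xop (E := E) o2 = @X2 _ E)
  * (Xop (E := E) o3 = @X3 _ E) * (Xop (E := E) o4 = @X4 _ E).
Proof. by rewrite !oE. Qed.
Lemma Dop_o : (Dop (E := E) o1 = @D1 _ E) * (Dop (E := E) o2 = @D2 _ E)
  * (Dop (E := E) o3 = @D3 _ E) * (Dop (E := E) o4 = @D4 _ E).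
Proof. by rewrite !oE. Qed.
Lemma besselop_o : (besselop al lam (E := E) o1 = @bessel1 R al lam E)
  * (besselop al lam (E := E) o2 = @bessel2 R al lam E)
  * (besselop al lam (E := E) o3 = @bessel3 R al lam E)
  * (besselop al lam (E := E) o4 = @bessel4 R al lam E).
Proof. by rewrite !oE. Qed.
Lemma pi_Lop_o : (pi_Lop al lam o1 = @pi_L1 R lam) * (pi_Lop al lam o2 = @pi_L2 R al lam)
  * (pi_Lop al lam o3 = @pi_L3 R al) * (pi_Lop al lam o4 = @pi_L4 R al).
Proof. by rewrite !oE. Qed.
End OpIndex.

Section JordanCommutators.
Variable R : realType.
Local Notation C := (R[i]).
Local Notation S := (super (serE R)).
Implicit Types (f g : S).
Variables al lam : R.
Hypothesis al0 : al != 0.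
Local Notation Be := (bessel_e al lam).
Lemma bessel_eD f g : Be (f + g) = Be f + Be g.
Proof.
apply: superP => c d a b; rewrite !(ev_add, bessel_e_ev).
case: c; case: d; rewrite !besselE; case: a => [|a]; case: b => [|b];
  rewrite !evE; move: (_%:C) => q; ring.
Qed.
Lemma bessel_eZ k f : Be (k *: f) = k *: Be f.
Proof.
apply: superP => c d a b; rewrite !(ev_scale, bessel_e_ev).
case: c; case: d; rewrite !besselE; case: a => [|a]; case: b => [|b];
  rewrite !evE; move: (_%:C) => q; ring.
Qed.
Lemma bessel_e_sum (I : Type) (r : seq I) (F : I -> S) :
  Be (\sum_(i <- r) F i) = \sum_(i <- r) Be (F i).
Proof.
apply: (big_morph Be bessel_eD).
by have := bessel_eZ 0 0; rewrite !scale0r.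
Qed.

Lemma LmxE (u : Dal R) i j : Lmx al u i j = jprod al u (Defs.basis R j) i 0.
Proof. by rewrite /Lmx mxE. Qed.

Lemma jprodE (u v : Dal R) i : jprod al u v i 0 =
  (u o1 0 * v o1 0 + (u o3 0 * v o4 0 - u o4 0 * v o3 0)) * (i == o1)%:R +
  (u o2 0 * v o2 0 + al * (u o3 0 * v o4 0 - u o4 0 * v o3 0)) * (i == o2)%:R +
  2^-1 * ((u o1 0 + u o2 0) * v o3 0 + u o3 0 * (v o1 0 + v o2 0)) * (i == o3)%:R +
  2^-1 * ((u o1 0 + u o2 0) * v o4 0 + u o4 0 * (v o1 0 + v o2 0)) * (i == o4)%:R.
Proof. by rewrite /jprod /Defs.basis !mxE eqxx !andbT. Qed.

Lemma basisE (i j : 'I_4) : Defs.basis R j i 0 = (i == j)%:R.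
Proof. by rewrite /Defs.basis mxE eqxx andbT. Qed.

Lemma Lmx_val (u : Dal R) (i j : 'I_4) : Lmx al u i j =
  nth 0 (nth [::] [::
    [:: u o1 0; 0; - u o4 0; u o3 0];
    [:: 0; u o2 0; - (al * u o4 0); al * u o3 0];
    [:: 2^-1 * u o3 0; 2^-1 * u o3 0; 2^-1 * (u o1 0 + u o2 0); 0];
    [:: 2^-1 * u o4 0; 2^-1 * u o4 0; 0; 2^-1 * (u o1 0 + u o2 0)]] i) j.
Proof.
rewrite LmxE jprodE !basisE.
move: i j; apply: forall_ord4; apply: forall_ord4;
 rewrite !oE; move: (u _ _) (u _ _) (u _ _) (u _ _) => ? ? ? ? /=; ring.
Qed.

Lemma ev_0 c d a b : (0 : S) c d a b = 0. Proof. by []. Qed.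

Lemma complex_add (x y : R) : (x + y)%:C = x%:C + y%:C :> C.
Proof. exact: rmorphD. Qed.
Lemma complex_mul (x y : R) : (x * y)%:C = x%:C * y%:C :> C.
Proof. exact: rmorphM. Qed.
Lemma complex_opp (x : R) : (- x)%:C = - x%:C :> C.
Proof. exact: rmorphN. Qed.
Lemma complex_half : (2^-1)%:C = 2^-1 :> C.
Proof. by rewrite fmorphV rmorphMn. Qed.
Lemma complex_0 : 0%:C = 0 :> C. Proof. by []. Qed.
Definition real_castE := (complex_add, complex_mul, complex_opp, complex_half, complex_0).

Lemma piL_pi_Lop (u : Dal R) f :
  piL al lam u f = \sum_(i < 4) (u i 0)%:C *: pi_Lop al lam i f.
Proof.
rewrite /piL /derT !big_ord_recl !big_ord0 !Lmx_val /lamL !oE.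
move: (u _ 0) (u _ 0) (u _ 0) (u _ 0) => u3 u4 u2 u1.
rewrite /= /pi_Lop /Xop /Dop /=.
rewrite /pi_L1 /pi_L2 /pi_L3 /pi_L4.
apply: superP => c d a b.
rewrite !(ev_add, ev_opp, ev_scale, ev_0).
rewrite !real_castE.
repeat match goal with
| |- context [@X1 ?K ?E ?g c d a b] => move: (@X1 K E g c d a b) => ?
| |- context [@X2 ?K ?E ?g c d a b] => move: (@X2 K E g c d a b) => ?
| |- context [@X3 ?K ?E ?g c d a b] => move: (@X3 K E g c d a b) => ?
| |- context [@X4 ?K ?E ?g c d a b] => move: (@X4 K E g c d a b) => ?
end.
move: (lam%:C) ((2 * al)^-1%:C) (u1%:C) (u2%:C) (u3%:C) (u4%:C) => *.
ring.
Qed.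
Lemma bessel_e_zmul (u : Dal R) f :
  Be (zmul u f) = zmul u (Be f) - 2 *: piL al lam u f.
Proof.
rewrite /zmul bessel_e_sum piL_pi_Lop scaler_sumr -sumrB; apply: eq_bigr => i _.
rewrite bessel_eZ scalerA [2 * _]mulrC -scalerA -scalerBr; congr (_ *: _).
by move: i; apply: forall_ord4; rewrite ?Xop_o ?pi_Lop_o
  (bessel_e_X1 lam al0, bessel_e_X2 lam al0, bessel_e_X3 lam al0, bessel_e_X4 lam al0).
Qed.

Lemma bessel_e_piL (u : Dal R) f :
  Be (piL al lam u f) = piL al lam u (Be f) - bessel al lam u f.
Proof.
rewrite !piL_pi_Lop bessel_e_sum /bessel -sumrB; apply: eq_bigr => i _.
rewrite bessel_eZ -scalerBr; congr (_ *: _).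
by move: i; apply: forall_ord4; rewrite ?besselop_o ?pi_Lop_o
  (bessel_e_piL1 lam al0, bessel_e_piL2 lam al0, bessel_e_piL3 lam al0, bessel_e_piL4 lam al0).
Qed.

Lemma bessel_e_bessel (u : Dal R) f :
  Be (bessel al lam u f) = bessel al lam u (Be f).
Proof.
rewrite /bessel bessel_e_sum; apply: eq_bigr => i _.
rewrite bessel_eZ; congr (_ *: _).
by move: i; apply: forall_ord4; rewrite ?besselop_o
  (bessel_e_bessel1 lam al0, bessel_e_bessel2 lam al0,
   bessel_e_bessel3 lam al0, bessel_e_bessel4 lam al0).
Qed.
End JordanCommutators.

(** * Superderivations of the Jordan superalgebra *)
Section Superderivations.
Variable R : realType.
Variable al : R.

Lemma mulmx4E (T : 'M[R]_4) (v : Dal R) k : (T *m v) k 0 =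
  T k o1 * v o1 0 + T k o2 * v o2 0 + T k o3 * v o3 0 + T k o4 * v o4 0.
Proof. by rewrite mxE !big_ord_recl big_ord0 !oE addr0 !addrA. Qed.

Lemma hom_superder_entry p (T : 'M[R]_4) (i j k : 'I_4) :
  hom_superder al p T ->
  let w := jprod al (Defs.basis R i) (Defs.basis R j) in
  T k o1 * w o1 0 + T k o2 * w o2 0 + T k o3 * w o3 0 + T k o4 * w o4 0 =
  jprod al (T *m Defs.basis R i) (Defs.basis R j) k 0
  + (-1) ^+ (p && par i) * jprod al (Defs.basis R i) (T *m Defs.basis R j) k 0.
Proof.
move=> [_ /(_ i (Defs.basis R j)) /matrixP/(_ k 0)] /=.
by rewrite mulmx4E => ->; rewrite !mxE.
Qed.

Lemma mulmx_basis (T : 'M[R]_4) j k : (T *m Defs.basis R j) k 0 = T k j.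
Proof.
rewrite mulmx4E !basisE; move: j; apply: forall_ord4; rewrite !oE /=; ring.
Qed.

(** The columns are the images of e1, e2, xi, eta.  The parameters r, s, t give
sl_2 acting on the span of xi and eta; p and q give the multiples of the inner
derivations [L_(e1), L_xi] and [L_(e1), L_eta]. *)
Definition superder_mx (r s t p q : R) : 'M[R]_4 :=
  \matrix_(i, j) nth 0 (nth [::] [::
    [:: 0; 0; 2 * q; - (2 * p)];
    [:: 0; 0; - (2 * (al * q)); 2 * (al * p)];
    [:: p; - p; r; s];
    [:: q; - q; t; - r]] i) j.

Lemma par_o : (par o1 = false) * (par o2 = false) * (par o3 = true)
  * (par o4 = true).
Proof. by rewrite !oE. Qed.

Ltac entry h := move: h => /=; rewrite !jprodE !mulmx_basis !basisE
  ?par_o !oE /=; lra.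

(** Parity kills one half of the entries of each homogeneous part, and the
Leibniz rule on products of two basis vectors determines the others from five. *)
Lemma superderE (T : 'M[R]_4) : superder al T ->
  exists r s t p q, T = superder_mx r s t p q.
Proof.
move=> [T0 [T1 [h0 h1 ->]]].
have Z0 i j : par i (+) par j -> T0 i j = 0.
  by move=> ij; apply/eqP/negPn/negP => /(proj1 h0); rewrite ij.
have Z1 i j : ~~ (par i (+) par j) -> T1 i j = 0.
  by move=> ij; apply/eqP/negPn/negP => /(proj1 h1) ij1; rewrite ij1 in ij.
have E p (T' : 'M[R]_4) (i j k : 'I_4) (h : hom_superder al p T') :=
  hom_superder_entry i j k h.
have a11 : T0 o1 o1 = 0 by entry (E _ _ o1 o1 o1 h0).
have a21 : T0 o2 o1 = 0 by entry (E _ _ o1 o1 o2 h0).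
have a12 : T0 o1 o2 = 0 by entry (E _ _ o2 o2 o1 h0).
have a22 : T0 o2 o2 = 0 by entry (E _ _ o2 o2 o2 h0).
(* The product xi eta is in the span of e1 and e2, which T0 kills. *)
have a44 : T0 o4 o4 = - T0 o3 o3.
  by have := E _ _ o3 o4 o1 h0; rewrite /= a11 a12 => e; entry e.
(* T1 maps e1 e2 = 0 to 0. *)
have b32 : T1 o3 o2 = - T1 o3 o1 by entry (E _ _ o1 o2 o3 h1).
have b42 : T1 o4 o2 = - T1 o4 o1 by entry (E _ _ o1 o2 o4 h1).
have b13 : T1 o1 o3 = 2 * T1 o4 o1 by entry (E _ _ o1 o3 o1 h1).
have b14 : T1 o1 o4 = - (2 * T1 o3 o1) by entry (E _ _ o1 o4 o1 h1).
have b23 : T1 o2 o3 = - (2 * (al * T1 o4 o1)) by entry (E _ _ o1 o3 o2 h1).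
have b24 : T1 o2 o4 = 2 * (al * T1 o3 o1) by entry (E _ _ o1 o4 o2 h1).
exists (T0 o3 o3), (T0 o3 o4), (T0 o4 o3), (T1 o3 o1), (T1 o4 o1).
have z0 : (T0 o1 o3 = 0) * (T0 o1 o4 = 0) * (T0 o2 o3 = 0) * (T0 o2 o4 = 0) *
  (T0 o3 o1 = 0) * (T0 o3 o2 = 0) * (T0 o4 o1 = 0) * (T0 o4 o2 = 0).
  by do !split; apply: Z0; rewrite !par_o.
have z1 : (T1 o1 o1 = 0) * (T1 o1 o2 = 0) * (T1 o2 o1 = 0) * (T1 o2 o2 = 0) *
  (T1 o3 o3 = 0) * (T1 o3 o4 = 0) * (T1 o4 o3 = 0) * (T1 o4 o4 = 0).
  by do !split; apply: Z1; rewrite !par_o.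
apply/matrixP; apply: forall_ord4; apply: forall_ord4; rewrite !mxE ?z0 ?z1 ?a11 ?a21
  ?a12 ?a22 ?a44 ?b32 ?b42 ?b13 ?b14 ?b23 ?b24 ?oE /=; ring.
Qed.

Local Notation C := (R[i]).
Local Notation S := (super (serE R)).
Implicit Types (f g : S).

Definition der_h f : S := X3 (D3 f) - X4 (D4 f).
Definition der_e f : S := X3 (D4 f).
Definition der_f f : S := X4 (D3 f).
Definition der_xi f : S :=
  X3 (D1 f) - X3 (D2 f) - 2 *: X1 (D4 f) + 2 *: (al%:C *: X2 (D4 f)).
Definition der_eta f : S :=
  X4 (D1 f) - X4 (D2 f) + 2 *: X1 (D3 f) - 2 *: (al%:C *: X2 (D3 f)).

Lemma superder_mxE r s t p q (i j : 'I_4) : superder_mx r s t p q i j =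
  nth 0 (nth [::] [::
    [:: 0; 0; 2 * q; - (2 * p)];
    [:: 0; 0; - (2 * (al * q)); 2 * (al * p)];
    [:: p; - p; r; s];
    [:: q; - q; t; - r]] i) j.
Proof. by rewrite /superder_mx mxE. Qed.

Lemma derT_superder_mx r s t p q f : derT (superder_mx r s t p q) f =
  r%:C *: der_h f + s%:C *: der_e f + t%:C *: der_f f + p%:C *: der_xi f + q%:C *: der_eta f.
Proof.
rewrite /derT !big_ord_recl !big_ord0 !superder_mxE.
rewrite /= /Xop /Dop /= /der_h /der_e /der_f /der_xi /der_eta.
apply: superP => c d a b.
rewrite !(ev_add, ev_opp, ev_scale, ev_0).
have two : 2%:C = 2 :> C by rewrite rmorphMn.
rewrite !(complex_add, complex_mul, complex_opp, complex_0 R, two).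
repeat match goal with
| |- context [@X1 ?K ?E ?g c d a b] => move: (@X1 K E g c d a b) => ?
| |- context [@X2 ?K ?E ?g c d a b] => move: (@X2 K E g c d a b) => ?
| |- context [@X3 ?K ?E ?g c d a b] => move: (@X3 K E g c d a b) => ?
| |- context [@X4 ?K ?E ?g c d a b] => move: (@X4 K E g c d a b) => ?
end.
move: (al%:C) (r%:C) (s%:C) (t%:C) (p%:C) (q%:C) => *.
ring.
Qed.

Variable lam : R.
Hypothesis al0 : al != 0.
Local Notation Be := (bessel_e al lam).

Lemma der_h_E f c d a b : der_h f c d a b =
  ((if c then 1 else 0) - (if d then 1 else 0)) * f c d a b.
Proof. by rewrite /der_h; case: c; case: d; rewrite !evE /=; ring. Qed.
Lemma der_e_0 f d a b : der_e f false d a b = 0. Proof. by []. Qed.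
Lemma der_e_11 f a b : der_e f true true a b = 0. Proof. by []. Qed.
Lemma der_e_10 f a b : der_e f true false a b = f false true a b.
Proof. by rewrite /der_e !evE. Qed.
Lemma der_f_0 f c a b : der_f f c false a b = 0. Proof. by []. Qed.
Lemma der_f_11 f a b : der_f f true true a b = 0.
Proof. by rewrite /der_f !evE oppr0. Qed.
Lemma der_f_01 f a b : der_f f false true a b = f true false a b.
Proof. by rewrite /der_f !evE. Qed.
Lemma der_xi_00 f a b : der_xi f false false a b =
  - 2 * X1 f false true a b + 2 * al%:C * X2 f false true a b.
Proof. rewrite /der_xi; case: a => [|a]; case: b=>[|b]; rewrite !evE; ring. Qed.
Lemma der_xi_10 f a b : der_xi f true false a b =
  2 * X1 f true true a b - 2 * al%:C * X2 f true true a b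
  + (a.+1%:R * f false false a.+1 b - b.+1%:R * f false false a b.+1).
Proof. rewrite /der_xi; case: a => [|a]; case: b=>[|b]; rewrite !evE; ring. Qed.
Lemma der_xi_01 f a b : der_xi f false true a b = 0.
Proof. rewrite /der_xi; case: a => [|a]; case: b=>[|b]; rewrite !evE; ring. Qed.
Lemma der_xi_11 f a b : der_xi f true true a b =
  a.+1%:R * f false true a.+1 b - b.+1%:R * f false true a b.+1.
Proof. rewrite /der_xi; case: a => [|a]; case: b=>[|b]; rewrite !evE; ring. Qed.
Lemma der_eta_00 f a b : der_eta f false false a b =
  2 * X1 f true false a b - 2 * al%:C * X2 f true false a b.
Proof. rewrite /der_eta; case: a => [|a]; case: b=>[|b]; rewrite !evE; ring. Qed.
Lemma der_eta_01 f a b : der_eta f false true a b =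
  2 * X1 f true true a b - 2 * al%:C * X2 f true true a b
  + (a.+1%:R * f false false a.+1 b - b.+1%:R * f false false a b.+1).
Proof. rewrite /der_eta; case: a => [|a]; case: b=>[|b]; rewrite !evE; ring. Qed.
Lemma der_eta_10 f a b : der_eta f true false a b = 0.
Proof. rewrite /der_eta; case: a => [|a]; case: b=>[|b]; rewrite !evE; ring. Qed.
Lemma der_eta_11 f a b : der_eta f true true a b =
  - (a.+1%:R * f true false a.+1 b - b.+1%:R * f true false a b.+1).
Proof. rewrite /der_eta; case: a => [|a]; case: b=>[|b]; rewrite !evE; ring. Qed.
Definition derE := (der_h_E, der_e_0, der_e_10, der_e_11, der_f_0, der_f_11,
  der_f_01, der_xi_00, der_xi_10, der_xi_01, der_xi_11,
  der_eta_00, der_eta_10, der_eta_01, der_eta_11).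

Ltac der_commutator :=
  let c := fresh "c" in let d := fresh "d" in
  let a := fresh "a" in let b := fresh "b" in
  apply: superP => c d a b;
  case: c; case: d; rewrite ?(bessel_e_ev, besselE, derE);
  case: a => [|[|a]]; case: b => [|[|b]];
  rewrite ?evE ?(bessel_e_ev, besselE, derE) ?evE;
  rewrite -/(lam_ratio al lam) ?(lam_ratioE lam al0);
  move: (lam_ratio al lam) (al%:C) => n ac; rewrite /=; ring.

Lemma bessel_e_der_h f : Be (der_h f) = der_h (Be f).
Proof. der_commutator. Qed.
Lemma bessel_e_der_e f : Be (der_e f) = der_e (Be f).
Proof. der_commutator. Qed.
Lemma bessel_e_der_f f : Be (der_f f) = der_f (Be f).
Proof. der_commutator. Qed.
Lemma bessel_e_der_xi f : Be (der_xi f) = der_xi (Be f).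
Proof. der_commutator. Qed.
Lemma bessel_e_der_eta f : Be (der_eta f) = der_eta (Be f).
Proof. der_commutator. Qed.

(** A derivation kills the unit e, so its action fixes B_e.  The five operators
spanning the derivations are checked separately. *)
Lemma bessel_e_derT T f : superder al T -> Be (derT T f) = derT T (Be f).
Proof.
move=> /superderE [r [s [t [p [q ->]]]]].
rewrite !derT_superder_mx.
by rewrite !bessel_eD !bessel_eZ bessel_e_der_h bessel_e_der_e bessel_e_der_f bessel_e_der_xi
  bessel_e_der_eta.
Qed.
End Superderivations.

(** * Transport along maps of coefficient algebras *)
Section Morphism.
Variable R : realType.
Local Notation C := (R[i]).
Variables (E E' : evenAlg C) (phi : E -> E').
Hypothesis dom0 : dom E 0.
Hypothesis domD : forall x y, dom E x -> dom E y -> dom E (x + y).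
Hypothesis domZ : forall k x, dom E x -> dom E (k *: x).
Hypothesis domX1 : forall x, dom E x -> dom E (mulx1 E x).
Hypothesis domX2 : forall x, dom E x -> dom E (mulx2 E x).
Hypothesis domD1 : forall x, dom E x -> dom E (der1 E x).
Hypothesis domD2 : forall x, dom E x -> dom E (der2 E x).
Hypothesis phiD : forall x y, dom E x -> dom E y -> phi (x + y) = phi x + phi y.
Hypothesis phiZ : forall k x, dom E x -> phi (k *: x) = k *: phi x.
Hypothesis phiX1 : forall x, dom E x -> phi (mulx1 E x) = mulx1 E' (phi x).
Hypothesis phiX2 : forall x, dom E x -> phi (mulx2 E x) = mulx2 E' (phi x).
Hypothesis phiD1 : forall x, dom E x -> phi (der1 E x) = der1 E' (phi x).
Hypothesis phiD2 : forall x, dom E x -> phi (der2 E x) = der2 E' (phi x).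

Definition super_map (f : super E) : super E' := fun c d => phi (f c d).
Definition super_dom (f : super E) : Prop := forall c d, dom E (f c d).

Lemma phi0 : phi 0 = 0.
Proof. by rewrite -(scale0r 0) phiZ // scale0r. Qed.

(** All operators of the theory are built from the same few operations on
coefficients, so a map [phi] that respects these on the domain of the source
respects the actions.  It is applied to the coefficients of a polynomial, to
multiplication by e^(- x1 - x2) and to the Taylor series. *)
Definition transports (F : super E -> super E) (F' : super E' -> super E') :=
  forall f, super_dom f -> super_dom (F f) /\ super_map (F f) = F' (super_map f).

Lemma transports_id : transports id id. Proof. by []. Qed.

Lemma transports_add F F' G G' : transports F F' -> transports G G' ->
  transports (fun f => F f + G f) (fun f => F' f + G' f).
Proof.
move=> hF hG f Df; have [DF <-] := hF f Df; have [DG <-] := hG f Df.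
split; first by move=> c d; apply: domD.
by apply/funext => c; apply/funext => d; apply: phiD.
Qed.

Lemma transports_scale k F F' : transports F F' ->
  transports (fun f => k *: F f) (fun f => k *: F' f).
Proof.
move=> hF f Df; have [DF <-] := hF f Df.
split; first by move=> c d; apply: domZ.
by apply/funext => c; apply/funext => d; apply: phiZ.
Qed.

Lemma transports_opp F F' : transports F F' ->
  transports (fun f => - F f) (fun f => - F' f).
Proof.
move=> hF f Df; have := transports_scale (-1) hF Df.
by rewrite !scaleN1r.
Qed.

Lemma transports_sum (n : nat) F F' : (forall i : 'I_n, transports (F i) (F' i)) ->
  transports (fun f => \sum_(i < n) F i f) (fun f => \sum_(i < n) F' i f).
Proof.
move=> hF f Df.
elim/big_ind2 : _ => [|_ x _ y [Dx <-] [Dy <-]|i _]; last exact: hF.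
- by split=> //; apply/funext => c; apply/funext => d; exact: phi0.
- split; first by move=> c d; apply: domD.
  by apply/funext => c; apply/funext => d; apply: phiD.
Qed.

Lemma transports_comp G G' F F' : transports G G' -> transports F F' ->
  transports (fun f => G (F f)) (fun f => G' (F' f)).
Proof.
by move=> hG hF f Df; have [DF <-] := hF f Df; have [DG <-] := hG _ DF.
Qed.

Lemma transports_X1 : transports (@X1 C E) (@X1 C E').
Proof.
move=> f Df; split; first by move=> c d; apply: domX1.
by apply/funext => c; apply/funext => d; apply: phiX1.
Qed.
Lemma transports_X2 : transports (@X2 C E) (@X2 C E').
Proof.
move=> f Df; split; first by move=> c d; apply: domX2.
by apply/funext => c; apply/funext => d; apply: phiX2.
Qed.
Lemma transports_D1 : transports (@D1 C E) (@D1 C E').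
Proof.
move=> f Df; split; first by move=> c d; apply: domD1.
by apply/funext => c; apply/funext => d; apply: phiD1.
Qed.
Lemma transports_D2 : transports (@D2 C E) (@D2 C E').
Proof.
move=> f Df; split; first by move=> c d; apply: domD2.
by apply/funext => c; apply/funext => d; apply: phiD2.
Qed.
Lemma transports_X3 : transports (@X3 C E) (@X3 C E').
Proof.
move=> f Df; split; first by move=> [] d //=; apply: Df.
by apply/funext => -[]; apply/funext => d //; exact: phi0.
Qed.
Lemma transports_D3 : transports (@D3 C E) (@D3 C E').
Proof.
move=> f Df; split; first by move=> [] d //=; apply: Df.
by apply/funext => -[]; apply/funext => d //; exact: phi0.
Qed.
Lemma transports_X4 : transports (@X4 C E) (@X4 C E').
Proof.
move=> f Df; split; first by move=> c [] //=; rewrite /X4; apply/domZ/Df.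
apply/funext => c; apply/funext => -[]; last exact: phi0.
exact: phiZ.
Qed.
Lemma transports_D4 : transports (@D4 C E) (@D4 C E').
Proof.
move=> f Df; split; first by move=> c [] //=; rewrite /D4; apply/domZ/Df.
apply/funext => c; apply/funext => -[]; first exact: phi0.
exact: phiZ.
Qed.

Ltac transport := rewrite /=; repeat first
  [ exact: transports_id | exact: transports_X1 | exact: transports_X2
  | exact: transports_X3 | exact: transports_X4 | exact: transports_D1 | exact: transports_D2
  | exact: transports_D3 | exact: transports_D4
  | apply: transports_add
  | apply: transports_opp
  | apply: transports_scale
  | apply: (transports_comp transports_X1)
  | apply: (transports_comp transports_X2)
  | apply: (transports_comp transports_X3)
  | apply: (transports_comp transports_X4)
  | apply: (transports_comp transports_D1)
  | apply: (transports_comp transports_D2)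
  | apply: (transports_comp transports_D3)
  | apply: (transports_comp transports_D4) ].

Hypothesis domE' : forall y, dom E' y.
Variables al lam : R.

Lemma transports_bessel1 : transports (bessel1 al lam (E := E)) (bessel1 al lam (E := E')).
Proof. rewrite /bessel1. transport. Qed.
Lemma transports_bessel2 : transports (bessel2 al lam (E := E)) (bessel2 al lam (E := E')).
Proof. rewrite /bessel2. transport. Qed.
Lemma transports_bessel3 : transports (bessel3 al lam (E := E)) (bessel3 al lam (E := E')).
Proof. rewrite /bessel3. transport. Qed.
Lemma transports_bessel4 : transports (bessel4 al lam (E := E)) (bessel4 al lam (E := E')).
Proof. rewrite /bessel4. transport. Qed.

Lemma transports_Xop i : transports (Xop (E := E) i) (Xop (E := E') i).
Proof.
move: i; apply: forall_ord4; rewrite ?Xop_o.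
- exact: transports_X1.
- exact: transports_X2.
- exact: transports_X3.
- exact: transports_X4.
Qed.
Lemma transports_Dop i : transports (Dop (E := E) i) (Dop (E := E') i).
Proof.
move: i; apply: forall_ord4; rewrite ?Dop_o.
- exact: transports_D1.
- exact: transports_D2.
- exact: transports_D3.
- exact: transports_D4.
Qed.
Lemma transports_besselop i : transports (besselop al lam (E := E) i) (besselop al lam (E := E') i).
Proof.
move: i; apply: forall_ord4; rewrite ?besselop_o.
- exact: transports_bessel1.
- exact: transports_bessel2.
- exact: transports_bessel3.
- exact: transports_bessel4.
Qed.

Lemma transports_zmul u : transports (zmul u (E := E)) (zmul u (E := E')).
Proof. by apply: transports_sum => i; apply/transports_scale/transports_Xop. Qed.

Lemma transports_bessel u :
  transports (bessel al lam u (E := E)) (bessel al lam u (E := E')).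
Proof. by apply: transports_sum => i; apply/transports_scale/transports_besselop. Qed.

Lemma transports_derT T : transports (derT T (E := E)) (derT T (E := E')).
Proof.
apply: transports_sum => i; apply: transports_sum => j; apply: transports_scale.
exact: (transports_comp (transports_Xop i) (transports_Dop j)).
Qed.

Lemma transports_piL u :
  transports (piL al lam u (E := E)) (piL al lam u (E := E')).
Proof.
apply: transports_add; first exact: (transports_scale _ transports_id).
exact/transports_opp/transports_derT.
Qed.

Lemma transports_piact X : transports (piact lam X (E := E)) (piact (al := al) lam X (E := E')).
Proof.
apply: transports_add; last exact/transports_opp/transports_scale/transports_bessel.
apply: transports_add; last exact/transports_derT.
apply: transports_add; last exact/transports_piL.
exact/transports_scale/transports_zmul.
Qed.

Lemma transports_rhoact X : transports (rhoact lam X (E := E)) (rhoact (al := al) lam X (E := E')).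
Proof.
apply: transports_add; last first.
  apply: transports_add; last exact/transports_opp/transports_scale/transports_piL.
  apply/transports_scale/transports_add; first exact: transports_zmul.
  exact: transports_bessel.
apply: transports_add; last exact/transports_derT.
apply: transports_add; last first.
  apply/transports_scale/transports_add; first exact: transports_zmul.
  exact/transports_opp/transports_bessel.
apply: transports_add; last exact/transports_scale/transports_piL.
apply/transports_scale/transports_add; first exact: transports_zmul.
exact: transports_bessel.
Qed.

Lemma super_mapD f g : super_dom f -> super_dom g ->
  super_dom (f + g) /\ super_map (f + g) = super_map f + super_map g.
Proof.
move=> Df Dg; split; first by move=> c d; apply: domD.
by apply/funext => c; apply/funext => d; apply: phiD.
Qed.

(** The ideal is described by multiplications alone, and [phi] carries these
over. *)
Lemma ideal_super_map f :
  ideal al lam f -> super_dom f /\ ideal al lam (super_map f).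
Proof.
move=> [h1 [h2 [h3 [h4 [dh ->]]]]].
have [d1 d2 d3 d4] : [/\ super_dom h1, super_dom h2, super_dom h3 & super_dom h4].
  by split=> c d; have [] := dh c d.
suff [D E0] : let F (E0 : evenAlg C) (x1 x2 x3 x4 : super E0) : super E0 :=
    if lam == al then
      (2 *: X1 (X2 x1) + X3 (X4 x1)) + X2 (X2 x2) + X2 (X3 x3) + X2 (X4 x4)
    else
      ((2 * al)%:C *: X1 (X2 x1) + X3 (X4 x1)) + X1 (X1 x2) + X1 (X3 x3)
      + X1 (X4 x4) in
    super_dom (F E h1 h2 h3 h4) /\ super_map (F E h1 h2 h3 h4) =
      F E' (super_map h1) (super_map h2) (super_map h3) (super_map h4).
  split=> //; exists (super_map h1), (super_map h2), (super_map h3), (super_map h4).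
  by split=> //; move=> c d; split; exact: domE'.
have gen k : transports (fun f => k *: X1 (X2 f) + X3 (X4 f))
                        (fun f => k *: X1 (X2 f) + X3 (X4 f)) by transport.
have mon F F' G G' : transports F F' -> transports G G' ->
  transports (fun f => F (G f)) (fun f => F' (G' f)) by exact: transports_comp.
rewrite /=; case: ifP => _.
- have [A1 <-] := gen 2 _ d1.
  have [A2 <-] := mon _ _ _ _ transports_X2 transports_X2 _ d2.
  have [A3 <-] := mon _ _ _ _ transports_X2 transports_X3 _ d3.
  have [A4 <-] := mon _ _ _ _ transports_X2 transports_X4 _ d4.
  have [B2 <-] := super_mapD A1 A2; have [B3 <-] := super_mapD B2 A3.
  exact: super_mapD.
- have [A1 <-] := gen (2 * al)%:C _ d1.
  have [A2 <-] := mon _ _ _ _ transports_X1 transports_X1 _ d2.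
  have [A3 <-] := mon _ _ _ _ transports_X1 transports_X3 _ d3.
  have [A4 <-] := mon _ _ _ _ transports_X1 transports_X4 _ d4.
  have [B2 <-] := super_mapD A1 A2; have [B3 <-] := super_mapD B2 A3.
  exact: super_mapD.
Qed.
End Morphism.

(** * Polynomials as power series, and multiplication by e^(- x1 - x2) *)
Section Series.
Variable R : realType.
Local Notation C := (R[i]).

Definition coefs (p : polyE R) : serE R := fun a b => mpoly.mcoeff (mono a b) p.

Local Notation i0 := (ord0 : 'I_2).
Local Notation i1 := (ord_max : 'I_2).

Lemma mono_i0 a b : (mono a b) i0 = a.
Proof. by rewrite /mpoly.fun_of_multinom (tnth_nth 0%N). Qed.
Lemma mono_i1 a b : (mono a b) i1 = b.
Proof. by rewrite /mpoly.fun_of_multinom (tnth_nth 0%N). Qed.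

Lemma forall_ord2 (P : 'I_2 -> Prop) : P i0 -> P i1 -> forall i, P i.
Proof.
move=> p0 p1 [[|[|m]] lt] //; [move: p0|move: p1]; congr P; exact/val_inj.
Qed.

Lemma mono_U1 a b : mono a.+1 b = mpoly.mnm_add (mono a b) (mpoly.mnm1 i0).
Proof.
apply/mpoly.mnmP; apply: forall_ord2;
  by rewrite mpoly.mnmDE mpoly.mnm1E ?mono_i0 ?mono_i1 /= ?addn1 ?addn0.
Qed.

Lemma mono_U2 a b : mono a b.+1 = mpoly.mnm_add (mono a b) (mpoly.mnm1 i1).
Proof.
apply/mpoly.mnmP; apply: forall_ord2;
  by rewrite mpoly.mnmDE mpoly.mnm1E ?mono_i0 ?mono_i1 /= ?addn1 ?addn0.
Qed.

Lemma mono_eta (m : mpoly.multinom 2) : m = mono (m i0) (m i1).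
Proof. by apply/mpoly.mnmP; apply: forall_ord2; rewrite ?mono_i0 ?mono_i1. Qed.

Lemma coefX_shift (i : 'I_2) (p : mpoly.mpoly 2 C) m :
  mpoly.mcoeff (mpoly.mnm_add m (mpoly.mnm1 i)) (mpoly.mpolyX C (mpoly.mnm1 i) * p)
  = mpoly.mcoeff m p.
Proof. by rewrite -mpoly.commr_mpolyX mpoly.addmC mpoly.mcoeffMX. Qed.

Lemma coefX_0 (i : 'I_2) (p : mpoly.mpoly 2 C) (m : mpoly.multinom 2) : m i = 0%N ->
  mpoly.mcoeff m (mpoly.mpolyX C (mpoly.mnm1 i) * p) = 0.
Proof.
move=> mi; rewrite -mpoly.commr_mpolyX [p]mpoly.mpolyE mulr_suml raddf_sum big1 // => k _.
rewrite -scalerAl -mpoly.mpolyXD /= mpoly.mcoeffZ mpoly.mcoeffX.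
case: eqP => [E|_]; last by rewrite mulr0.
by move: mi; rewrite -E mpoly.mnmDE mpoly.mnm1E eqxx addn1.
Qed.

Lemma coefs_X1 p : coefs (mulx1 (polyE R) p) = mulx1 (serE R) (coefs p).
Proof.
apply/funext => -[|a]; apply/funext => b; rewrite /coefs /=.
  by rewrite coefX_0 ?mono_i0.
by rewrite mono_U1 coefX_shift.
Qed.

Lemma coefs_X2 p : coefs (mulx2 (polyE R) p) = mulx2 (serE R) (coefs p).
Proof.
apply/funext => a; apply/funext => -[|b]; rewrite /coefs /=.
  by rewrite coefX_0 ?mono_i1.
by rewrite mono_U2 coefX_shift.
Qed.

Lemma coefs_D1 p : coefs (der1 (polyE R) p) = der1 (serE R) (coefs p).
Proof.
apply/funext => a; apply/funext => b.
by rewrite /coefs /= mpoly.mcoeff_deriv mono_i0 mono_U1.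
Qed.

Lemma coefs_D2 p : coefs (der2 (polyE R) p) = der2 (serE R) (coefs p).
Proof.
apply/funext => a; apply/funext => b.
by rewrite /coefs /= mpoly.mcoeff_deriv mono_i1 mono_U2.
Qed.

Lemma coefsD p q : coefs (p + q) = coefs p + coefs q.
Proof. by apply/funext => a; apply/funext => b; exact: mpoly.mcoeffD. Qed.

Lemma coefsZ k p : coefs (k *: p) = k *: coefs p.
Proof. by apply/funext => a; apply/funext => b; exact: mpoly.mcoeffZ. Qed.

Lemma coefs_inj : injective coefs.
Proof.
move=> p q pq; apply/mpoly.mpolyP => m; rewrite (mono_eta m).
exact: (congr1 (fun f : serE R => f (m i0) (m i1)) pq).
Qed.

(** Coefficients of the product of e^(- x) with a power series in one variable. *)
Definition econv (s : nat -> C) (a : nat) : C :=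
  \sum_(i < a.+1) ((-1) ^+ i / i`!%:R) * s (a - i)%N.

Lemma econvD s t a : econv (fun i => s i + t i) a = econv s a + econv t a.
Proof. by rewrite -big_split; apply: eq_bigr => i _; rewrite mulrDr. Qed.
Lemma econvZ k s a : econv (fun i => k * s i) a = k * econv s a.
Proof. by rewrite mulr_sumr; apply: eq_bigr => i _; rewrite mulrCA. Qed.
Lemma econvMn s n a : econv (fun i => s i *+ n) a = econv s a *+ n.
Proof. by rewrite -sumrMnl; apply: eq_bigr => i _; rewrite mulrnAr. Qed.
Lemma eq_econv s t a : s =1 t -> econv s a = econv t a.
Proof. by move=> st; apply: eq_bigr => i _; rewrite st. Qed.
Lemma econv0 a : econv (fun=> 0) a = 0.
Proof. by rewrite /econv big1 // => i _; rewrite mulr0. Qed.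

Lemma econv_shift s a :
  econv (fun i => if i is j.+1 then s j else 0) a =
  if a is b.+1 then econv s b else 0.
Proof.
case: a => [|a]; first by rewrite /econv big_ord_recl big_ord0 subn0 mulr0 addr0.
rewrite /econv big_ord_recr /= subnn mulr0 addr0.
by apply: eq_bigr => i _; rewrite subSn // -ltnS.
Qed.

(** The Leibniz rule for e^(- x) s, solved for the term with the derivative of
s. *)
Lemma econv_der s a :
  econv (fun i => s i.+1 *+ i.+1) a = econv s a.+1 *+ a.+1 + econv s a.
Proof.
have -> : econv s a.+1 *+ a.+1 =
    \sum_(i < a.+2) ((-1) ^+ i / i`!%:R * s (a.+1 - i)%N *+ (a.+1 - i))
    + \sum_(i < a.+2) ((-1) ^+ i / i`!%:R * s (a.+1 - i)%N *+ i).
  rewrite -big_split -sumrMnl; apply: eq_bigr => i _ /=.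
  by rewrite -mulrnDr subnK // -ltnS.
(* The weight a + 1 on each term is the sum of the exponents i and a + 1 - i of
   the two factors. *)
rewrite big_ord_recr /= subnn mulr0n addr0.
rewrite [X in _ + X + _]big_ord_recl mulr0n add0r -addrA -big_split /=.
rewrite [X in _ + X]big1 => [|i _].
  rewrite addr0; apply: eq_bigr => i _.
  by rewrite mulrnAr subSn // -ltnS.
rewrite subSS -mulrnAl -mulrDl [X in X * _](_ : _ = 0) ?mul0r //.
rewrite /bump /= add1n exprS factS natrM -mulr_natr.
have : i.+1%:R != 0 :> C by rewrite pnatr_eq0.
have : i`!%:R != 0 :> C by rewrite pnatr_eq0 -lt0n fact_gt0.
move: (i`!%:R) (i.+1%:R) => y x y0 x0.
by rewrite mulN1r mulNr mulNr invfM mulrA mulrAC mulfVK // addNr.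
Qed.

(** Multiplication by e^(- x1 - x2), one variable at a time. *)
Definition emul (s : serE R) : serE R :=
  fun a b => econv (fun a' => econv (s a') b) a.

(** Power series with the derivatives conjugated by e^(- x1 - x2).  In this
algebra the generic formulas for the Bessel operators, pi and rho give their
conjugates. *)
Definition twisted : evenAlg C :=
  @EvenAlg C (nat -> nat -> C^o) setT (mulx1 (serE R)) (mulx2 (serE R))
    (fun s => der1 (serE R) s + s) (fun s => der2 (serE R) s + s).

Lemma expmulE p c d : expmul p c d = emul (coefs (p c d)).
Proof.
apply/funext => a; apply/funext => b; rewrite /expmul /emul /econv.
apply: eq_bigr => i _; rewrite mulr_sumr; apply: eq_bigr => j _.
by rewrite exprD natrM invfM mulrA [in RHS]mulrACA.
Qed.

Lemma emulD s t : emul (s + t) = emul s + emul t.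
Proof.
apply/funext => a; apply/funext => b; rewrite /emul -[RHS]econvD.
by apply: eq_econv => i; rewrite -econvD.
Qed.

Lemma emulZ k s : emul (k *: s) = k *: emul s.
Proof.
apply/funext => a; apply/funext => b; rewrite /emul -[RHS]econvZ.
by apply: eq_econv => i; rewrite -econvZ.
Qed.

Lemma emul_X1 s : emul (mulx1 (serE R) s) = mulx1 (serE R) (emul s).
Proof.
apply/funext => a; apply/funext => b; rewrite /emul /= -econv_shift.
by apply: eq_econv => -[|i] //; exact: econv0.
Qed.

Lemma emul_X2 s : emul (mulx2 (serE R) s) = mulx2 (serE R) (emul s).
Proof.
apply/funext => a; apply/funext => b; rewrite /emul /=.
transitivity (econv (fun a' => if b is b'.+1 then econv (s a') b' else 0) a).
  by apply: eq_econv => i; rewrite econv_shift.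
by case: b => [|b] //; exact: econv0.
Qed.

Lemma emul_D1 s : emul (der1 (serE R) s) = der1 twisted (emul s).
Proof.
apply/funext => a; apply/funext => b; rewrite /emul /=.
rewrite -[RHS]econv_der; apply: eq_econv => i.
exact: econvMn.
Qed.

Lemma emul_D2 s : emul (der2 (serE R) s) = der2 twisted (emul s).
Proof.
apply/funext => a; apply/funext => b; rewrite /emul /=.
transitivity (econv (fun a' => econv (s a') b.+1 *+ b.+1 + econv (s a') b) a).
  by apply: eq_econv => i; rewrite -econv_der.
rewrite econvD; congr (_ + _).
exact: (econvMn (fun a' => econv (s a') b.+1)).
Qed.

Definition toser (p : super (polyE R)) : super (serE R) := super_map coefs p.

Lemma transports_toser F F' :
  transports coefs F F' -> forall p, toser (F p) = F' (toser p).
Proof. by move=> h p; have [] := h p. Qed.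

Lemma transports_expmul F F' :
  transports (E' := twisted) (fun p : polyE R => emul (coefs p)) F F' ->
  forall p, expmul (F p) = F' (expmul p).
Proof.
move=> h p; have [//|_] := h p.
have E q : expmul q = super_map (E' := twisted) (fun p : polyE R => emul (coefs p)) q.
  by apply/funext => c; apply/funext => d; exact: expmulE.
by rewrite !E.
Qed.

End Series.

(** * Conjugation of rho by e^(- x1 - x2) *)
Section Twisting.
Variable R : realType.
Local Notation C := (R[i]).
Local Notation S := (super (serE R)).
Implicit Types (f g : S).
Variables al lam : R.
Hypothesis al0 : al != 0.

Let E1 f : S := D1 f + f.
Let E2 f : S := D2 f + f.

Lemma twisted_bessel1 f : (bessel1 al lam (E := twisted R) f : S) =
  bessel1 al lam f - 2 *: pi_L1 lam f + X1 f.
Proof.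
transitivity (- (lam%:C *: E1 f) + X1 (E1 (E1 f)) + X3 (D3 (E1 f)) + X4 (D4 (E1 f))
  - (2 * al)%:C *: X2 (D3 (D4 f))); first by [].
apply: superP => c d a b; rewrite /E1 !(ev_add, ev_opp, ev_scale).
case: c; case: d; rewrite ?(besselE, pi_LE); case: a => [|a]; case: b => [|b];
  rewrite ?evE; by field.
Qed.
Lemma twisted_bessel2 f : (bessel2 al lam (E := twisted R) f : S) =
  bessel2 al lam f - 2 *: pi_L2 al lam f + X2 f.
Proof.
transitivity (- ((lam / al)%:C *: E2 f) + X2 (E2 (E2 f)) + X3 (D3 (E2 f)) + X4 (D4 (E2 f))
  - 2 *: X1 (D3 (D4 f))); first by [].
apply: superP => c d a b; rewrite /E2 !(ev_add, ev_opp, ev_scale).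
case: c; case: d; rewrite ?(besselE, pi_LE); case: a => [|a]; case: b => [|b];
  rewrite ?evE; move: (_ / _)%:C => n; by field.
Qed.
Lemma twisted_bessel3 f : (bessel3 al lam (E := twisted R) f : S) =
  bessel3 al lam f - 2 *: pi_L3 al f + X3 f.
Proof.
transitivity (- ((2 * lam)%:C *: D4 f) + 2 *: X1 (E1 (D4 f))
  + (2 * al)%:C *: X2 (E2 (D4 f))
  + (2 * (1 + al))%:C *: X3 (D3 (D4 f)) + X3 (E1 (E2 f))); first by [].
apply: superP => c d a b; rewrite /E1 /E2 !(ev_add, ev_opp, ev_scale).
case: c; case: d; rewrite ?(besselE, pi_LE); case: a => [|a]; case: b => [|b];
  rewrite ?evE; by field.
Qed.
Lemma twisted_bessel4 f : (bessel4 al lam (E := twisted R) f : S) =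
  bessel4 al lam f - 2 *: pi_L4 al f + X4 f.
Proof.
transitivity ((2 * lam)%:C *: D3 f - 2 *: X1 (E1 (D3 f))
  - (2 * al)%:C *: X2 (E2 (D3 f))
  - (2 * (1 + al))%:C *: X4 (D4 (D3 f)) + X4 (E1 (E2 f))); first by [].
apply: superP => c d a b; rewrite /E1 /E2 !(ev_add, ev_opp, ev_scale).
case: c; case: d; rewrite ?(besselE, pi_LE); case: a => [|a]; case: b => [|b];
  rewrite ?evE; by field.
Qed.

(** Substituting d_i + 1 for d_i in a second-order operator adds a first-order
part, which is - 2 pi(L_a), and a multiplication, which is z_a. *)
Lemma twisted_bessel u f : (bessel al lam u (E := twisted R) f : S) =
  bessel al lam u f - 2 *: piL al lam u f + zmul u f.
Proof.
rewrite /bessel piL_pi_Lop /zmul scaler_sumr -sumrB -big_split; apply: eq_bigr => i _.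
rewrite /= scalerA [2 * _]mulrC -scalerA -scalerBr -scalerDr; congr (_ *: _).
move: i; apply: forall_ord4; rewrite ?besselop_o ?pi_Lop_o ?Xop_o.
- exact: twisted_bessel1.
- exact: twisted_bessel2.
- exact: twisted_bessel3.
- exact: twisted_bessel4.
Qed.

Lemma twisted_derT T f : (derT T (E := twisted R) f : S) =
  derT T f + \sum_(i < 4) (T i o1 + T i o2)%:C *: Xop i f.
Proof.
rewrite /derT -big_split; apply: eq_bigr => i _ /=.
rewrite !big_ord_recl !big_ord0 !oE.
have -> : Dop (E := twisted R) ord0 f = (Dop ord0 f + f : S) by [].
have -> : Dop (E := twisted R) (lift ord0 ord0) f = (Dop (lift ord0 ord0) f + f : S) by [].
have XE g : Xop (E := twisted R) i g = @Xop C (serE R) i g by [].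
have XD g h : @Xop C (serE R) i (g + h) = Xop i g + Xop i h.
  move: i {XE}; apply: forall_ord4; rewrite ?Xop_o; apply: superP => c d a b;
  rewrite !(ev_add); case: c; case: d; case: a => [|a]; case: b => [|b]; rewrite ?evE; ring.
rewrite !XE !XD; move: (Xop i _) (Xop i _) (Xop i _) (Xop i _) (Xop i _) => u1 u2 u3 u4 u5.
apply: superP => c d a b; rewrite !(ev_add, ev_opp, ev_scale, ev_0) complex_add.
ring.
Qed.

Lemma Lmx_unit (u : Dal R) i : Lmx al u i o1 + Lmx al u i o2 = u i 0.
Proof. by rewrite !Lmx_val !oE /=; move: i; apply: forall_ord4; rewrite !oE /=; field. Qed.

(** The derivation of L_a is of first order; applied to x1 + x2 it gives z_b
with b = L_a e = a. *)
Lemma twisted_piL u f : (piL al lam u (E := twisted R) f : S) =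
  piL al lam u f - zmul u f.
Proof.
transitivity ((lamL al lam u)%:C *: f - (derT (Lmx al u) (E := twisted R) f : S)).
  by [].
rewrite twisted_derT.
have -> : \sum_(i < 4) (Lmx al u i o1 + Lmx al u i o2)%:C *: Xop i f = zmul u f.
  by apply: eq_bigr => i _; rewrite Lmx_unit.
rewrite /piL; move: (derT _ _) (zmul _ _) ((lamL al lam u)%:C *: f) => x y z.
by rewrite opprD addrA.
Qed.

(** A derivation of the superalgebra kills e, so its superderivation kills
x1 + x2. *)
Lemma twisted_superder T f : superder al T ->
  (derT T (E := twisted R) f : S) = derT T f.
Proof.
move=> /superderE [r [s [t [p [q ->]]]]]; rewrite twisted_derT big1 ?addr0 // => i _.
rewrite !superder_mxE !oE; move: i; apply: forall_ord4; rewrite !oE /= ?addr0 ?subrr;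
 exact: scale0r.
Qed.

(** The operator rho(X) conjugated by e^(- x1 - x2). *)
Definition twrho (X : tkk al) f : S :=
    (- ('i%C / 2) *: bessel al lam (tkk_minus X) f
     + (2 * 'i%C) *: piL al lam (tkk_minus X) f
     - (2 * 'i%C) *: zmul (tkk_minus X) f)
  + (piL al lam (tkk_L X) f - 2^-1 *: bessel al lam (tkk_L X) f)
  + derT (tkk_der X) f
  - ('i%C / 2) *: bessel al lam (tkk_plus X) f.

Lemma twisted_rhoact (X : tkk al) f :
  (rhoact lam X (E := twisted R) f : S) = twrho X f.
Proof.
rewrite /rhoact.
transitivity ((- ('i%C / 2) *: (zmul (tkk_minus X) f
      + (bessel al lam (tkk_minus X) (E := twisted R) f : S))
    + 'i%C *: (piL al lam (tkk_minus X) (E := twisted R) f : S))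
    + 2^-1 *: (zmul (tkk_L X) f - (bessel al lam (tkk_L X) (E := twisted R) f : S))
    + (derT (tkk_der X) (E := twisted R) f : S)
    + (- ('i%C / 2) *: (zmul (tkk_plus X) f
      + (bessel al lam (tkk_plus X) (E := twisted R) f : S))
      - 'i%C *: (piL al lam (tkk_plus X) (E := twisted R) f : S))); first by [].
rewrite !twisted_bessel !twisted_piL (twisted_superder _ (tkk_derP X)) /twrho.
move: (zmul (tkk_minus X) f) (zmul (tkk_L X) f) (zmul (tkk_plus X) f)
  (bessel al lam (tkk_minus X) f) (bessel al lam (tkk_L X) f)
  (bessel al lam (tkk_plus X) f) (piL al lam (tkk_minus X) f)
  (piL al lam (tkk_L X) f) (piL al lam (tkk_plus X) f)
  (derT (tkk_der X) f) => *.
apply: superP => c d a b; rewrite !(ev_add, ev_opp, ev_scale).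
by field.
Qed.

Lemma toser_rhoact (X : tkk al) p : toser (rhoact lam X p) = rhoact lam X (toser p).
Proof.
apply: (transports_toser (F' := rhoact lam X)); apply: transports_rhoact => //.
- by move=> x y _ _; apply: coefsD.
- by move=> x y _; apply: coefsZ.
- by move=> x _; apply: coefs_X1.
- by move=> x _; apply: coefs_X2.
- by move=> x _; apply: coefs_D1.
- by move=> x _; apply: coefs_D2.
Qed.

Lemma toser_ideal p : ideal al lam p -> ideal al lam (toser p).
Proof.
move=> Ip; suff [] : super_dom p /\ ideal al lam (toser p) by [].
apply: ideal_super_map => //.
- by move=> x y _ _; apply: coefsD.
- by move=> x y _; apply: coefsZ.
- by move=> x _; apply: coefs_X1.
- by move=> x _; apply: coefs_X2.
Qed.

Lemma expmul_ideal p : ideal al lam p -> ideal al lam (expmul p).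
Proof.
move=> Ip.
have -> : expmul p = super_map (E' := serE R) (fun p : polyE R => emul (coefs p)) p.
  by apply/funext => c; apply/funext => d; exact: expmulE.
suff [] : super_dom p /\ ideal al lam
  (super_map (E' := serE R) (fun p : polyE R => emul (coefs p)) p) by [].
apply: ideal_super_map => //.
- by move=> x y _ _; rewrite coefsD emulD.
- by move=> x y _; rewrite coefsZ emulZ.
- by move=> x _; rewrite coefs_X1 emul_X1.
- by move=> x _; rewrite coefs_X2 emul_X2.
Qed.

Lemma toserD p q : toser (p + q) = toser p + toser q :> S.
Proof. by apply/funext => c; apply/funext => d; exact: coefsD. Qed.
Lemma toserZ k p : toser (k *: p) = k *: toser p :> S.
Proof. by apply/funext => c; apply/funext => d; exact: coefsZ. Qed.
Lemma expmulD p q : expmul (p + q) = expmul p + expmul q :> S.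
Proof.
by apply/funext => c; apply/funext => d; rewrite !expmulE coefsD emulD -!expmulE.
Qed.
Lemma expmulZ k p : expmul (k *: p) = k *: expmul p :> S.
Proof.
by apply/funext => c; apply/funext => d; rewrite !expmulE coefsZ emulZ -!expmulE.
Qed.

(** Transport along p |-> e^(- x1 - x2) p into the algebra [twisted]. *)
Lemma expmul_rhoact (X : tkk al) p : expmul (rhoact lam X p) = twrho X (expmul p).
Proof.
rewrite -twisted_rhoact.
apply: (transports_expmul (F' := rhoact lam X (E := twisted R))).
apply: transports_rhoact => //.
- by move=> x y _ _; rewrite coefsD emulD.
- by move=> x y _; rewrite coefsZ emulZ.
- by move=> x _; rewrite coefs_X1 emul_X1.
- by move=> x _; rewrite coefs_X2 emul_X2.
- by move=> x _; rewrite coefs_D1 emul_D1.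
- by move=> x _; rewrite coefs_D2 emul_D2.
Qed.
End Twisting.

(** * Coordinates on the quotient by the ideal *)

(* Simplification of the coordinates must not unfold the operators that evE
   evaluates. *)
#[local] Arguments X1 : simpl never.
#[local] Arguments X2 : simpl never.
#[local] Arguments X3 : simpl never.
#[local] Arguments X4 : simpl never.
#[local] Arguments D1 : simpl never.
#[local] Arguments D2 : simpl never.
#[local] Arguments D3 : simpl never.
#[local] Arguments D4 : simpl never.

Section Quotient.
Variable R : realType.
Local Notation C := (R[i]).
Local Notation S := (super (serE R)).
Implicit Types (f g : S).
Variables (al lam : R) (sw : bool).
Hypothesis al0 : al != 0.
Hypothesis hsw : if sw then lam = al else lam = 1 /\ al != 1.

(** The flag says which case holds: [true] for lambda = al, where x1 is the main
variable and the square of x2 is in the ideal; [false] for lambda = 1 with the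
roles exchanged.  [coefn] lists the exponent of the main variable first. *)
Definition coefn (b : bool) (s : serE R) (k l : nat) : C := if b then s k l else s l k.
Let beta : C := if sw then 1 else al%:C.
Definition main_param : R := if sw then al else al^-1.
Let mu : C := main_param%:C.

(** Let x be the main and y the other even variable.  The quotient has the
(topological) basis x^k, x^k x3, x^k x4, x^k y, and x^j x3 x4 is congruent to
- 2 beta x^(j+1) y.  The coordinate at (true, true) is minus the coefficient of
x^k y; with this sign [B_small] carries it unchanged to the coordinate at
(false, false). *)
Definition qcoord f (c d : bool) (k : nat) : C :=
  if c && d then
    2 * beta * (if k is j.+1 then coefn sw (f true true) j 0 else 0)
    - coefn sw (f false false) k 1
  else coefn sw (f c d) k 0.

Definition X_main : S -> S := if sw then @X1 _ (serE R) else @X2 _ (serE R).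
Definition X_small : S -> S := if sw then @X2 _ (serE R) else @X1 _ (serE R).
Definition B_main : S -> S :=
  if sw then bessel1 al lam (E := serE R) else bessel2 al lam (E := serE R).
Definition B_small : S -> S :=
  if sw then bessel2 al lam (E := serE R) else bessel1 al lam (E := serE R).

Lemma beta_neq0 : beta != 0.
Proof. by rewrite /beta; case: sw; rewrite ?oner_eq0 ?alC_neq0. Qed.

Lemma qcoord_add f g c d k : qcoord (f + g) c d k = qcoord f c d k + qcoord g c d k.
Proof.
by rewrite /qcoord /coefn; case: sw; case: c; case: d; case: k => [|k]; rewrite /= ?ev_add; ring.
Qed.
Lemma qcoord_scale (z : C) f c d k : qcoord (z *: f) c d k = z * qcoord f c d k.
Proof.
by rewrite /qcoord /coefn; case: sw; case: c; case: d; case: k => [|k]; rewrite /= ?ev_scale; ring.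
Qed.

Ltac qcoord_cases := rewrite /qcoord /coefn /X_main /X_small /B_main /B_small /mu /main_param /beta;
  let e := fresh "elam" in move: hsw; case: sw => /= [e|[e _]]; rewrite ?e {e}.

Lemma qcoord_X_main f c d k : qcoord (X_main f) c d k = if k is j.+1 then qcoord f c d j else 0.
Proof.
by qcoord_cases; case: c; case: d; case: k => [|[|k]]; rewrite /= ?evE; ring.
Qed.

Lemma qcoord_X_small f c d k : qcoord (X_small f) c d k =
  if c && d then - qcoord f false false k else 0.
Proof.
by qcoord_cases; case: c; case: d; case: k => [|[|k]]; rewrite /= ?evE; ring.
Qed.

Lemma qcoord_X3 f c d k : qcoord (X3 f) c d k =
  if c then if d then 2 * beta * (if k is j.+1 then qcoord f false true j else 0)
            else qcoord f false false k
  else 0.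
Proof.
by qcoord_cases; case: c; case: d; case: k => [|[|k]]; rewrite /= ?evE; ring.
Qed.

Lemma qcoord_X4 f c d k : qcoord (X4 f) c d k =
  if d then if c then - 2 * beta * (if k is j.+1 then qcoord f true false j else 0)
            else qcoord f false false k
  else 0.
Proof.
by qcoord_cases; case: c; case: d; case: k => [|[|k]]; rewrite /= ?evE; ring.
Qed.

Lemma div_al_al : (al / al)%:C = 1 :> C. Proof. by rewrite divff. Qed.
Lemma al_mul_inv : al%:C * (al^-1)%:C = 1 :> C. Proof. by rewrite -rmorphM divff. Qed.

(** The main Bessel operator lowers the exponent of the main variable; its
coefficients are nonzero if [main_param] is not an integer. *)
Lemma qcoord_B_main f c d k : qcoord (B_main f) c d k = k.+1%:R *
   (k%:R + (if c (+) d then 1 else 0) - mu) * qcoord f c d k.+1.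
Proof.
have e := al_mul_inv.
qcoord_cases; case: c; case: d; case: k => [|k]; rewrite /= ?besselE ?evE ?div_al_al ?div1r;
 try ring;  move: (al%:C) (_%:C) e => a a' e; ring: e.
Qed.

Lemma qcoord_B_small f c d k : qcoord (B_small f) c d k =
  if c || d then 0 else qcoord f true true k.
Proof.
by qcoord_cases; case: c; case: d; case: k => [|k];
  rewrite /= ?besselE ?evE ?div_al_al ?div1r; ring.
Qed.

Definition nullclass f := forall c d k, qcoord f c d k = 0.

Lemma nullclassP f : nullclass f ->
  [/\ forall k, coefn sw (f false false) k 0 = 0,
      forall k, coefn sw (f true false) k 0 = 0,
      forall k, coefn sw (f false true) k 0 = 0,
      coefn sw (f false false) 0 1 = 0 &
      forall k, coefn sw (f false false) k.+1 1 =
        2 * beta * coefn sw (f true true) k 0].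
Proof.
move=> f0; split=> [k|k|k||k].
- exact: f0 false false k.
- exact: f0 true false k.
- exact: f0 false true k.
- by have := f0 true true 0%N; rewrite /qcoord /= mulr0 sub0r => /eqP; rewrite oppr_eq0 => /eqP.
- by have := f0 true true k.+1; rewrite /qcoord /= => /eqP; rewrite subr_eq0 => /eqP.
Qed.

Ltac null_cases f0 :=
  let c := fresh "c" in let d := fresh "d" in let k := fresh "k" in
  let u0 := fresh "u" in let a0 := fresh "a" in let b0 := fresh "b" in
  let v0 := fresh "v" in let v1 := fresh "v" in
  case: (nullclassP f0); rewrite /nullclass; qcoord_cases;
  move=> u0 a0 b0 v0 v1 c d k; case: c; case: d; case: k => [|k];
  rewrite /= ?besselE ?derE ?evE ?u0 ?a0 ?b0 ?v0 ?v1; ring.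

Lemma nullclass_bessel3 f : nullclass f -> nullclass (bessel3 al lam f).
Proof.
by move=> f0; null_cases f0.
Qed.
Lemma nullclass_bessel4 f : nullclass f -> nullclass (bessel4 al lam f).
Proof.
by move=> f0; null_cases f0.
Qed.
Lemma nullclass_der_h f : nullclass f -> nullclass (der_h f).
Proof.
by move=> f0; null_cases f0.
Qed.
Lemma nullclass_der_e f : nullclass f -> nullclass (der_e f).
Proof.
by move=> f0; null_cases f0.
Qed.
Lemma nullclass_der_f f : nullclass f -> nullclass (der_f f).
Proof.
by move=> f0; null_cases f0.
Qed.
Lemma nullclass_der_xi f : nullclass f -> nullclass (der_xi al f).
Proof.
by move=> f0; null_cases f0.
Qed.
Lemma nullclass_der_eta f : nullclass f -> nullclass (der_eta al f).
Proof.
by move=> f0; null_cases f0.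
Qed.

Lemma nullclass_add f g : nullclass f -> nullclass g -> nullclass (f + g).
Proof. by move=> f0 g0 c d k; rewrite qcoord_add f0 g0 addr0. Qed.
Lemma nullclass_scale (z : C) f : nullclass f -> nullclass (z *: f).
Proof. by move=> f0 c d k; rewrite qcoord_scale f0 mulr0. Qed.
Lemma nullclass0 : nullclass 0.
Proof. by move=> c d k; rewrite -(scale0r 0) qcoord_scale mul0r. Qed.

Lemma nullclass_Xop i f : nullclass f -> nullclass (Xop i f).
Proof.
move=> f0; have [z1 z2] : nullclass (X_main f) /\ nullclass (X_small f).
  split=> c d k; first by rewrite qcoord_X_main; case: k.
  by rewrite qcoord_X_small f0 oppr0 if_same.
move: i; apply: forall_ord4; rewrite ?Xop_o.
- by move: z1 z2; rewrite /X_main /X_small; case: (sw).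
- by move: z1 z2; rewrite /X_main /X_small; case: (sw).
- by move=> c d k; rewrite qcoord_X3 f0; case: c; case: d; case: k => [|k]; rewrite ?f0 ?mulr0.
- by move=> c d k; rewrite qcoord_X4 f0; case: c; case: d; case: k => [|k]; rewrite ?f0 ?mulr0.
Qed.

Lemma nullclass_besselop i f : nullclass f -> nullclass (besselop al lam i f).
Proof.
move=> f0; have [z1 z2] : nullclass (B_main f) /\ nullclass (B_small f).
  split=> c d k; first by rewrite qcoord_B_main f0 mulr0.
  by rewrite qcoord_B_small f0 if_same.
move: i; apply: forall_ord4; rewrite ?besselop_o.
- by move: z1 z2; rewrite /B_main /B_small; case: (sw).
- by move: z1 z2; rewrite /B_main /B_small; case: (sw).
- exact: nullclass_bessel3.
- exact: nullclass_bessel4.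
Qed.

Lemma nullclass_sum (n : nat) (F : 'I_n -> S) : (forall i, nullclass (F i)) ->
  nullclass (\sum_(i < n) F i).
Proof.
move=> h; elim/big_ind : _ => [|x y|i _]; [exact: nullclass0|exact: nullclass_add|exact: h].
Qed.

Lemma nullclass_zmul u f : nullclass f -> nullclass (zmul u f).
Proof. by move=> f0; apply: nullclass_sum => i; apply/nullclass_scale/nullclass_Xop. Qed.

Lemma nullclass_bessel u f : nullclass f -> nullclass (bessel al lam u f).
Proof. by move=> f0; apply: nullclass_sum => i; apply/nullclass_scale/nullclass_besselop. Qed.

Lemma nullclass_bessel_e f : nullclass f -> nullclass (bessel_e al lam f).
Proof.
move=> f0; apply: nullclass_add.
  by have := nullclass_besselop o1 f0; rewrite besselop_o.
by have := nullclass_besselop o2 f0; rewrite besselop_o.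
Qed.

(** By [bessel_e_zmul], pi(L_a) is half a commutator of z_a and B_e, and both
respect the null classes. *)
Lemma nullclass_piL u f : nullclass f -> nullclass (piL al lam u f).
Proof.
move=> f0; have E : piL al lam u f = 2^-1 *: (zmul u (bessel_e al lam f)
   - bessel_e al lam (zmul u f)).
  by rewrite bessel_e_zmul // opprB addrC subrK scalerA mulVf ?scale1r ?pnatr_eq0.
rewrite E; apply/nullclass_scale/nullclass_add; first exact/nullclass_zmul/nullclass_bessel_e.
by rewrite -scaleN1r; apply/nullclass_scale/nullclass_bessel_e/nullclass_zmul.
Qed.

Lemma nullclass_derT T f : superder al T -> nullclass f -> nullclass (derT T f).
Proof.
move=> /superderE [r [s [t [p [q ->]]]]] f0; rewrite derT_superder_mx.
apply: nullclass_add; last exact/nullclass_scale/nullclass_der_eta.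
apply: nullclass_add; last exact/nullclass_scale/nullclass_der_xi.
apply: nullclass_add; last exact/nullclass_scale/nullclass_der_f.
apply: nullclass_add; last exact/nullclass_scale/nullclass_der_e.
exact/nullclass_scale/nullclass_der_h.
Qed.

(** The test that selects the generators of the ideal: for lambda = 1 it fails
because al is different from 1. *)
Lemma lam_eq_al : (lam == al) = sw.
Proof. by move: hsw; case: sw => [->|[-> /negPf]]; rewrite ?eqxx // eq_sym. Qed.

Lemma ideal_nullclass f : ideal al lam f -> nullclass f.
Proof.
move=> [h1 [h2 [h3 [h4 [_ ->]]]]]; rewrite lam_eq_al /nullclass; qcoord_cases; move=> c d k.
- by case: c; case: d; case: k => [|[|k]]; rewrite /= ?evE; ring.
- by case: c; case: d; case: k => [|[|k]]; rewrite /= ?evE; ring.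
Qed.

(** Division by the small variable, forgetting the terms without it. *)
Definition mshift (s : serE R) : serE R := fun a b => if sw then s a b.+1 else s a.+1 b.

(** The part free of the small variable. *)
Definition mslice (s : serE R) : serE R :=
  fun a b => if (if sw then b else a) is 0 then s a b else 0.

(** Coefficients that write a null class on the four generators: the mixed
generator absorbs the part of the x3 x4 component without the small variable,
the other three absorb what is divisible by its square, by its product with x3
and by its product with x4.  They are given by shifts and slices, which preserve
polynomials. *)
Definition gen1 f : S := fun c d => if c || d then 0 else mslice (f true true).
Definition gen2 f : S := fun c d => if c || d then 0 else mshift (mshift (f false false)).
Definition gen3 f : S := fun c d => if c then 0 else mshift (f true d).
Definition gen4 f : S := fun c d => if c || d then 0 else mshift (f false true).

Definition generated (h1 h2 h3 h4 : S) : S := if lam == al then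
    (2 *: X1 (X2 h1) + X3 (X4 h1)) + X2 (X2 h2) + X2 (X3 h3) + X2 (X4 h4)
  else
    ((2 * al)%:C *: X1 (X2 h1) + X3 (X4 h1)) + X1 (X1 h2) + X1 (X3 h3) + X1 (X4 h4).

(** Vanishing of the coordinates says that all components without the small
variable vanish except that of x3 x4, and that this one is matched by the terms
linear in the small variable as in the mixed generator. *)
Lemma nullclass_generated f : nullclass f ->
  f = generated (gen1 f) (gen2 f) (gen3 f) (gen4 f).
Proof.
move=> f0; apply: superP; case: (nullclassP f0); rewrite /generated lam_eq_al.
rewrite /gen1 /gen2 /gen3 /gen4 /mslice /mshift.
qcoord_cases; move=> u0 a0 b0 v0 v1 c d a b; case: c; case: d;
case: a => [|[|a]]; case: b => [|[|b]];
rewrite ?evE /= ?u0 ?a0 ?b0 ?v0 ?v1; ring.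
Qed.

Lemma nullclass_ideal f : nullclass f -> ideal al lam f.
Proof.
move=> f0; exists (gen1 f), (gen2 f), (gen3 f), (gen4 f).
by split; [move=> c d; split|exact: nullclass_generated].
Qed.

Lemma coefs0 : coefs (0 : mpoly.mpoly 2 C) = 0.
Proof. by have := coefsZ (R := R) 0 0; rewrite !scale0r. Qed.

Definition polynomial (s : serE R) := exists p, coefs p = s.

Lemma polynomial_closed (F : serE R -> serE R) :
  (forall s t, F (s + t) = F s + F t) -> (forall (z : C) s, F (z *: s) = z *: F s) ->
  (forall m : mpoly.multinom 2, polynomial (F (coefs (mpoly.mpolyX C m)))) ->
  forall s, polynomial s -> polynomial (F s).
Proof.
move=> FD FZ FX s [p <-]; elim/mpoly.mpolyind : p => [|z m p _ _ [q qE]].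
  by exists 0; rewrite coefs0; have := FZ 0 0; rewrite !scale0r.
have [r rE] := FX m.
by exists (z *: r + q); rewrite !coefsD !coefsZ FD FZ rE qE.
Qed.

Lemma coefs_mono a b k l :
  coefs (mpoly.mpolyX C (mono a b)) k l = ((a == k) && (b == l))%:R.
Proof.
rewrite /coefs mpoly.mcoeffX; congr (nat_of_bool _)%:R.
apply/eqP/andP => [E|[/eqP -> /eqP ->]] //.
have := congr1 (fun m : mpoly.multinom 2 => m ord0) E.
have := congr1 (fun m : mpoly.multinom 2 => m ord_max) E.
by rewrite !mono_i0 !mono_i1 => -> ->.
Qed.

Lemma polynomial0 : polynomial 0.
Proof. by exists 0; exact: coefs0. Qed.

Lemma polynomial_mshift s : polynomial s -> polynomial (mshift s).
Proof.
apply: polynomial_closed => [t u|z t|m].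
- by apply/funext => a; apply/funext => b; rewrite /mshift; case: (sw).
- by apply/funext => a; apply/funext => b; rewrite /mshift; case: (sw).
rewrite (mono_eta m); move: (m ord0) (m ord_max) => a b.
have [E|[p pE]] : mshift (coefs (mpoly.mpolyX C (mono a b))) = 0 \/
   exists p, mshift (coefs (mpoly.mpolyX C (mono a b))) = coefs p.
- rewrite /mshift; case: (sw).
    case: b => [|b]; [left|right; exists (mpoly.mpolyX C (mono a b))];
      apply/funext => k; apply/funext => l; rewrite !coefs_mono //.
    by rewrite andbF.
  case: a => [|a]; [left|right; exists (mpoly.mpolyX C (mono a b))];
    by apply/funext => k; apply/funext => l; rewrite !coefs_mono.
- by rewrite E; exact: polynomial0.
- by exists p.
Qed.

Lemma polynomial_mslice s : polynomial s -> polynomial (mslice s).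
Proof.
apply: polynomial_closed => [t u|z t|m].
- apply/funext => a; apply/funext => b.
  rewrite -[RHS]/(mslice t a b + mslice u a b) /mslice.
  by case: (if sw then b else a) => //=; rewrite addr0.
- apply/funext => a; apply/funext => b.
  rewrite -[RHS]/(z * mslice t a b) /mslice.
  by case: (if sw then b else a) => //=; rewrite mulr0.
rewrite (mono_eta m); move: (m ord0) (m ord_max) => a b.
have [E|[p pE]] : mslice (coefs (mpoly.mpolyX C (mono a b))) = 0 \/
   exists p, mslice (coefs (mpoly.mpolyX C (mono a b))) = coefs p.
- rewrite /mslice; case: (sw).
    case: b => [|b]; [right; exists (mpoly.mpolyX C (mono a 0))|left];
      apply/funext => k; apply/funext => -[|l]; rewrite ?coefs_mono //=;
      by rewrite andbF.
  case: a => [|a]; [right; exists (mpoly.mpolyX C (mono 0 b))|left];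
      by apply/funext => -[|k]; apply/funext => l; rewrite ?coefs_mono.
- by rewrite E; exact: polynomial0.
- by exists p.
Qed.

Lemma polynomial_super (h : S) : (forall c d, polynomial (h c d)) ->
  exists p, toser p = h.
Proof.
move=> /(_ _ _)/cid-H; exists (fun c d => projT1 (H c d)).
by apply/funext => c; apply/funext => d; rewrite /toser /super_map; case: (H c d).
Qed.

Lemma toser_inj : injective (@toser R).
Proof.
move=> p q pq; apply/funext => c; apply/funext => d; apply: coefs_inj.
exact: (congr1 (fun f : S => f c d) pq).
Qed.

(** A polynomial in the ideal of the power series is in the ideal of the
polynomials, because the multipliers [gen1] to [gen4] of a polynomial are
polynomials. *)
Lemma nullclass_toser_ideal (p : super (polyE R)) : nullclass (toser p) -> ideal al lam p.
Proof.
move=> p0.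
have P c d : polynomial (toser p c d) by exists (p c d).
(* The four multipliers are polynomials. *)
have [h1 E1] : exists p1, toser p1 = gen1 (toser p).
  by apply: polynomial_super => -[] [] /=; rewrite /gen1;
    first [exact: polynomial0 | exact/polynomial_mslice/P].
have [h2 E2] : exists p1, toser p1 = gen2 (toser p).
  by apply: polynomial_super => -[] [] /=; rewrite /gen2;
    first [exact: polynomial0 | exact/polynomial_mshift/polynomial_mshift/P].
have [h3 E3] : exists p1, toser p1 = gen3 (toser p).
  by apply: polynomial_super => -[] [] /=; rewrite /gen3;
    first [exact: polynomial0 | exact/polynomial_mshift/P].
have [h4 E4] : exists p1, toser p1 = gen4 (toser p).
  by apply: polynomial_super => -[] [] /=; rewrite /gen4;
    first [exact: polynomial0 | exact/polynomial_mshift/P].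
exists h1, h2, h3, h4; split=> //; apply: toser_inj.
rewrite [LHS](nullclass_generated p0) -E1 -E2 -E3 -E4 /generated.
have t1 (g : super (polyE R)) : toser (X1 g) = X1 (toser g) :> S.
  by apply/funext => c; apply/funext => d; exact: coefs_X1.
have t2 (g : super (polyE R)) : toser (X2 g) = X2 (toser g) :> S.
  by apply/funext => c; apply/funext => d; exact: coefs_X2.
have c0 := coefs0.
have t3 (g : super (polyE R)) : toser (X3 g) = X3 (toser g) :> S.
  by apply/funext => -[]; apply/funext => d; rewrite /toser /super_map /X3 ?c0.
have t4 (g : super (polyE R)) : toser (X4 g) = X4 (toser g) :> S.
  by apply/funext => c; apply/funext => -[]; rewrite /toser /super_map /X4 ?c0 ?coefsZ.
by case: ifP => _; rewrite !toserD ?toserZ !(t1, t2, t3, t4).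
Qed.
End Quotient.

(** * Linear operators and coefficientwise limits *)
Section LinearMaps.
Variables (K : numFieldType) (V : lmodType K).
Implicit Types (F : V -> V) (f g : V).

Definition linear_map F := forall (k : K) f g, F (k *: f + g) = k *: F f + F g.

Lemma linear_mapD F f g : linear_map F -> F (f + g) = F f + F g.
Proof. by move=> lF; have := lF 1 f g; rewrite !scale1r. Qed.
Lemma linear_map0 F : linear_map F -> F 0 = 0.
Proof. by move=> lF; have := lF (-1) 0 0; rewrite addr0 scaler0 scaleN1r addNr. Qed.
Lemma linear_mapZ F k f : linear_map F -> F (k *: f) = k *: F f.
Proof. by move=> lF; have := lF k f 0; rewrite (linear_map0 lF) !addr0. Qed.
Lemma linear_mapB F f g : linear_map F -> F (f - g) = F f - F g.
Proof. by move=> lF; rewrite -scaleN1r (linear_mapD _ _ lF) (linear_mapZ _ _ lF) scaleN1r. Qed.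
End LinearMaps.

Section Convergence.
Variable R : realType.
Local Notation C := (R[i]).
Local Notation S := (super (serE R)).
Implicit Types (f g s : S).

Definition ccvg (u : nat -> C) (l : C) :=
  (fun n => complex.Re (u n)) @ \oo --> complex.Re l /\
  (fun n => complex.Im (u n)) @ \oo --> complex.Im l.

Lemma ccvg_cst l : ccvg (fun=> l) l.
Proof. by split; exact: cvg_cst. Qed.

Lemma ReD (x y : C) : complex.Re (x + y) = complex.Re x + complex.Re y.
Proof. by case: x; case: y. Qed.
Lemma ImD (x y : C) : complex.Im (x + y) = complex.Im x + complex.Im y.
Proof. by case: x; case: y. Qed.
Lemma ReM (x y : C) : complex.Re (x * y) =
  complex.Re x * complex.Re y - complex.Im x * complex.Im y.
Proof. by case: x; case: y. Qed.
Lemma ImM (x y : C) : complex.Im (x * y) =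
  complex.Re x * complex.Im y + complex.Im x * complex.Re y.
Proof. by case: x => a b; case: y => c d. Qed.

Lemma ccvg_add u v l m : ccvg u l -> ccvg v m -> ccvg (fun n => u n + v n) (l + m).
Proof.
move=> [ur ui] [vr vi]; split.
  rewrite ReD; under eq_fun do rewrite ReD; exact: cvgD.
rewrite ImD; under eq_fun do rewrite ImD; exact: cvgD.
Qed.

Lemma ccvg_scale k u l : ccvg u l -> ccvg (fun n => k * u n) (k * l).
Proof.
move=> [ur ui]; split.
  rewrite ReM; under eq_fun do rewrite ReM.
  by apply: cvgB; apply: cvgM => //; exact: cvg_cst.
rewrite ImM; under eq_fun do rewrite ImM.
by apply: cvgD; apply: cvgM => //; exact: cvg_cst.
Qed.

Lemma ccvg_shift u l : ccvg (fun n => u n.+1) l <-> ccvg u l.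
Proof.
rewrite /ccvg; split=> -[ur ui]; split.
- by move: ur; rewrite (cvg_shiftS (fun n => complex.Re (u n))).
- by move: ui; rewrite (cvg_shiftS (fun n => complex.Im (u n))).
- by rewrite (cvg_shiftS (fun n => complex.Re (u n))).
- by rewrite (cvg_shiftS (fun n => complex.Im (u n))).
Qed.

Lemma ccvg_unique u l m : ccvg u l -> ccvg u m -> l = m.
Proof.
move=> [ur ui] [vr vi]; rewrite [l]complexE [m]complexE.
by rewrite (cvg_unique _ ur vr) // (cvg_unique _ ui vi).
Qed.

Definition cont_op (F : S -> S) := forall v s, scvg v s -> scvg (fun n => F (v n)) (F s).
Definition lincont F := linear_map F /\ cont_op F.

Lemma lincont_id : lincont id. Proof. by split. Qed.
Lemma lincont_comp F G : lincont F -> lincont G -> lincont (fun f => F (G f)).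
Proof.
move=> [lF cF] [lG cG]; split=> [k f g|v s h]; first by rewrite lG lF.
exact/cF/cG.
Qed.

Lemma scvg_add u v s t : scvg u s -> scvg v t -> scvg (fun n => u n + v n) (s + t).
Proof. by move=> us vt c d a b; apply: ccvg_add (us c d a b) (vt c d a b). Qed.
Lemma scvg_scale k u s : scvg u s -> scvg (fun n => k *: u n) (k *: s).
Proof. by move=> us c d a b; apply: ccvg_scale (us c d a b). Qed.

Lemma lincont_add F G : lincont F -> lincont G -> lincont (fun f => F f + G f).
Proof.
move=> [lF cF] [lG cG]; split=> [k f g|v s h].
  by rewrite lF lG scalerDr addrACA.
by apply: scvg_add; [exact: cF|exact: cG].
Qed.
Lemma lincont_scale z F : lincont F -> lincont (fun f => z *: F f).
Proof.
move=> [lF cF]; split=> [k f g|v s h].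
  by rewrite lF scalerDr !scalerA [z * k]mulrC.
exact/scvg_scale/cF.
Qed.
Lemma lincont_opp F : lincont F -> lincont (fun f => - F f).
Proof.
move=> gF; have := lincont_scale (-1) gF; congr lincont.
by apply/funext => f; exact: scaleN1r.
Qed.
Lemma lincont_0 : lincont (fun=> 0).
Proof.
split=> [k f g|v s h]; first by rewrite scaler0 addr0.
by move=> c d a b; exact: ccvg_cst.
Qed.
Lemma lincont_sum (n : nat) (F : 'I_n -> S -> S) : (forall i, lincont (F i)) ->
  lincont (fun f => \sum_(i < n) F i f).
Proof.
elim: n F => [|n IH] F gF.
  by have := lincont_0; congr lincont; apply/funext => f; rewrite big_ord0.
have := lincont_add (IH (fun i => F (widen_ord (leqnSn n) i)) (fun i => gF _)) (gF ord_max).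
by congr lincont; apply/funext => f; rewrite big_ord_recr.
Qed.

(** An operator each of whose output coefficients is a multiple of one input
coefficient is continuous for coefficientwise convergence. *)
Lemma lincont_pointwise F : linear_map F ->
  (forall c d a b, exists c' d' a' b' (z : C), forall f, F f c d a b = z * f c' d' a' b') ->
  lincont F.
Proof.
move=> lF h; split=> // v s vs c d a b.
have [c' [d' [a' [b' [z E]]]]] := h c d a b.
have := ccvg_scale z (vs c' d' a' b').
rewrite -/(ccvg (fun n => F (v n) c d a b) (F s c d a b)).
by rewrite E; congr ccvg; apply/funext => n; rewrite E.
Qed.

Ltac linop :=
  let k := fresh "k" in let f := fresh "f" in let g := fresh "g" in
  let c := fresh "c" in let d := fresh "d" in
  let a := fresh "a" in let b := fresh "b" in
  move=> k f g; apply: superP => c d a b; rewrite !(ev_add, ev_scale);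
  case: c; case: d; case: a => [|a]; case: b => [|b]; rewrite ?evE; ring.
Ltac ptwise c' d' a' b' z :=
  let f := fresh "f" in exists c', d', a', b', z; move=> f; rewrite ?evE; ring.

Lemma lincont_X1 : lincont (@X1 _ (serE R)).
Proof.
apply: lincont_pointwise => [|c d [|a] b]; first by linop.
  by ptwise c d 0%N b (0 : C).
by ptwise c d a b (1 : C).
Qed.
Lemma lincont_X2 : lincont (@X2 _ (serE R)).
Proof.
apply: lincont_pointwise => [|c d a [|b]]; first by linop.
  by ptwise c d a 0%N (0 : C).
by ptwise c d a b (1 : C).
Qed.
Lemma lincont_X3 : lincont (@X3 _ (serE R)).
Proof.
apply: lincont_pointwise => [|[] d a b]; first by linop.
  by ptwise false d a b (1 : C).
by ptwise false d a b (0 : C).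
Qed.
Lemma lincont_X4 : lincont (@X4 _ (serE R)).
Proof.
apply: lincont_pointwise => [|[] [] a b]; first by linop.
- by ptwise true false a b (-1 : C).
- by ptwise false false a b (0 : C).
- by ptwise false false a b (1 : C).
- by ptwise false false a b (0 : C).
Qed.
Lemma lincont_D1 : lincont (@D1 _ (serE R)).
Proof.
apply: lincont_pointwise => [|c d a b]; first by linop.
by ptwise c d a.+1 b (a.+1%:R : C).
Qed.
Lemma lincont_D2 : lincont (@D2 _ (serE R)).
Proof.
apply: lincont_pointwise => [|c d a b]; first by linop.
by ptwise c d a b.+1 (b.+1%:R : C).
Qed.
Lemma lincont_D3 : lincont (@D3 _ (serE R)).
Proof.
apply: lincont_pointwise => [|[] d a b]; first by linop.
  by ptwise false d a b (0 : C).
by ptwise true d a b (1 : C).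
Qed.
Lemma lincont_D4 : lincont (@D4 _ (serE R)).
Proof.
apply: lincont_pointwise => [|[] [] a b]; first by linop.
- by ptwise false false a b (0 : C).
- by ptwise true true a b (-1 : C).
- by ptwise false false a b (0 : C).
- by ptwise false true a b (1 : C).
Qed.

Lemma lincont_Xop i : lincont (@Xop _ (serE R) i).
Proof.
move: i; apply: forall_ord4; rewrite ?Xop_o; [exact: lincont_X1|exact: lincont_X2|
  exact: lincont_X3|exact: lincont_X4].
Qed.
Lemma lincont_Dop i : lincont (@Dop _ (serE R) i).
Proof.
move: i; apply: forall_ord4; rewrite ?Dop_o; [exact: lincont_D1|exact: lincont_D2|
  exact: lincont_D3|exact: lincont_D4].
Qed.

Ltac lincont_tac := cbv beta zeta; repeat match goal with
  | |- lincont (fun f => f) => exact: lincont_id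
  | |- lincont (fun f => @GRing.add _ (@?F f) (@?G f)) => apply: (@lincont_add F G)
  | |- lincont (fun f => @GRing.opp _ (@?F f)) => apply: (@lincont_opp F)
  | |- lincont (fun f => @GRing.scale _ _ ?k (@?F f)) => apply: (@lincont_scale k F)
  | |- lincont (fun f => @X1 _ _ (@?F f)) => apply: (@lincont_comp (@X1 _ (serE R)) F lincont_X1)
  | |- lincont (fun f => @X2 _ _ (@?F f)) => apply: (@lincont_comp (@X2 _ (serE R)) F lincont_X2)
  | |- lincont (fun f => @X3 _ _ (@?F f)) => apply: (@lincont_comp (@X3 _ (serE R)) F lincont_X3)
  | |- lincont (fun f => @X4 _ _ (@?F f)) => apply: (@lincont_comp (@X4 _ (serE R)) F lincont_X4)
  | |- lincont (fun f => @D1 _ _ (@?F f)) => apply: (@lincont_comp (@D1 _ (serE R)) F lincont_D1)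
  | |- lincont (fun f => @D2 _ _ (@?F f)) => apply: (@lincont_comp (@D2 _ (serE R)) F lincont_D2)
  | |- lincont (fun f => @D3 _ _ (@?F f)) => apply: (@lincont_comp (@D3 _ (serE R)) F lincont_D3)
  | |- lincont (fun f => @D4 _ _ (@?F f)) => apply: (@lincont_comp (@D4 _ (serE R)) F lincont_D4)
  end.

Variables al lam : R.
Lemma lincont_besselop i : lincont (besselop al lam (E := serE R) i).
Proof.
move: i; apply: forall_ord4; rewrite ?besselop_o.
- by rewrite /bessel1; lincont_tac.
- by rewrite /bessel2; lincont_tac.
- by rewrite /bessel3; lincont_tac.
- by rewrite /bessel4; lincont_tac.
Qed.
Lemma lincont_zmul u : lincont (zmul u (E := serE R)).
Proof. by apply: lincont_sum => i; apply/lincont_scale/lincont_Xop. Qed.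
Lemma lincont_bessel u : lincont (bessel al lam u (E := serE R)).
Proof. by apply: lincont_sum => i; apply/lincont_scale/lincont_besselop. Qed.
Lemma lincont_derT T : lincont (derT T (E := serE R)).
Proof.
apply: lincont_sum => i; apply: lincont_sum => j; apply: lincont_scale.
exact: (lincont_comp (lincont_Xop i) (lincont_Dop j)).
Qed.
Lemma lincont_piL u : lincont (piL al lam u (E := serE R)).
Proof.
by apply: lincont_add; [exact: lincont_scale _ lincont_id|exact/lincont_opp/lincont_derT].
Qed.
Lemma lincont_bessel_e : lincont (bessel_e al lam).
Proof.
apply: lincont_add; [have := lincont_besselop o1|have := lincont_besselop o2];
by rewrite besselop_o.
Qed.

End Convergence.

(** * Partial sums of an exponential series *)
Section ExponentialSums.
Variables (K : numFieldType) (V : lmodType K).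
Implicit Types (F : V -> V) (f g : V).

Lemma linear_map_combination F (k1 k2 k3 : K) (b1 l1 z1 l2 b2 d b3 : V) :
  linear_map F ->
  F ((k1 *: b1 + k2 *: l1 - k2 *: z1) + (l2 - k3 *: b2) + d - (- k1) *: b3) =
  k1 *: F b1 + k2 *: F l1 + (- k2) *: F z1 + (F l2 + (- k3) *: F b2) + F d
  + k1 *: F b3.
Proof.
move=> lF; rewrite !(linear_mapB _ _ lF, linear_mapD _ _ lF, linear_mapZ _ _ lF).
by rewrite !scaleNr opprK.
Qed.

Variable B : V -> V.
Hypothesis lB : linear_map B.

(** The term of degree n in exp(- B / 2). *)
Definition expterm (n : nat) f : V := ((- 2^-1) ^+ n / n`!%:R : K) *: iter n B f.
Definition expsum (N : nat) f : V := \sum_(n < N) expterm n f.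

Lemma exptermS n f : expterm n.+1 f = (- 2^-1 / n.+1%:R : K) *: B (expterm n f).
Proof.
rewrite /expterm iterS (linear_mapZ _ _ lB) scalerA.
by congr (_ *: _); rewrite exprS factS natrM invfM mulrACA.
Qed.

Lemma expterm0 f : expterm 0 f = f.
Proof. by rewrite /expterm expr0 fact0 divr1 scale1r. Qed.

Lemma expsumS N f : expsum N.+1 f = expsum N f + expterm N f.
Proof. by rewrite /expsum big_ord_recr. Qed.
Lemma expsum0 f : expsum 0 f = 0.
Proof. by rewrite /expsum big_ord0. Qed.

Lemma expterm_linear n : linear_map (expterm n).
Proof.
elim: n => [|n IH] k f g; first by rewrite !expterm0.
by rewrite !exptermS IH lB scalerDr !scalerA mulrC.
Qed.

Lemma expsum_linear n : linear_map (expsum n).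
Proof.
elim: n => [|n IH] k f g; first by rewrite !expsum0 scaler0 addr0.
by rewrite !expsumS IH expterm_linear scalerDr addrACA.
Qed.

Variables Y Z W : V -> V.
Hypothesis lY : linear_map Y.
Hypothesis lZ : linear_map Z.
Hypothesis lW : linear_map W.
Hypothesis BY : forall f, B (Y f) = Y (B f) + Z f.
Hypothesis BZ : forall f, B (Z f) = Z (B f) + W f.
Hypothesis BW : forall f, B (W f) = W (B f).

Lemma B_expterm n f : B (expterm n f) = - (2 * n.+1%:R) *: expterm n.+1 f.
Proof.
rewrite exptermS scalerA -[LHS]scale1r; congr (_ *: _).
have n1 : n.+1%:R != 0 :> K by rewrite pnatr_eq0.
by move: (n.+1%:R) n1 => x n1; field.
Qed.

Let BD f g : B (f + g) = B f + B g. Proof. exact: linear_mapD. Qed.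
Let BN f : B (- f) = - B f.
Proof. by have := linear_mapB 0 f lB; rewrite (linear_map0 lB) !sub0r. Qed.
Let BS k f : B (k *: f) = k *: B f. Proof. exact: linear_mapZ. Qed.
Let YD f g : Y (f + g) = Y f + Y g. Proof. exact: linear_mapD. Qed.
Let ZD f g : Z (f + g) = Z f + Z g. Proof. exact: linear_mapD. Qed.
Let WD f g : W (f + g) = W f + W g. Proof. exact: linear_mapD. Qed.
Let YS k f : Y (k *: f) = k *: Y f. Proof. exact: linear_mapZ. Qed.
Let ZS k f : Z (k *: f) = k *: Z f. Proof. exact: linear_mapZ. Qed.
Let WS k f : W (k *: f) = k *: W f. Proof. exact: linear_mapZ. Qed.

(** The terms of degree n + 2 in the identity
exp(- B/2) Y = (Y - (1/2) Z + (1/8) W) exp(- B/2), where Z = [B, Y] and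
W = [B, Z] commutes with B. *)
Lemma expterm_comm n f : expterm n.+2 (Y f) =
  Y (expterm n.+2 f) - 2^-1 *: Z (expterm n.+1 f) + 8%:R^-1 *: W (expterm n f).
Proof.
elim: n => [|n IH].
  rewrite !exptermS !expterm0 BY !BS !BD BY BZ !YS !ZS.
  rewrite !scalerDr !scalerA -!addrA; congr (_ + _).
  by rewrite addrA -scalerDl -scaleNr; congr (_ *: _ + _ *: _); field.
(* Pushing one more B through produces the three terms of the next degree; what
   remains is to compare the scalar coefficients. *)
rewrite exptermS IH !(BD, BN, BS) BY BZ BW !B_expterm.
move: (expterm n.+3 f) (expterm n.+2 f) (expterm n.+1 f) => e3 e2 e1.
rewrite !(YS, ZS, WS) !(@scalerDr K V, @scalerA K V, @scalerN K V, opprD).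
have n3 : n.+3%:R != 0 :> K by rewrite pnatr_eq0.
have -> : n.+2%:R = n.+3%:R - 1 :> K by rewrite -[n.+3%:R]natr1 addrK.
have -> : n.+1%:R = n.+3%:R - 2 :> K by rewrite -[n.+3%:R]natr1 -[n.+2%:R]natr1; ring.
move: (n.+3%:R) n3 => x x0.
rewrite -!addrA; congr (_ + _).
  by rewrite -[RHS]scale1r; congr (_ *: _); field.
rewrite !addrA -!(@scaleNr K V) -(@scalerDl K V) -addrA -(@scalerDl K V).
by congr (_ *: _ + _ *: _); field.
Qed.

(** The three partial sums have different lengths because the terms are graded
by the number of factors B; with these lengths the identity is exact. *)
Lemma expsum_comm n f : expsum n.+2 (Y f) =
  Y (expsum n.+2 f) - 2^-1 *: Z (expsum n.+1 f) + 8%:R^-1 *: W (expsum n f).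
Proof.
elim: n => [|n IH].
  rewrite !expsumS !expsum0 !add0r !exptermS !expterm0 BY.
  rewrite (linear_map0 lW) !YD !YS scaler0 addr0.
  by rewrite scalerDr addrA; congr (_ + _); rewrite -scaleNr; congr (_ *: _); field.
rewrite expsumS IH expterm_comm addrACA [X in X + _]addrACA.
by rewrite -opprD -!scalerDr -YD -ZD -WD -!expsumS.
Qed.
End ExponentialSums.

(** * The exponential of - B_e / 2 *)
Section Intertwining.
Variable R : realType.
Local Notation C := (R[i]).
Local Notation S := (super (serE R)).
Implicit Types (f g s : S).
Variables (al lam : R) (sw : bool).
Hypothesis al0 : al != 0.
Hypothesis hsw : if sw then lam = al else lam = 1 /\ al != 1.
Local Notation Be := (bessel_e al lam : S -> S).
Local Notation kz := (nullclass al sw).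

(** Continuous operators that preserve the ideal; these pass to limits in the
quotient. *)
Definition descends (F : S -> S) := lincont F /\ forall f, kz f -> kz (F f).

Lemma descends_zmul u : descends (zmul u (E := serE R)).
Proof. by split; [exact: lincont_zmul|move=> f; exact: (nullclass_zmul hsw)]. Qed.
Lemma descends_bessel u : descends (bessel al lam u (E := serE R)).
Proof. by split; [exact: lincont_bessel|move=> f; exact: (nullclass_bessel al0 hsw)]. Qed.
Lemma descends_piL u : descends (piL al lam u (E := serE R)).
Proof. by split; [exact: lincont_piL|move=> f; exact: (nullclass_piL al0 hsw)]. Qed.
Lemma descends_derT T : superder al T -> descends (derT T (E := serE R)).
Proof. by move=> dT; split; [exact: lincont_derT|move=> f; exact: (nullclass_derT hsw)]. Qed.

Local Notation qc := (qcvg al lam).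

Lemma eqmod_nullclass f g : eqmod al lam f g <-> kz (f - g).
Proof. by split; [exact: (ideal_nullclass hsw)|exact: (nullclass_ideal hsw)]. Qed.

Lemma qcvg_descends F u s : descends F -> qc u s -> qc (fun n => F (u n)) (F s).
Proof.
move=> [[lF cF] kF] [v [vu vs]]; exists (fun n => F (v n)); split; last exact: cF.
move=> n; have /eqmod_nullclass/kF := vu n; rewrite (linear_mapB _ _ lF).
by move/eqmod_nullclass.
Qed.

Lemma qcvg_add u v s t : qc u s -> qc v t -> qc (fun n => u n + v n) (s + t).
Proof.
move=> [u' [uu us]] [v' [vv vt]]; exists (fun n => u' n + v' n).
split; last exact: scvg_add.
move=> n; apply/eqmod_nullclass; have /eqmod_nullclass a := uu n; have /eqmod_nullclass b := vv n.
have -> : u' n + v' n - (u n + v n) = (u' n - u n) + (v' n - v n).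
  by rewrite opprD addrACA.
exact: nullclass_add.
Qed.

Lemma qcvg_scale k u s : qc u s -> qc (fun n => k *: u n) (k *: s).
Proof.
move=> [u' [uu us]]; exists (fun n => k *: u' n); split; last exact: scvg_scale.
move=> n; apply/eqmod_nullclass; have /eqmod_nullclass a := uu n.
by rewrite -scalerBr; exact: nullclass_scale.
Qed.

Lemma qcvg_succ u s : qc (fun n => u n.+1) s <-> qc u s.
Proof.
split=> -[v [vu vs]].
  exists (fun n => if n is m.+1 then v m else u 0%N); split.
    move=> [|n]; last exact: vu.
    by apply/eqmod_nullclass; rewrite subrr; exact: nullclass0.
  move=> c d a b; have := vs c d a b.
  exact: (proj1 (ccvg_shift (fun n => (if n is m.+1 then v m else u 0%N) c d a b) _)).
exists (fun n => v n.+1); split=> // c d a b.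
exact: (proj2 (ccvg_shift (fun n => v n c d a b) _) (vs c d a b)).
Qed.

Local Notation E := (expsum Be).

Lemma bessel_e_linear : linear_map Be.
Proof. by have [] := lincont_bessel_e al lam. Qed.

Lemma expsum_nullclass N f : kz f -> kz (E N f).
Proof.
move=> f0; apply: nullclass_sum => i; apply: nullclass_scale.
by elim: (nat_of_ord i) => // n IH; rewrite iterS; exact: (nullclass_bessel_e al0 hsw).
Qed.

Lemma qcvg_eq u v s t : u =1 v -> s = t -> qc u s -> qc v t.
Proof. by move=> /funext -> ->. Qed.

Lemma linear_map_opp (F : S -> S) : linear_map F -> linear_map (fun f => - F f).
Proof. by move=> lF k f g; rewrite lF opprD -scalerN. Qed.
Lemma linear_map_scale z (F : S -> S) : linear_map F -> linear_map (fun f => z *: F f).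
Proof. by move=> lF k f g; rewrite lF scalerDr !scalerA [z * k]mulrC. Qed.
Lemma linear_map_0 : linear_map (fun=> 0 : S).
Proof. by move=> k f g; rewrite scaler0 addr0. Qed.

Lemma expsum_zmul N u f : E N.+2 (zmul u f) =
  zmul u (E N.+2 f) + piL al lam u (E N.+1 f) + 4%:R^-1 *: bessel al lam u (E N f).
Proof.
have lz := (descends_zmul u).1.1; have lp := (descends_piL u).1.1.
have lb := (descends_bessel u).1.1.
have BY g : Be (zmul u g) = zmul u (Be g) + - (2 *: piL al lam u g).
  exact: bessel_e_zmul.
have BZ g : Be (- (2 *: piL al lam u g)) =
    - (2 *: piL al lam u (Be g)) + 2 *: bessel al lam u g.
  rewrite -[in LHS]scaleNr bessel_eZ (bessel_e_piL _ al0).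
  move: (piL _ _ _ _) (bessel _ _ _ _) => x y.
  by apply: superP => c d a b; rewrite !(ev_add, ev_opp, ev_scale); ring.
have BW g : Be (2 *: bessel al lam u g) = 2 *: bessel al lam u (Be g).
  by rewrite bessel_eZ (bessel_e_bessel _ al0).
rewrite (expsum_comm bessel_e_linear lz (linear_map_opp (linear_map_scale 2 lp))
  (linear_map_scale 2 lb) BY BZ BW).
move: (zmul _ _) (piL _ _ _ _) (bessel _ _ _ _) => x y z.
by apply: superP => c d a b; rewrite !(ev_add, ev_opp, ev_scale); field.
Qed.

Lemma expsum_piL N u f : E N.+2 (piL al lam u f) =
  piL al lam u (E N.+2 f) + 2^-1 *: bessel al lam u (E N.+1 f).
Proof.
have lp := (descends_piL u).1.1; have lb := (descends_bessel u).1.1.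
have BY g : Be (piL al lam u g) = piL al lam u (Be g) + - bessel al lam u g.
  exact: bessel_e_piL.
have BZ g : Be (- bessel al lam u g) = - bessel al lam u (Be g) + 0.
  by rewrite addr0 -scaleN1r bessel_eZ (bessel_e_bessel _ al0) scaleN1r.
have BW (g : S) : Be 0 = 0 by exact: (linear_map0 bessel_e_linear).
rewrite (expsum_comm bessel_e_linear lp (linear_map_opp lb) linear_map_0 BY BZ BW).
move: (piL _ _ _ _) (bessel _ _ _ _) => x y.
by apply: superP => c d a b; rewrite !(ev_add, ev_opp, ev_scale, ev_0); ring.
Qed.

Lemma expsum_commute N (Y : S -> S) f : linear_map Y ->
  (forall f, Be (Y f) = Y (Be f)) -> E N.+2 (Y f) = Y (E N.+2 f).
Proof.
move=> lY BY.
have BY' g : Be (Y g) = Y (Be g) + 0 by rewrite addr0.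
have BW (g : S) : Be 0 = 0 by exact: (linear_map0 bessel_e_linear).
have BZ (g : S) : Be 0 = 0 + 0 by rewrite addr0; exact: BW.
rewrite (expsum_comm bessel_e_linear lY linear_map_0 linear_map_0 BY' BZ BW).
move: (Y _) => x.
by apply: superP => c d a b; rewrite !(ev_add, ev_opp, ev_scale, ev_0); ring.
Qed.

Lemma qcvg_succ2 u s : qc (fun n => u n.+2) s <-> qc u s.
Proof. by rewrite (qcvg_succ (fun n => u n.+1)) qcvg_succ. Qed.

(** Conjugating [twrho] by exp(- B_e / 2): in the coefficient of a^- the terms
z_a + pi(L_a) + B(z_a) / 4, pi(L_a) + B(z_a) / 2 and B(z_a) combine to a
multiple of z_a, in that of L_a to pi(L_a). *)
Lemma expsum_twrho (X : tkk al) f s :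
  qc (fun N => E N f) s -> qc (fun N => E N (twrho lam X f)) (piact lam X s).
Proof.
move=> fs; apply: (proj1 (qcvg_succ2 (fun N => E N (twrho lam X f)) _)).
have fs1 : qc (fun N => E N.+1 f) s by exact: (proj2 (qcvg_succ (fun N => E N f) s)).
have fs2 : qc (fun N => E N.+2 f) s by exact: (proj2 (qcvg_succ2 (fun N => E N f) s)).
have Hz u : qc (fun N => E N.+2 (zmul u f))
    (zmul u s + piL al lam u s + 4%:R^-1 *: bessel al lam u s).
  apply: (qcvg_eq (fun N => esym (expsum_zmul N u f)) erefl).
  apply: qcvg_add; last exact/qcvg_scale/(qcvg_descends (descends_bessel u)).
  apply: qcvg_add; first exact/(qcvg_descends (descends_zmul u)).
  exact/(qcvg_descends (descends_piL u)).
have Hp u : qc (fun N => E N.+2 (piL al lam u f))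
    (piL al lam u s + 2^-1 *: bessel al lam u s).
  apply: (qcvg_eq (fun N => esym (expsum_piL N u f)) erefl).
  apply: qcvg_add; last exact/qcvg_scale/(qcvg_descends (descends_bessel u)).
  exact/(qcvg_descends (descends_piL u)).
have Hb u : qc (fun N => E N.+2 (bessel al lam u f)) (bessel al lam u s).
  have lb := (descends_bessel u).1.1.
  apply: (qcvg_eq (u := fun N => bessel al lam u (E N.+2 f)) _ erefl).
    by move=> N; rewrite (expsum_commute _ _ lb (fun g => bessel_e_bessel lam al0 u g)).
  exact/(qcvg_descends (descends_bessel u)).
have Hd : qc (fun N => E N.+2 (derT (tkk_der X) f)) (derT (tkk_der X) s).
  have dX := tkk_derP X.
  have ld := (descends_derT dX).1.1.
  apply: (qcvg_eq (u := fun N => derT (tkk_der X) (E N.+2 f)) _ erefl).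
    by move=> N; rewrite (expsum_commute _ _ ld (fun g => bessel_e_derT lam al0 g dX)).
  exact/(qcvg_descends (descends_derT dX)).
have lE N : linear_map (E N) by exact: (expsum_linear bessel_e_linear).
have H := qcvg_add (qcvg_add (qcvg_add (qcvg_add (qcvg_add
    (qcvg_scale (- ('i%C / 2)) (Hb (tkk_minus X)))
    (qcvg_scale (2 * 'i%C) (Hp (tkk_minus X))))
    (qcvg_scale (- (2 * 'i%C)) (Hz (tkk_minus X))))
    (qcvg_add (Hp (tkk_L X)) (qcvg_scale (- 2^-1) (Hb (tkk_L X)))))
    Hd) (qcvg_scale (- ('i%C / 2)) (Hb (tkk_plus X))).
apply: qcvg_eq H.
  move=> N; rewrite /twrho.
  have := linear_map_combination (- ('i%C / 2)) (2 * 'i%C) 2^-1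
    (bessel al lam (tkk_minus X) f) (piL al lam (tkk_minus X) f)
    (zmul (tkk_minus X) f) (piL al lam (tkk_L X) f) (bessel al lam (tkk_L X) f)
    (derT (tkk_der X) f) (bessel al lam (tkk_plus X) f) (lE N.+2).
  by rewrite opprK => ->.
rewrite /piact; move: (zmul (tkk_minus X) s)
  (bessel al lam (tkk_minus X) s) (bessel al lam (tkk_L X) s)
  (bessel al lam (tkk_plus X) s) (piL al lam (tkk_minus X) s)
  (piL al lam (tkk_L X) s) (derT (tkk_der X) s) => *.
by apply: superP => c d a b; rewrite !(ev_add, ev_opp, ev_scale); field.
Qed.

End Intertwining.

(** * The binomial series at - 1 / 2 *)
Section BinomialSeries.
Variable R : realType.
Implicit Types (nu : R) (n N : nat).

Definition falling nu n : R := \prod_(j < n) (nu - j%:R).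
Definition bterm nu n : R := (- 2^-1) ^+ n / n`!%:R * falling nu n.
Definition bsum nu N : R := \sum_(n < N) bterm nu n.

Lemma falling0 nu : falling nu 0 = 1.
Proof. by rewrite /falling big_ord0. Qed.
Lemma fallingSl nu n : falling nu n.+1 = nu * falling (nu - 1) n.
Proof.
rewrite /falling big_ord_recl subr0; congr (_ * _); apply: eq_bigr => i _.
by rewrite lift0 -natr1 opprD addrA addrAC.
Qed.
Lemma fallingSr nu n : falling nu n.+1 = falling nu n * (nu - n%:R).
Proof. by rewrite /falling big_ord_recr. Qed.

Lemma bterm0 nu : bterm nu 0 = 1.
Proof. by rewrite /bterm falling0 expr0 fact0 divr1 mulr1. Qed.

(** The Pascal rule for the binomial coefficients. *)
Lemma bterm_pascal nu n : bterm nu n.+1 = bterm (nu - 1) n.+1 - 2^-1 * bterm (nu - 1) n.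
Proof.
rewrite /bterm fallingSl fallingSr exprS factS natrM.
have n0 : n.+1%:R != 0 :> R by rewrite pnatr_eq0.
have f0 : n`!%:R != 0 :> R by rewrite pnatr_eq0 -lt0n fact_gt0.
have -> : nu - 1 - n%:R = nu - n.+1%:R by rewrite -natr1 opprD addrA addrAC.
move: (falling _ _) (n`!%:R) f0 (n.+1%:R) n0 (_ ^+ n) => f y y0 x x0 z.
by field; rewrite x0 y0.
Qed.

Lemma bsumS nu N : bsum nu N.+1 = bsum nu N + bterm nu N.
Proof. by rewrite /bsum big_ord_recr. Qed.
Lemma bsum0 nu : bsum nu 0 = 0.
Proof. by rewrite /bsum big_ord0. Qed.

Lemma bsum_pascal nu N : bsum nu N.+1 = bsum (nu - 1) N.+1 - 2^-1 * bsum (nu - 1) N.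
Proof.
elim: N => [|N IH]; first by rewrite !bsumS !bsum0 !bterm0 mulr0 subr0.
rewrite bsumS IH bterm_pascal (bsumS _ N.+1) (bsumS _ N).
ring.
Qed.

Lemma btermS nu n : bterm nu n.+1 = bterm nu n * ((n%:R - nu) / (2 * n.+1%:R)).
Proof.
rewrite /bterm fallingSr exprS factS natrM.
have n0 : n.+1%:R != 0 :> R by rewrite pnatr_eq0.
have f0 : n`!%:R != 0 :> R by rewrite pnatr_eq0 -lt0n fact_gt0.
move: (falling _ _) (n`!%:R) f0 (n.+1%:R) n0 (_ ^+ n) (n%:R) => f y y0 x x0 z w.
by field; rewrite x0 y0.
Qed.

Lemma bterm_ge0 nu n : nu <= 0 -> 0 <= bterm nu n.
Proof.
move=> nu0; elim: n => [|n IH]; first by rewrite bterm0.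
rewrite btermS mulr_ge0 // divr_ge0 ?mulr_ge0 ?ler0n //.
by rewrite subr_ge0 (le_trans nu0) ?ler0n.
Qed.

Lemma bterm_le nu n : - 1 <= nu -> nu <= 0 -> bterm nu n <= 2^-1 ^+ n.
Proof.
move=> nu1 nu0; elim: n => [|n IH]; first by rewrite bterm0.
rewrite btermS exprSr; apply: ler_pM => //; first exact: bterm_ge0.
  by rewrite divr_ge0 ?mulr_ge0 ?ler0n // subr_ge0 (le_trans nu0) ?ler0n.
rewrite invfM mulrCA ger_pMr ?invr_gt0 // ler_pdivrMr ?ltr0n // mul1r -natr1.
by rewrite lerD2l lerNl.
Qed.

Lemma bsum_le_succ nu N : nu <= 0 -> bsum nu N <= bsum nu N.+1.
Proof. by move=> nu0; rewrite bsumS lerDl bterm_ge0. Qed.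

(** For nu between - 1 and 0 the series is dominated by a geometric one.  For
smaller nu the Pascal rule bounds the partial sums at nu by twice those at
nu + 1, because the partial sums increase when nu is at most 0. *)
Lemma bsum_bounded (m : nat) nu : - m.+1%:R <= nu -> nu <= 0 ->
  exists M, forall N, bsum nu N <= M.
Proof.
elim: m nu => [|m IH] nu num nu0.
  exists 2 => N; have H : bsum nu N <= 2 - 2 * 2^-1 ^+ N.
    elim: N => [|N IHN]; first by rewrite bsum0 expr0 mulr1 subrr.
    rewrite bsumS; apply: (le_trans (lerD IHN (bterm_le N num nu0))).
    by rewrite exprS; lra.
  by apply: (le_trans H); rewrite gerBl mulr_ge0 // exprn_ge0.
(* The interval grows by one unit to the left at each step. *)
have [h|h] := lerP (- m.+1%:R) nu; first exact: IH.
have nu1 : nu + 1 <= 0.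
  have : (1 : R) <= m.+1%:R by rewrite ler1n.
  lra.
have [|M HM] := IH (nu + 1) _ nu1.
  by move: num; rewrite -[m.+2%:R]natr1; lra.
exists (2 * M) => N; apply: (le_trans (bsum_le_succ N nu0)).
have := bsum_pascal (nu + 1) N; rewrite addrK.
have := HM N.+1; have := bsum_le_succ N nu0; lra.
Qed.

(** For nu at most 0 the terms are nonnegative and the sums are bounded; the
Pascal rule carries convergence from nu - 1 to nu. *)
Lemma bsum_cvg nu : cvgn (bsum nu).
Proof.
have neg nu' : nu' <= 0 -> cvgn (bsum nu').
  move=> nu0; apply: nondecreasing_is_cvgn.
    by apply/nondecreasing_seqP => n; exact: bsum_le_succ.
  have [|M HM] := @bsum_bounded (Num.bound `|nu'|) nu' _ nu0.
    rewrite lerNl; apply: (le_trans (ler_norm _)); rewrite normrN -[leLHS]normr_id.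
    apply/ltW/(lt_le_trans (archi_boundP (normr_ge0 _))).
    by rewrite ler_nat normr_id.
  by exists M => _ [N _ <-].
have [h|h] := lerP nu 0; first exact: neg.
suff H (m : nat) nu' : nu' <= m%:R -> cvgn (bsum nu').
  apply: (H (Num.bound nu)); exact/ltW/archi_boundP/ltW.
elim: m nu' => [|m IH] nu' num; first exact: neg.
have c : cvgn (bsum (nu' - 1)) by apply: IH; rewrite lerBlDr natr1.
have c2 : (fun N => bsum nu' N.+1) @ \oo -->
    limn (bsum (nu' - 1)) - 2^-1 * limn (bsum (nu' - 1)).
  rewrite (_ : (fun N => bsum nu' N.+1) =
     (fun N => bsum (nu' - 1) N.+1 - 2^-1 * bsum (nu' - 1) N)).
    apply: cvgB; first by rewrite (cvg_shiftS (bsum (nu' - 1))); exact: c.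
    by apply: cvgM; [exact: cvg_cst|exact: c].
  by apply/funext => N; exact: bsum_pascal.
by move: c2; rewrite (cvg_shiftS (bsum nu')) => /cvgP.
Qed.

(** The value of the binomial series, (1 / 2)^nu.  Only its behaviour under
integer shifts of nu and its nonvanishing matter. *)
Definition blim nu : R := limn (bsum nu).

Lemma bsum_to nu : bsum nu @ \oo --> blim nu.
Proof. exact: bsum_cvg. Qed.

(** The limit of the Pascal rule. *)
Lemma blim_pred nu : blim (nu - 1) = 2 * blim nu.
Proof.
have c1 : (fun N => bsum nu N.+1) @ \oo --> blim nu.
  by rewrite (cvg_shiftS (bsum nu)); exact: bsum_to.
have c2 : (fun N => bsum nu N.+1) @ \oo --> blim (nu - 1) - 2^-1 * blim (nu - 1).
  rewrite (_ : (fun N => bsum nu N.+1) =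
     (fun N => bsum (nu - 1) N.+1 - 2^-1 * bsum (nu - 1) N)).
    apply: cvgB; first by rewrite (cvg_shiftS (bsum (nu - 1))); exact: bsum_to.
    by apply: cvgM; [exact: cvg_cst|exact: bsum_to].
  by apply/funext => N; exact: bsum_pascal.
have e : blim nu = blim (nu - 1) - 2^-1 * blim (nu - 1).
  exact: (cvg_unique _ c1 c2).
by rewrite e; lra.
Qed.

Lemma blim_sub nu k : blim (nu - k%:R) = 2 ^+ k * blim nu.
Proof.
elim: k => [|k IH]; first by rewrite subr0 mul1r.
by rewrite -natr1 opprD addrA blim_pred IH exprS mulrA.
Qed.

(** For nu at most 0 the sum is at least its first term 1, and the shift rule
reaches all other nu. *)
Lemma blim_neq0 nu : blim nu != 0.
Proof.
suff H (m : nat) nu' : nu' <= m%:R -> 0 < blim nu'.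
  have [h|h] := lerP nu 0; first by rewrite gt_eqF // (H 0%N).
  by rewrite gt_eqF // (H (Num.bound nu)) //; exact/ltW/archi_boundP/ltW.
elim: m nu' => [|m IH] nu' num.
  apply: (lt_le_trans ltr01); apply: limr_ge; first exact: bsum_cvg.
  exists 1%N => // N /= N0; case: N N0 => // N _.
  elim: N => [|N IHN]; first by rewrite bsumS bsum0 bterm0 add0r.
  exact/(le_trans IHN)/bsum_le_succ.
have := IH (nu' - 1); rewrite lerBlDr natr1 => /(_ num).
by rewrite blim_pred pmulr_rgt0.
Qed.
End BinomialSeries.

(** * Limits in the quotient and the image of the constant 1 *)
Section QuotientLimits.
Variable R : realType.
Local Notation C := (R[i]).
Local Notation S := (super (serE R)).
Local Notation P := (super (polyE R)).
Implicit Types (f g s : S).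
Variables (al lam : R) (sw : bool).
Hypothesis al0 : al != 0.
Hypothesis hsw : if sw then lam = al else lam = 1 /\ al != 1.
Local Notation Be := (bessel_e al lam : S -> S).
Local Notation kz := (nullclass al sw).
Local Notation kp := (qcoord al sw).
Local Notation qc := (qcvg al lam).

Lemma qcoord_cont v s c d k : scvg v s -> ccvg (fun n => kp (v n) c d k) (kp s c d k).
Proof.
move=> vs; rewrite /qcoord /coefn; case: (c && d); last first.
  by case: (sw); exact: vs.
have e (x : S) : 2 * (if sw then 1 else al%:C) * (if k is j.+1 then
  if sw then x true true j 0%N else x true true 0%N j else 0) -
  (if sw then x false false k 1%N else x false false 1%N k) =
  2 * (if sw then 1 else al%:C) * (if k is j.+1 then
  if sw then x true true j 0%N else x true true 0%N j else 0) +
  (-1) * (if sw then x false false k 1%N else x false false 1%N k) by rewrite mulN1r.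
rewrite e; under eq_fun do rewrite e.
apply: ccvg_add; apply: ccvg_scale; last by case: (sw); exact: vs.
by case: k {e} => [|k]; [exact: ccvg_cst|case: (sw); exact: vs].
Qed.

(** A representative with prescribed coordinates that depends continuously on
them; the component of x3 x4 is taken to be 0. *)
Definition lift_qcoord (q : bool -> bool -> nat -> C) : S := fun c d a b =>
  let k := if sw then a else b in let l := if sw then b else a in
  if c && d then 0 else
  if l is 0 then q c d k else
  if ~~ c && ~~ d && (l == 1%N) then - q true true k else 0.

Lemma qcoord_lift q c d k : kp (lift_qcoord q) c d k = q c d k.
Proof.
rewrite /qcoord /coefn /lift_qcoord; case: (sw); case: c; case: d; case: k => [|k] //=;
  by rewrite mulr0 sub0r opprK.
Qed.

Lemma lift_cont (u : nat -> bool -> bool -> nat -> C) q :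
  (forall c d k, ccvg (fun n => u n c d k) (q c d k)) ->
  scvg (fun n => lift_qcoord (u n)) (lift_qcoord q).
Proof.
move=> uq c d a b; rewrite -/(ccvg _ _) /lift_qcoord.
move: (if sw then a else b) (if sw then b else a) => k l.
case: (c && d); first exact: ccvg_cst.
case: l => [|l]; first exact: uq.
case: ifP => _; last exact: ccvg_cst.
have := ccvg_scale (-1) (uq true true k); rewrite mulN1r; congr ccvg.
by apply/funext => n; rewrite mulN1r.
Qed.

Lemma qcoord_opp f c d k : kp (- f) c d k = - kp f c d k.
Proof. by rewrite -scaleN1r qcoord_scale mulN1r. Qed.

(** Convergence in the quotient asks for convergent representatives, and
[lift_qcoord] provides them from the coordinates. *)
Lemma qcvgP u s : qc u s <-> forall c d k, ccvg (fun n => kp (u n) c d k) (kp s c d k).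
Proof.
split=> [[v [vu vs]] c d k|h].
  have := qcoord_cont c d k vs; congr ccvg; apply/funext => n.
  have /(eqmod_nullclass hsw)/(_ c d k) := vu n.
  by rewrite qcoord_add qcoord_opp => /eqP; rewrite subr_eq0 => /eqP.
exists (fun n => s + lift_qcoord (fun c d k => kp (u n) c d k - kp s c d k)); split.
  move=> n; apply/(eqmod_nullclass hsw) => c d k.
  by rewrite !qcoord_add qcoord_lift qcoord_opp; ring.
have z : lift_qcoord (fun c d k => 0) = 0.
  apply: superP => c d a b; rewrite /lift_qcoord; case: (c && d) => //.
  by case: (if sw then b else a) => // l; case: ifP; rewrite ?oppr0.
rewrite -[s in scvg _ s]addr0; apply: scvg_add; first by move=> c d a b; exact: ccvg_cst.
rewrite -z; apply: lift_cont => c d k.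
rewrite -(subrr (kp s c d k)); apply: ccvg_add; [exact: h|exact: ccvg_cst].
Qed.

Lemma qcvg_unique u s t c d k : qc u s -> qc u t -> kp s c d k = kp t c d k.
Proof. by move=> /qcvgP us /qcvgP ut; exact: ccvg_unique (us c d k) (ut c d k). Qed.

Lemma ccvg_real (u : nat -> R) (l : R) : u @ \oo --> l -> ccvg (fun n => (u n)%:C) l%:C.
Proof. by move=> ul; split=> //=; exact: cvg_cst. Qed.

Local Notation mu := (main_param al sw).
Lemma econv_delta (z : C) a :
  econv (fun i => if i == 0%N then z else 0) a = (-1) ^+ a / a`!%:R * z.
Proof.
rewrite /econv big_ord_recr /= subnn eqxx big1 ?add0r // => i _.
by rewrite subn_eq0 leqNgt ltn_ord mulr0.
Qed.

Definition exp_m1 : S := expmul (pone R).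

(** The coordinates of e^(- x1 - x2), both those at (false, false) and those at
(true, true). *)
Definition exp_coef (k : nat) : C := (-1) ^+ k / k`!%:R.

Lemma coefs_pone c d a b : toser (pone R) c d a b =
   if ~~ c && ~~ d && (a == 0%N) && (b == 0%N) then 1 else 0.
Proof.
rewrite /toser /super_map /pone /polymono; case: c; case: d => /=; rewrite ?coefs0 //.
by rewrite coefs_mono ![_ == 0%N]eq_sym; case: ifP.
Qed.

Lemma exp_m1E c d a b : exp_m1 c d a b =
  if ~~ c && ~~ d then (-1) ^+ (a + b) / (a`! * b`!)%:R else 0.
Proof.
rewrite /exp_m1 expmulE /emul.
have E a' b' : coefs (pone R c d) a' b' =
    if ~~ c && ~~ d && (a' == 0%N) && (b' == 0%N) then 1 else 0.
  exact: coefs_pone.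
case: ifP => cd; last first.
  rewrite -[RHS](econv0 _ a); apply: eq_econv => a'.
  by rewrite -[RHS](econv0 _ b); apply: eq_econv => b'; rewrite E cd.
transitivity (econv (fun a' => if a' == 0%N then (-1) ^+ b / b`!%:R * 1 else 0 : C) a).
  apply: eq_econv => a'; case: eqP => [->|/eqP/negPf a0].
    by rewrite -econv_delta; apply: eq_econv => b'; rewrite E cd eqxx.
  by rewrite -[RHS](econv0 _ b); apply: eq_econv => b'; rewrite E cd a0.
by rewrite econv_delta mulr1 exprD natrM invfM mulrACA.
Qed.

Lemma qcoord_bessel_e f c d k : kp (Be f) c d k =
  k.+1%:R * (k%:R + (if c (+) d then 1 else 0) - mu%:C) * kp f c d k.+1 +
  if c || d then 0 else kp f true true k.
Proof.
rewrite -(qcoord_B_main al0 hsw) -(qcoord_B_small al0 hsw) -qcoord_add; congr qcoord.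
by rewrite /B_main /B_small /bessel_e; case: (sw) => //; rewrite addrC.
Qed.

Lemma qcoord_exp_m1 c d k : kp exp_m1 c d k = if c == d then exp_coef k else 0.
Proof.
rewrite /qcoord /coefn /exp_coef; case: c; case: d; case: (sw); case: k => [|k] /=;
 rewrite ?exp_m1E /= ?addn0 ?add0n ?addn1 ?add1n ?muln1 ?mul1n ?mulr0 ?fact0 //
   ?sub0r ?expr1 ?exprS ?mulN1r ?mulNr ?opprK //;
 by rewrite expr0 mul1r.
Qed.

Definition bfall (n k : nat) : C := (falling (mu - k%:R) n)%:C.

Lemma exp_coefS k : exp_coef k.+1 * k.+1%:R = - exp_coef k.
Proof.
rewrite /exp_coef exprS factS natrM.
have n0 : k.+1%:R != 0 :> C by rewrite pnatr_eq0.
have f0 : k`!%:R != 0 :> C by rewrite pnatr_eq0 -lt0n fact_gt0.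
move: (k`!%:R) f0 (k.+1%:R) n0 (_ ^+ k) => y y0 x x0 z.
by field; rewrite x0 y0.
Qed.

Lemma bfallS n k : bfall n.+1 k = (mu%:C - k%:R) * bfall n k.+1.
Proof.
rewrite /bfall fallingSl rmorphM rmorphB rmorph_nat; congr (_ * (falling _ n)%:C).
by rewrite -[k.+1%:R]natr1 opprD addrA.
Qed.

(** On each coordinate [bessel_e] is a lowering operator, and it adds the
coordinate at (true, true) to that at (false, false); the latter happens once in
each of n positions, whence the factor n. *)
Lemma qcoord_iter n c d k : kp (iter n Be exp_m1) c d k =
  if c == d then exp_coef k * (bfall n k + (if c then 0 else n%:R * bfall n.-1 k)) else 0.
Proof.
elim: n c d k => [|n IH] c d k.
  rewrite qcoord_exp_m1 /bfall falling0; case: ifP => // _.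
  by case: c; rewrite ?mul0r addr0 mulr1.
rewrite iterS qcoord_bessel_e !IH; case: c; case: d => /=; rewrite ?mulr0 ?addr0 //.
- have w : exp_coef k = - (exp_coef k.+1 * k.+1%:R) by rewrite exp_coefS opprK.
  by rewrite bfallS w; ring.
- have w : exp_coef k = - (exp_coef k.+1 * k.+1%:R) by rewrite exp_coefS opprK.
  by case: n {IH} => [|n]; rewrite /= !(bfallS _ k) w; ring.
Qed.

Lemma complex_natr (n : nat) : (n%:R)%:C = n%:R :> C.
Proof. exact: rmorph_nat. Qed.

Lemma ctermE n : ((- 2^-1) ^+ n / n`!%:R : C) = ((- 2^-1) ^+ n / n`!%:R)%:C.
Proof. by rewrite rmorphM fmorphV rmorph_nat rmorphXn rmorphN fmorphV rmorph_nat. Qed.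

Lemma bsumC N k : (bsum (mu - k%:R) N)%:C =
  \sum_(n < N) ((- 2^-1) ^+ n / n`!%:R : C) * bfall n k.
Proof.
rewrite /bsum rmorph_sum; apply: eq_bigr => n _.
by rewrite ctermE -rmorphM.
Qed.

Lemma qcoord_sum N (F : 'I_N -> S) c d k :
  kp (\sum_(n < N) F n) c d k = \sum_(n < N) kp (F n) c d k.
Proof.
apply: (big_morph (fun f => kp f c d k)) => [f g|]; first exact: qcoord_add.
exact: nullclass0.
Qed.

Lemma qcoord_expsum N c d k : kp (expsum Be N.+1 exp_m1) c d k =
  if c == d then exp_coef k * ((bsum (mu - k%:R) N.+1)%:C -
     if c then 0 else 2^-1 * (bsum (mu - k%:R) N)%:C) else 0.
Proof.
rewrite /expsum qcoord_sum; under eq_bigr => n _ do rewrite qcoord_scale qcoord_iter.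
case: (c == d); last by rewrite big1 // => n _; rewrite mulr0.
case: c.
  rewrite subr0 bsumC mulr_sumr; apply: eq_bigr => n _.
  by rewrite addr0 mulrCA.
have e2 : \sum_(n < N.+1) ((- 2^-1) ^+ n / n`!%:R : C) * (n%:R * bfall n.-1 k) =
    - (2^-1 * (bsum (mu - k%:R) N)%:C).
  rewrite big_ord_recl mul0r mulr0 add0r bsumC mulr_sumr -sumrN.
  apply: eq_bigr => n _; rewrite lift0 /=.
  rewrite exprS factS natrM.
  have n0 : n.+1%:R != 0 :> C by rewrite pnatr_eq0.
  have f0 : n`!%:R != 0 :> C by rewrite pnatr_eq0 -lt0n fact_gt0.
  move: (n`!%:R) f0 (n.+1%:R) n0 (_ ^+ n) (bfall n k) => y y0 x x0 z b.
  by field; rewrite x0 y0.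
rewrite -e2 bsumC -big_split mulr_sumr; apply: eq_bigr => n _ /=.
by rewrite -mulrDr mulrCA.
Qed.

(** The power series of e^(- 2 (x1 + x2)). *)
Definition exp_m2 : S := fun c d a b =>
  if ~~ c && ~~ d then (- 2) ^+ (a + b) / (a`! * b`!)%:R else 0.

Lemma qcoord_exp_m2 c d k : kp exp_m2 c d k =
  if c == d then (if c then 2 else 1) * (2 ^+ k * exp_coef k) else 0.
Proof.
have p2 n : (- 2) ^+ n = 2 ^+ n * (-1) ^+ n :> C by rewrite -exprMn mulrN1.
rewrite /qcoord /coefn /exp_coef /exp_m2; case: c; case: d; case: (sw); case: k => [|k] /=;
 rewrite ?p2 ?addn0 ?add0n ?addn1 ?add1n ?muln1 ?mul1n ?mulr0 ?fact0 ?sub0r //;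
 rewrite -?[1`!]/1%N ?exprS ?expr0; by field; rewrite ?pnatr_eq0 -?lt0n ?fact_gt0.
Qed.

(** The coordinates of the partial sums are partial binomial series at mu - k,
and the shift rule turns their limits into 2^k times the limit at mu, which is
the factor between the coordinates of e^(- x1 - x2) and of e^(- 2 (x1 + x2)).
The factor 1 / 2 comes from the contribution of the coordinate at (true, true). *)
Lemma expsum_one : qc (fun N => expsum Be N exp_m1) ((2^-1 * blim mu)%:C *: exp_m2).
Proof.
apply/(qcvg_succ hsw)/qcvgP => c d k; rewrite qcoord_scale qcoord_exp_m2.
under eq_fun do rewrite qcoord_expsum.
case: (c == d); last by rewrite mulr0; exact: ccvg_cst.
(* Both partial sums in the coordinate have this limit. *)
have bl : blim (mu - k%:R) = 2 ^+ k * blim mu by exact: blim_sub.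
have b0 := ccvg_real (@bsum_to R (mu - k%:R)); rewrite bl in b0.
have b1 : ccvg (fun n => (bsum (mu - k%:R) n.+1)%:C) (2 ^+ k * blim mu)%:C.
  exact: (proj2 (ccvg_shift (fun n => (bsum (mu - k%:R) n)%:C) _)).
have e : (2 ^+ k * blim mu)%:C = 2 ^+ k * (blim mu)%:C :> C.
  by rewrite rmorphM rmorphXn rmorph_nat.
have h : (2^-1 * blim mu)%:C = 2^-1 * (blim mu)%:C :> C.
  by rewrite complex_mul complex_half.
rewrite e in b0 b1; rewrite h.
case: c.
  have -> : 2^-1 * (blim mu)%:C * (2 * (2 ^+ k * exp_coef k)) =
      exp_coef k * (2 ^+ k * (blim mu)%:C).
    by field.
  by apply: ccvg_scale; under eq_fun do rewrite subr0.
have -> : 2^-1 * (blim mu)%:C * (1 * (2 ^+ k * exp_coef k)) =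
    exp_coef k * (2 ^+ k * (blim mu)%:C + (- 2^-1) * (2 ^+ k * (blim mu)%:C)) by field.
apply: ccvg_scale; under eq_fun do rewrite -mulNr.
by apply: ccvg_add => //; exact: ccvg_scale.
Qed.

Lemma exp_m2_nonzero : kp ((2^-1 * blim mu)%:C *: exp_m2) false false 0 != 0.
Proof.
rewrite qcoord_scale qcoord_exp_m2 /exp_coef /= !expr0 !mul1r fact0 invr1 mulr1.
by rewrite (inj_eq (@complexI R)) mulf_neq0 ?invr_eq0 ?blim_neq0.
Qed.
End QuotientLimits.

(** * The module generated by the constant 1 *)
Section Generation.
Variable R : realType.
Local Notation C := (R[i]).
Local Notation S := (super (serE R)).
Local Notation P := (super (polyE R)).

Lemma toser_zmul u (p : P) : toser (zmul u p) = zmul u (toser p).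
Proof.
apply: (transports_toser (F' := zmul u)); apply: transports_zmul => //.
- by move=> x y _ _; apply: coefsD.
- by move=> x y _; apply: coefsZ.
- by move=> x _; apply: coefs_X1.
- by move=> x _; apply: coefs_X2.
Qed.

Lemma zmul_basis (E : evenAlg C) i (f : super E) : zmul (Defs.basis R i) f = Xop i f.
Proof.
rewrite /zmul (bigD1 i) //= basisE eqxx scale1r big1 ?addr0 // => j ji.
by rewrite basisE (negPf ji) scale0r.
Qed.

Definition embed c d (m : mpoly.mpoly 2 C) : P :=
  fun c' d' => if (c' == c) && (d' == d) then m else 0.

(** The induction behind all generation arguments: for the module generated by
1, for the image of the transform, and for the smoothness of p e^(- 2 (x1 + x2)). *)
Lemma super_poly_ind (Q : P -> Prop) : Q (pone R) ->
  (forall p q, Q p -> Q q -> Q (p + q)) -> (forall (k : C) p, Q p -> Q (k *: p)) ->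
  (forall i p, Q p -> Q (Xop i p)) -> forall p, Q p.
Proof.
move=> Q1 QD QZ QX.
have QX1 p : Q p -> Q (X1 p) by move=> /(QX o1); rewrite Xop_o.
have QX2 p : Q p -> Q (X2 p) by move=> /(QX o2); rewrite Xop_o.
have QX3 p : Q p -> Q (X3 p) by move=> /(QX o3); rewrite Xop_o.
have QX4 p : Q p -> Q (X4 p) by move=> /(QX o4); rewrite Xop_o.
have Q0 : Q 0 by rewrite -(scale0r (pone R)); exact: QZ.
have em_mono a b : Q (embed false false (mpoly.mpolyX C (mono a b))).
  elim: a => [|a IH]; first elim: b => [|b IH]; first exact: Q1.
    have -> : embed false false (mpoly.mpolyX C (mono 0 b.+1)) =
       X2 (embed false false (mpoly.mpolyX C (mono 0 b))).
      apply/funext => -[]; apply/funext => -[] /=; rewrite /X2 /embed /= ?mulr0 //.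
      by rewrite mono_U2 mpoly.mpolyXD mulrC.
    exact: QX2.
  have -> : embed false false (mpoly.mpolyX C (mono a.+1 b)) =
     X1 (embed false false (mpoly.mpolyX C (mono a b))).
    apply/funext => -[]; apply/funext => -[] /=; rewrite /X1 /embed /= ?mulr0 //.
    by rewrite mono_U1 mpoly.mpolyXD mulrC.
  exact: QX1.
have em00 m : Q (embed false false m).
  elim/mpoly.mpolyind : m => [|k m p _ _ IH].
    rewrite (_ : embed _ _ _ = 0) //.
    by apply/funext => -[]; apply/funext => -[].
  have -> : embed false false (k *: mpoly.mpolyX C m + p) =
     k *: embed false false (mpoly.mpolyX C m) + embed false false p.
    apply/funext => -[]; apply/funext => -[] //=; rewrite /embed /=;
    by rewrite -[RHS]/(k *: 0 + 0) scaler0 addr0.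
  apply: QD => //; apply: QZ; rewrite (mono_eta m); exact: em_mono.
have em01 m : Q (embed false true m).
  rewrite (_ : embed _ _ _ = X4 (embed false false m)); first exact: QX4.
  apply/funext => -[]; apply/funext => -[] //=; rewrite /X4 /embed /= ?scaler0 //.
  by rewrite expr0 scale1r.
have em10 d m : Q (embed true d m).
  rewrite (_ : embed _ _ _ = X3 (embed false d m)).
    by apply: QX3; case: d.
  by apply/funext => -[]; apply/funext => -[].
move=> p; have -> : p = embed false false (p false false) + embed false true (p false true)
   + embed true false (p true false) + embed true true (p true true).
  apply/funext => c; apply/funext => d.
  rewrite -[RHS]/(embed false false (p false false) c d + embed false true (p false true) c d
   + embed true false (p true false) c d + embed true true (p true true) c d).
  by case: c; case: d; rewrite /embed /= ?addr0 ?add0r.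
by apply: (QD) => //; apply: (QD) => //; apply: (QD).
Qed.
End Generation.

Section Submodule.
Variable R : realType.
Local Notation C := (R[i]).
Local Notation S := (super (serE R)).
Local Notation P := (super (polyE R)).
Variables (al lam : R).
Hypothesis al0 : al != 0.

Lemma toser_bessel u (p : P) : toser (bessel al lam u p) = bessel al lam u (toser p).
Proof.
apply: (transports_toser (F' := bessel al lam u)); apply: transports_bessel => //.
- by move=> x y _ _; apply: coefsD.
- by move=> x y _; apply: coefsZ.
- by move=> x _; apply: coefs_X1.
- by move=> x _; apply: coefs_X2.
- by move=> x _; apply: coefs_D1.
- by move=> x _; apply: coefs_D2.
Qed.

Lemma superder0 : superder al 0.
Proof.
exists 0, 0; rewrite addr0; split=> //; split=> [i j|i b]; rewrite ?mxE ?eqxx //;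
 rewrite !mul0mx /jprod !mxE; apply/matrixP => k l; rewrite !mxE; ring.
Qed.

(** The elements L_u and u^- + u^+: under rho they act by (z_u - B(z_u)) / 2 and
by - i (z_u + B(z_u)). *)
Definition tkk_Lel (u : Dal R) : tkk al := TKK 0 u 0 superder0.
Definition tkk_pm (u : Dal R) : tkk al := TKK u 0 u superder0.

Lemma zmul0 (f : S) : zmul 0 f = 0.
Proof. by rewrite /zmul big1 // => i _; rewrite mxE; exact: scale0r. Qed.
Lemma bessel0 (f : S) : bessel al lam 0 f = 0.
Proof. by rewrite /bessel big1 // => i _; rewrite mxE; exact: scale0r. Qed.
Lemma piL0 (f : S) : piL al lam 0 f = 0.
Proof. by rewrite piL_pi_Lop big1 // => i _; rewrite mxE; exact: scale0r. Qed.
Lemma derT0 (f : S) : derT 0 f = 0.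
Proof.
by rewrite /derT big1 // => i _; rewrite big1 // => j _; rewrite mxE; exact: scale0r.
Qed.

Lemma rho_Lel u (f : S) : rhoact lam (tkk_Lel u) f = 2^-1 *: (zmul u f - bessel al lam u f).
Proof.
rewrite /rhoact /= !zmul0 !bessel0 !piL0 derT0.
move: (zmul _ _) (bessel _ _ _ _) => x y.
by apply: superP => c d a b; rewrite !(ev_add, ev_opp, ev_scale, ev_0); ring.
Qed.
Lemma rho_pm u (f : S) : rhoact lam (tkk_pm u) f = - 'i%C *: (zmul u f + bessel al lam u f).
Proof.
rewrite /rhoact /= !zmul0 !bessel0 derT0.
move: (zmul _ _) (bessel _ _ _ _) (piL _ _ _ _) => x y z.
by apply: superP => c d a b; rewrite !(ev_add, ev_opp, ev_scale, ev_0); field.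
Qed.

Lemma toser_combination (k1 k2 : C) (p q : P) (f g : S) : toser p = f -> toser q = g ->
  toser (k1 *: p + k2 *: q) = k1 *: f + k2 *: g.
Proof. by move=> <- <-; rewrite toserD !toserZ. Qed.

(** In the combination of the two actions the Bessel operators cancel; in
[bessel_rho] the multiplications do. *)
Lemma zmul_rho u (p : P) : zmul u p =
  1 *: rhoact lam (tkk_Lel u) p + ('i%C / 2) *: rhoact lam (tkk_pm u) p.
Proof.
apply: toser_inj.
have e : zmul u (toser p) = 1 *: rhoact lam (tkk_Lel u) (toser p)
    + ('i%C / 2) *: rhoact lam (tkk_pm u) (toser p).
  rewrite rho_Lel rho_pm; move: (zmul _ _) (bessel _ _ _ _) => x y.
  have ii : 'i%C * 'i%C = -1 :> C by rewrite -expr2 sqr_i.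
  apply: superP => c d a b; rewrite !(ev_add, ev_opp, ev_scale, ev_0).
  have eii z w : 'i%C / 2 * (- 'i%C * (z + w)) = - ('i%C * 'i%C) * (2^-1 * (z + w)) :> C.
    by ring.
  by rewrite eii ii; field.
exact: (etrans (toser_zmul u p) (etrans e (esym (toser_combination 1 ('i%C / 2)
  (toser_rhoact lam (tkk_Lel u) p) (toser_rhoact lam (tkk_pm u) p))))).
Qed.
Lemma bessel_rho u (p : P) : bessel al lam u p =
  (-1) *: rhoact lam (tkk_Lel u) p + ('i%C / 2) *: rhoact lam (tkk_pm u) p.
Proof.
apply: toser_inj.
have e : bessel al lam u (toser p) = (-1) *: rhoact lam (tkk_Lel u) (toser p)
    + ('i%C / 2) *: rhoact lam (tkk_pm u) (toser p).
  rewrite rho_Lel rho_pm; move: (zmul _ _) (bessel _ _ _ _) => x y.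
  have ii : 'i%C * 'i%C = -1 :> C by rewrite -expr2 sqr_i.
  apply: superP => c d a b; rewrite !(ev_add, ev_opp, ev_scale, ev_0).
  have eii z w : 'i%C / 2 * (- 'i%C * (z + w)) = - ('i%C * 'i%C) * (2^-1 * (z + w)) :> C.
    by ring.
  by rewrite eii ii; field.
exact: (etrans (toser_bessel u p) (etrans e (esym (toser_combination (-1) ('i%C / 2)
  (toser_rhoact lam (tkk_Lel u) p) (toser_rhoact lam (tkk_pm u) p))))).
Qed.

(** Multiplication by a coordinate is a combination of operators rho(X), and
these multiplications generate all superpolynomials from 1. *)
Lemma inF_all (p : P) : inF al lam p.
Proof.
elim/super_poly_ind : p => [|p q|k p|i p ip].
- exact: inF_one.
- exact: inF_add.
- exact: inF_scale.
- rewrite -zmul_basis zmul_rho; apply: inF_add; exact/inF_scale/inF_rho.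
Qed.
End Submodule.

(** * Bijectivity modulo the ideal *)
Section Bijection.
Variable R : realType.
Local Notation C := (R[i]).
Local Notation S := (super (serE R)).
Local Notation P := (super (polyE R)).
Variables (al lam : R) (sw : bool).
Hypothesis al0 : al != 0.
Hypothesis hsw : if sw then lam = al else lam = 1 /\ al != 1.
Local Notation mu := (main_param al sw).
Hypothesis mu_nat : ~ exists n : nat, mu = n%:R.
Local Notation Be := (bessel_e al lam : S -> S).
Local Notation kz := (nullclass al sw).
Local Notation kp := (qcoord al sw).
Local Notation qc := (qcvg al lam).
Local Notation Cinv := (Cinv al lam).

Lemma CinvE (p : P) (s : S) : Cinv p s = qc (fun N => expsum Be N (expmul p)) s.
Proof.
rewrite /Defs.Cinv.
have e : (fun g : S => bessel1 al lam g + bessel2 al lam g) = Be by [].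
by rewrite e; congr qcvg.
Qed.

Lemma Cinv_add p q s t : Cinv p s -> Cinv q t -> Cinv (p + q) (s + t).
Proof.
rewrite !CinvE => ps qt; apply: (qcvg_eq _ erefl (qcvg_add hsw ps qt)) => N.
by rewrite expmulD (linear_mapD _ _ (expsum_linear (bessel_e_linear al lam) N)).
Qed.

Lemma Cinv_scale (k : C) p s : Cinv p s -> Cinv (k *: p) (k *: s).
Proof.
rewrite !CinvE => ps; apply: (qcvg_eq _ erefl (qcvg_scale hsw k ps)) => N.
by rewrite expmulZ (linear_mapZ _ _ (expsum_linear (bessel_e_linear al lam) N)).
Qed.

Lemma Cinv_rhoact (X : tkk al) p s : Cinv p s -> Cinv (rhoact lam X p) (piact lam X s).
Proof.
rewrite !CinvE => ps; apply: (qcvg_eq _ erefl (expsum_twrho al0 hsw X ps)) => N.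
by rewrite expmul_rhoact.
Qed.

(** Multiplication by e^(- x1 - x2) and the operators in the partial sums
preserve the ideal. *)
Lemma Cinv_eqmod p q s : eqmod al lam p q -> Cinv p s -> Cinv q s.
Proof.
move=> pq; rewrite !CinvE; move=> [v [vu vs]].
exists v; split; last exact: vs.
move=> n.
apply/(eqmod_nullclass hsw); have /(eqmod_nullclass hsw) a := vu n.
have /(ideal_nullclass hsw) b := expmul_ideal pq.
have := expsum_nullclass al0 hsw n b.
have -> : expmul (p - q) = expmul p - expmul q.
  by rewrite -scaleN1r expmulD expmulZ scaleN1r.
rewrite (linear_mapB _ _ (expsum_linear (bessel_e_linear al lam) n)) => c.
have -> : v n - expsum Be n (expmul q) = (v n - expsum Be n (expmul p)) +
    (expsum Be n (expmul p) - expsum Be n (expmul q)).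
  by rewrite addrA subrK.
exact: (nullclass_add a c).
Qed.

Lemma Cinv_one : Cinv (pone R) ((2^-1 * blim mu)%:C *: exp_m2 R).
Proof. by rewrite CinvE; have := expsum_one al0 hsw. Qed.

Lemma piact0 (X : tkk al) : piact lam X (0 : S) = 0.
Proof.
have lz := (descends_zmul hsw (tkk_minus X)).1.1.
have lp := (descends_piL al0 hsw (tkk_L X)).1.1.
have lb := (descends_bessel al0 hsw (tkk_plus X)).1.1.
have ld := (descends_derT hsw (tkk_derP X)).1.1.
rewrite /piact (linear_map0 lz) (linear_map0 lp) (linear_map0 lb) (linear_map0 ld).
by rewrite !scaler0 subr0 !addr0.
Qed.

Let K p := Cinv p 0.

Lemma K_add p q : K p -> K q -> K (p + q).
Proof. by move=> kp' kq; have := Cinv_add kp' kq; rewrite addr0. Qed.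
Lemma K_scale (k : C) p : K p -> K (k *: p).
Proof. by move=> /(Cinv_scale k); rewrite scaler0. Qed.
Lemma K_rho (X : tkk al) p : K p -> K (rhoact lam X p).
Proof. by move=> /(Cinv_rhoact X); rewrite piact0. Qed.
Lemma K_zmul u p : K p -> K (zmul u p).
Proof.
move=> Kp; rewrite (zmul_rho al lam u p).
by apply: K_add; apply/K_scale/K_rho.
Qed.
Lemma K_bessel u p : K p -> K (bessel al lam u p).
Proof.
move=> Kp; rewrite (bessel_rho al lam u p).
by apply: K_add; apply/K_scale/K_rho.
Qed.

Definition main_index : 'I_4 := if sw then o1 else o2.
Definition small_index : 'I_4 := if sw then o2 else o1.
Lemma bessel_basis (E : evenAlg C) i (f : super E) :
  bessel al lam (Defs.basis R i) f = besselop al lam i f.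
Proof.
rewrite /bessel (bigD1 i) //= basisE eqxx scale1r big1 ?addr0 // => j ji.
by rewrite basisE (negPf ji) scale0r.
Qed.

Lemma toser_B_main p :
  toser (bessel al lam (Defs.basis R main_index) p) = B_main al lam sw (toser p).
Proof.
rewrite toser_bessel bessel_basis /main_index /B_main.
by case: (sw); rewrite besselop_o.
Qed.
Lemma toser_B_small p :
  toser (bessel al lam (Defs.basis R small_index) p) = B_small al lam sw (toser p).
Proof.
rewrite toser_bessel bessel_basis /small_index /B_small.
by case: (sw); rewrite besselop_o.
Qed.
Lemma toser_X_small p : toser (zmul (Defs.basis R small_index) p) = X_small sw (toser p).
Proof.
rewrite toser_zmul zmul_basis /small_index /X_small.
by case: (sw); rewrite Xop_o.
Qed.
Lemma toser_X3 p : toser (zmul (Defs.basis R o3) p) = X3 (toser p).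
Proof. by rewrite toser_zmul zmul_basis Xop_o. Qed.
Lemma toser_X4 p : toser (zmul (Defs.basis R o4) p) = X4 (toser p).
Proof. by rewrite toser_zmul zmul_basis Xop_o. Qed.

Lemma mcoeff_large (m : mpoly.mpoly 2 C) : exists N, forall a b, (N <= a + b)%N -> coefs m a b = 0.
Proof.
exists (mpoly.msize m) => a b h; apply: mpoly.memN_msupp_eq0.
apply/negP => /mpoly.msize_mdeg_lt; rewrite ltnNge mpoly.mdegE big_ord_recl big_ord1.
have -> : (lift ord0 ord0 : 'I_2) = ord_max by exact/val_inj.
by rewrite mono_i0 mono_i1 h.
Qed.

Lemma qcoord_toser_large (p : P) : exists N, forall k, (N <= k)%N -> kp (toser p) false false k = 0.
Proof.
have [N HN] := mcoeff_large (p false false); exists N => k h.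
by rewrite /qcoord /coefn /=; case: (sw); rewrite /toser /super_map HN // ?addn0 ?add0n.
Qed.

(** Classes all of whose coordinates are at (false, false), that is, polynomials
in the main variable. *)
Definition pure (p : P) := forall c d k, (c || d) -> kp (toser p) c d k = 0.

Lemma pure_B_small p : pure (bessel al lam (Defs.basis R small_index) p).
Proof. by move=> c d k cd; rewrite toser_B_small (qcoord_B_small al0 hsw) cd. Qed.

(** [B_small] carries the coordinate at (true, true) to (false, false) and kills
the others; a suitable multiplication first brings any nonzero coordinate to
(true, true). *)
Lemma K_pure p : K p -> ~ kz (toser p) ->
  exists q k, [/\ K q, pure q & kp (toser q) false false k != 0].
Proof.
move=> Kp np.
have [c [d [k nk]]] : exists c d k, kp (toser p) c d k != 0.
  by apply: contra_notP np => h c d k; apply/eqP/negPn/negP => nk; apply: h; exists c, d, k.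
have b0 := beta_neq0 sw al0.
case: c nk => nk; case: d nk => nk.
- exists (bessel al lam (Defs.basis R small_index) p), k; split;
    [exact: K_bessel|exact: pure_B_small|].
  by rewrite toser_B_small (qcoord_B_small al0 hsw).
- exists (bessel al lam (Defs.basis R small_index) (zmul (Defs.basis R o4) p)), k.+1.
  split; [exact/K_bessel/K_zmul|exact: pure_B_small|].
  rewrite toser_B_small (qcoord_B_small al0 hsw) /= toser_X4 (qcoord_X4 hsw) /=.
  by rewrite !mulf_neq0 // oppr_eq0 pnatr_eq0.
- exists (bessel al lam (Defs.basis R small_index) (zmul (Defs.basis R o3) p)), k.+1.
  split; [exact/K_bessel/K_zmul|exact: pure_B_small|].
  rewrite toser_B_small (qcoord_B_small al0 hsw) /= toser_X3 (qcoord_X3 hsw) /=.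
  by rewrite !mulf_neq0 // pnatr_eq0.
- exists (bessel al lam (Defs.basis R small_index) (zmul (Defs.basis R small_index) p)), k.
  split; [exact/K_bessel/K_zmul|exact: pure_B_small|].
  by rewrite toser_B_small (qcoord_B_small al0 hsw) /=
    toser_X_small (qcoord_X_small hsw) /= oppr_eq0.
Qed.

(** A pure class of degree d is lowered d times by [B_main]; no factor
vanishes, because mu is not a natural number. *)
Lemma K_lower d q : K q -> pure q -> kp (toser q) false false d != 0 ->
  (forall k, (d < k)%N -> kp (toser q) false false k = 0) ->
  exists q', [/\ K q', pure q', kp (toser q') false false 0 != 0 &
    forall k, (0 < k)%N -> kp (toser q') false false k = 0].
Proof.
elim: d q => [|d IH] q Kq pq nq zq; first by exists q.
apply: (IH (bessel al lam (Defs.basis R main_index) q)); first exact: K_bessel.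
- by move=> c e k ce; rewrite toser_B_main (qcoord_B_main al0 hsw) pq // mulr0.
- rewrite toser_B_main (qcoord_B_main al0 hsw) /= !mulf_neq0 ?pnatr_eq0 // addr0 subr_eq0.
  apply/negP => /eqP e; apply: mu_nat; exists d; apply: (@complexI R).
  by rewrite -e rmorph_nat.
- by move=> k dk; rewrite toser_B_main (qcoord_B_main al0 hsw) zq ?mulr0.
Qed.

(** A nonzero class in the kernel would yield a nonzero constant in the kernel,
whereas the image of 1 is nonzero. *)
Lemma Cinv_injective p : Cinv p 0 -> kz (toser p).
Proof.
move=> Kp; apply: contrapT => /(K_pure Kp) [q [k0 [Kq pq nq]]].
have [N HN] := qcoord_toser_large q.
have bd k : kp (toser q) false false k != 0 -> (k <= N)%N.
  by move=> nk; rewrite leqNgt; apply: contra_neqN nk => /ltnW/HN.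
(* The degree of q. *)
case: (ex_maxnP (ex_intro _ k0 nq) bd) => d nd maxd.
have [|q' [Kq' pq' n0 z']] := K_lower Kq pq nd.
  by move=> k dk; apply/eqP/negPn/negP => /maxd; rewrite leqNgt dk.
pose c := kp (toser q') false false 0.
have E : eqmod al lam q' (c *: pone R).
  apply: (nullclass_toser_ideal hsw) => a b k.
  have -> : toser (q' - c *: pone R) = toser q' + (- c) *: toser (pone R) :> S.
    by rewrite -toserZ -toserD scaleNr.
  rewrite qcoord_add qcoord_scale.
  have -> : kp (toser (pone R)) a b k = if ~~ a && ~~ b && (k == 0%N) then 1 else 0.
    rewrite /qcoord /coefn; case: a; case: b; case: (sw); case: k => [|k];
    by rewrite /= !coefs_pone ?mulr0 ?subr0 //= andbF.
  case: a; case: b => /=; rewrite ?mulr0 ?addr0; try exact: pq'.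
  by case: k => [|k]; rewrite /= ?mulr1 ?subrr // mulr0 addr0 z'.
have h1 := Cinv_eqmod E Kq'; have h2 := Cinv_scale c Cinv_one.
have := qcvg_unique hsw false false 0 h1 h2.
rewrite qcoord_scale (nullclass0 _ _ _) => /eqP; rewrite eq_sym mulf_eq0 (negPf n0) /=.
by move=> /eqP e; have := exp_m2_nonzero al sw; rewrite e eqxx.
Qed.

(** The image is stable under pi(a^-) = - 2 i z_a and contains the series of
e^(- 2 (x1 + x2)).  The map [Phi] is p |-> p e^(- 2 (x1 + x2)), described by its
linearity, its compatibility with the coordinates and its value at 1. *)
Lemma Cinv_surjective (Phi : P -> S) :
  (forall p q, Phi (p + q) = Phi p + Phi q) -> (forall (k : C) p, Phi (k *: p) = k *: Phi p) ->
  (forall i p, Phi (Xop i p) = Xop i (Phi p)) -> Phi (pone R) = exp_m2 R ->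
  forall q, exists p, Cinv p (Phi q).
Proof.
move=> PD PZ PX P1 q.
elim/super_poly_ind : q => [|q r [p hp] [p' hp']|k q [p hp]|i q [p hp]].
- exists ((2^-1 * blim mu)%:C^-1 *: pone R).
  have := Cinv_scale (2^-1 * blim mu)%:C^-1 Cinv_one.
  rewrite scalerA mulVf; first by rewrite scale1r P1.
  by rewrite (inj_eq (@complexI R)) mulf_neq0 ?invr_eq0 ?blim_neq0.
- by exists (p + p'); rewrite PD; exact: Cinv_add.
- by exists (k *: p); rewrite PZ; exact: Cinv_scale.
(* The element (e_i)^-, which acts as - 2 i z_i under pi. *)
pose X := TKK (Defs.basis R i) 0 0 (superder0 al).
exists (- (2 * 'i%C)^-1 *: rhoact lam X p).
have := Cinv_scale (- (2 * 'i%C)^-1) (Cinv_rhoact X hp).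
rewrite PX; congr Cinv.
rewrite /piact /= zmul_basis piL0 // bessel0 derT0.
move: (Xop i _) => x; apply: superP => c d a b.
have i0 : 'i%C != 0 :> C by rewrite eq_complex /= oner_eq0 andbF.
by rewrite !(ev_add, ev_opp, ev_scale, ev_0); field.
Qed.
End Bijection.

(** * Calculus of smooth functions of two variables *)
Section SmoothFunctions.
Variable R : realType.
Implicit Types (f g h : R -> R -> R) (x y : R) (i : bool).

(** The two partial derivatives are treated at once: [i] is the variable that
moves, [true] for the second. *)
Definition slice i f x y : R -> R := if i then f x else fun t => f t y.
Definition slice_pt i x y : R := if i then y else x.

Definition regular f : Prop :=
  continuous (fun u : R * R => f u.1 u.2) /\
  forall x y, derivable (fun t => f t y) x 1 /\ derivable (f x) y 1.

Lemma rpder_is_derive f i x y : regular f ->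
  is_derive (slice_pt i x y) (1 : R) (slice i f x y) (rpder i f x y).
Proof.
move=> [_ /(_ x y)[fx fy]]; rewrite /rpder /slice /slice_pt; case: i.
  by rewrite derive1E; apply: derivableP; exact: fy.
by rewrite derive1E; apply: derivableP; exact: fx.
Qed.

Lemma rpder_val f i x y v : is_derive (slice_pt i x y) (1 : R) (slice i f x y) v ->
  rpder i f x y = v.
Proof.
rewrite /rpder /slice /slice_pt; case: i => fv;
by rewrite derive1E; exact: derive_val.
Qed.

Lemma regular_intro f : continuous (fun u : R * R => f u.1 u.2) ->
  (forall i x y, exists v, is_derive (slice_pt i x y) (1 : R) (slice i f x y) v) ->
  regular f.
Proof.
move=> cf df; split=> // x y; split.
  by have [v] := df false x y => -[].
by have [v] := df true x y => -[].
Qed.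

Lemma rsmooth_regular f : rsmooth f -> regular f.
Proof. by move=> /(_ [::]). Qed.

Lemma rsmooth_rpder i f : rsmooth f -> rsmooth (rpder i f).
Proof. by move=> sf w; have := sf (rcons w i); rewrite foldr_rcons. Qed.

(** Coinduction: smoothness of sums, of products with a coordinate and of the
exponential is proved by exhibiting a class closed under partial derivatives. *)
Lemma rsmooth_coind (Q : (R -> R -> R) -> Prop) : (forall f, Q f -> regular f) ->
  (forall i f, Q f -> Q (rpder i f)) -> forall f, Q f -> rsmooth f.
Proof.
move=> Qr Qd f Qf w; apply: Qr; elim: w => //= i w; exact: Qd.
Qed.

Lemma rpder_lin i f g (a b : R) : regular f -> regular g ->
  rpder i (fun x y => a * f x y + b * g x y) =
  (fun x y => a * rpder i f x y + b * rpder i g x y).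
Proof.
move=> rf rg; apply/funext => x; apply/funext => y; apply: rpder_val.
have df := rpder_is_derive i x y rf; have dg := rpder_is_derive i x y rg.
have := is_deriveD (is_deriveZ a df) (is_deriveZ b dg).
by case: i {df dg}.
Qed.

Lemma regular_lin f g (a b : R) : regular f -> regular g ->
  regular (fun x y => a * f x y + b * g x y).
Proof.
move=> rf rg; apply: regular_intro.
  move=> u; apply: cvgD; apply: cvgM; try exact: cvg_cst.
    exact: rf.1.
  exact: rg.1.
move=> i x y; exists (a * rpder i f x y + b * rpder i g x y).
have df := rpder_is_derive i x y rf; have dg := rpder_is_derive i x y rg.
have := is_deriveD (is_deriveZ a df) (is_deriveZ b dg).
by case: i {df dg}.
Qed.

Lemma rsmooth_lin f g (a b : R) : rsmooth f -> rsmooth g ->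
  rsmooth (fun x y => a * f x y + b * g x y).
Proof.
move=> sf sg; pose Q h := exists f g, [/\ rsmooth f, rsmooth g &
  h = fun x y => a * f x y + b * g x y].
apply: (@rsmooth_coind Q); last by exists f, g.
- by move=> _ [k [l [sk sl ->]]]; apply: regular_lin; exact: rsmooth_regular.
- move=> i _ [k [l [sk sl ->]]]; exists (rpder i k), (rpder i l).
  by split; [exact: rsmooth_rpder|exact: rsmooth_rpder|apply: rpder_lin; exact: rsmooth_regular].
Qed.

Definition coordfun i : R -> R -> R := fun x y => if i then y else x.

Lemma coord_is_derive i j x y :
  is_derive (slice_pt i x y) (1 : R) (slice i (coordfun j) x y) (if i == j then 1 else 0).
Proof.
rewrite /slice /coordfun; case: i; case: j => /=.
- exact: is_derive_id.
- exact: is_derive_cst.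
- exact: is_derive_cst.
- exact: is_derive_id.
Qed.

Lemma coord_mul_is_derive i j f x y : regular f ->
  is_derive (slice_pt i x y) (1 : R) (slice i (fun x y => coordfun j x y * f x y) x y)
    (coordfun j x y * rpder i f x y + (if i == j then f x y else 0)).
Proof.
move=> rf; have df := rpder_is_derive i x y rf; have dc := coord_is_derive i j x y.
have := is_deriveM dc df.
have e1 : slice i (coordfun j) x y (slice_pt i x y) = coordfun j x y by case: i {dc df}.
have e2 : slice i f x y (slice_pt i x y) = f x y by case: i {dc df e1}.
rewrite e1 e2.
have -> : coordfun j x y *: rpder i f x y + f x y *: (if i == j then 1 else 0) =
  coordfun j x y * rpder i f x y + (if i == j then f x y else 0).
  by case: ifP => _; rewrite ?scaler0 //; congr (_ + _); exact: mulr1.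
by case: i {df dc e1 e2}.
Qed.

Lemma rpder_coord_mul i j f : regular f ->
  rpder i (fun x y => coordfun j x y * f x y) =
  (fun x y => coordfun j x y * rpder i f x y + (if i == j then f x y else 0)).
Proof.
move=> rf; apply/funext => x; apply/funext => y; apply: rpder_val.
exact: coord_mul_is_derive.
Qed.

Lemma regular_coord_mul j f : regular f -> regular (fun x y => coordfun j x y * f x y).
Proof.
move=> rf; apply: regular_intro.
  move=> u; apply: cvgM; last exact: rf.1.
  by rewrite /coordfun; case: j; [exact: cvg_snd|exact: cvg_fst].
by move=> i x y; eexists; exact: coord_mul_is_derive.
Qed.

Lemma rsmooth_coord_mul j f : rsmooth f -> rsmooth (fun x y => coordfun j x y * f x y).
Proof.
move=> sf; pose Q h := exists f g, [/\ rsmooth f, rsmooth g &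
  h = fun x y => 1 * (coordfun j x y * f x y) + 1 * g x y].
have s0 : rsmooth (fun _ _ : R => 0 : R).
  have e : (fun _ _ : R => 0 : R) = (fun x y => 0 * f x y + 0 * f x y).
    by apply/funext => x; apply/funext => y; rewrite !mul0r addr0.
  by rewrite e; exact: rsmooth_lin.
apply: (@rsmooth_coind Q).
- move=> _ [k [l [sk sl ->]]]; apply: regular_lin; last exact: rsmooth_regular.
  by apply: regular_coord_mul; apply: rsmooth_regular.
- move=> i _ [k [l [sk sl ->]]].
  exists (rpder i k), (fun x y => (if i == j then 1 else 0) * k x y + 1 * rpder i l x y).
  split; [exact: rsmooth_rpder|exact: (rsmooth_lin _ _ sk (rsmooth_rpder i sl))|].
  have rk := rsmooth_regular sk; have rl := rsmooth_regular sl.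
  rewrite (rpder_lin _ _ _ (regular_coord_mul j rk) rl) (rpder_coord_mul _ _ rk).
  apply/funext => x; apply/funext => y.
  by case: ifP => _; ring.
- exists f, (fun _ _ : R => 0 : R); split=> //.
  by apply/funext => x; apply/funext => y; rewrite mulr0 addr0 mul1r.
Qed.

Definition gauss x y : R := expR (- 2 * (x + y)).

Lemma gauss_is_derive i x y (k : R) :
  is_derive (slice_pt i x y) (1 : R) (slice i (fun x y => k * gauss x y) x y)
    (- 2 * k * gauss x y).
Proof.
have c1 : is_derive (slice_pt i x y) (1 : R)
    (slice i (coordfun false) x y \+ slice i (coordfun true) x y) 1.
  have := is_deriveD (coord_is_derive i false x y) (coord_is_derive i true x y).
  by case: i; rewrite /= ?add0r ?addr0.
have c2 := is_deriveZ (- 2) c1.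
have c3 := is_derive1_comp (is_derive_expR _) c2.
have := is_deriveZ k c3; rewrite /slice /slice_pt /gauss /coordfun.
by case: i {c1 c2 c3} => /=; congr is_derive; rewrite /GRing.scale /=; ring.
Qed.

Lemma rpder_gauss i (k : R) : rpder i (fun x y => k * gauss x y) =
  (fun x y => - 2 * k * gauss x y).
Proof.
by apply/funext => x; apply/funext => y; apply: rpder_val; exact: gauss_is_derive.
Qed.

Lemma rsmooth_gauss (k : R) : rsmooth (fun x y => k * gauss x y).
Proof.
apply: (@rsmooth_coind (fun f => exists k, f = fun x y => k * gauss x y)); last by exists k.
- move=> _ [l ->]; apply: regular_intro.
    move=> u; apply: cvgM; first exact: cvg_cst.
    apply: (continuous_comp (f := fun u : R * R => - 2 * (u.1 + u.2)) (g := expR)).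
      apply: cvgM; first exact: cvg_cst.
      by apply: cvgD; [exact: cvg_fst|exact: cvg_snd].
    exact: continuous_expR.
  by move=> i x y; eexists; exact: gauss_is_derive.
- by move=> i _ [l ->]; exists (- 2 * l); exact: rpder_gauss.
Qed.
End SmoothFunctions.

(** * Symmetry of the mixed partial derivatives *)
Section Schwarz.
Variable R : realType.
Implicit Types (f g h : R -> R -> R) (x y : R) (i : bool).

Lemma mvt_step (phi dphi : R -> R) x (h : R) :
  (forall t, is_derive t (1 : R) phi (dphi t)) -> 0 < h ->
  exists2 c, x < c < x + h & phi (x + h) - phi x = dphi c * h.
Proof.
move=> df h0.
have [c cab e] : exists2 c, c \in `]x, (x + h)[%R &
    phi (x + h) - phi x = dphi c * (x + h - x).
  have lt : x < x + h by rewrite ltrDl.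
  apply: (MVT lt (fun t tin => df t)).
  apply: derivable_within_continuous => t tin.
  exact: (@ex_derive _ _ _ _ _ _ _ (df t)).
exists c; first by move: cab; rewrite in_itv.
by rewrite e addrAC subrr add0r.
Qed.

(** The second difference of f over the corners of a square is a difference of
differences in two ways; the mean value theorem, applied twice to each, gives
the two mixed derivatives at points of the square. *)
Lemma schwarz_box f x y (h : R) : rsmooth f -> 0 < h ->
  exists a b c d, [/\ x < a < x + h, y < b < y + h, x < c < x + h, y < d < y + h &
    rpder true (rpder false f) a b = rpder false (rpder true f) c d].
Proof.
move=> sf h0.
have rf := rsmooth_regular sf.
have r1 := rsmooth_regular (rsmooth_rpder false sf).
have r2 := rsmooth_regular (rsmooth_rpder true sf).
have p1 t : is_derive t (1 : R) (fun t => f t (y + h) - f t y)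
    (rpder false f t (y + h) - rpder false f t y).
  exact: (is_deriveB (rpder_is_derive false t (y + h) rf) (rpder_is_derive false t y rf)).
have p2 t : is_derive t (1 : R) (fun t => f (x + h) t - f x t)
    (rpder true f (x + h) t - rpder true f x t).
  exact: (is_deriveB (rpder_is_derive true (x + h) t rf) (rpder_is_derive true x t rf)).
have [a xa ea] := mvt_step x p1 h0.
have [d yd ed] := mvt_step y p2 h0.
have [b yb eb] := mvt_step y (fun t => rpder_is_derive true a t r1) h0.
have [c xc ec] := mvt_step x (fun t => rpder_is_derive false t d r2) h0.
have e1 : (f (x + h) (y + h) - f (x + h) y) - (f x (y + h) - f x y) =
    rpder true (rpder false f) a b * h * h.
  exact: (etrans ea (congr1 (fun z => z * h) eb)).
have e2 : (f (x + h) (y + h) - f x (y + h)) - (f (x + h) y - f x y) =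
    rpder false (rpder true f) c d * h * h.
  exact: (etrans ed (congr1 (fun z => z * h) ec)).
exists a, b, c, d; split; [exact: xa|exact: yb|exact: xc|exact: yd|].
have h2 : h * h != 0 by rewrite mulf_neq0 // gt_eqF.
apply: (mulIf h2); move: e1 e2.
move: (rpder true _ a b) (rpder false _ c d) => p q; rewrite !mulrA => <- <-.
ring.
Qed.

Lemma near_box (G : R -> R -> R) x y (e : R) :
  continuous (fun u : R * R => G u.1 u.2) -> 0 < e ->
  exists2 r, 0 < r & forall a b, x < a < x + r -> y < b < y + r -> `|G x y - G a b| < e.
Proof.
move=> cG e0.
have := cG (x, y) => /cvgr_dist_lt /(_ e e0) /nbhs_ballP[r /= r0 Br].
exists r => // a b /andP[xa ax] /andP[yb By].
apply: (Br (a, b)); split => /=; rewrite /ball /= ltr_distlC; apply/andP; split; lra.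
Qed.

Lemma schwarz f : rsmooth f -> rpder true (rpder false f) = rpder false (rpder true f).
Proof.
move=> sf; apply/funext => x; apply/funext => y.
have s1 := rsmooth_regular (rsmooth_rpder true (rsmooth_rpder false sf)).
have s2 := rsmooth_regular (rsmooth_rpder false (rsmooth_rpder true sf)).
apply/eqP; rewrite -subr_eq0 -normr_eq0; apply/eqP/le_anti; rewrite normr_ge0 andbT.
apply/ler_addgt0Pr => e e0; rewrite add0r.
have e2 : 0 < e / 2 by rewrite divr_gt0.
have [r r0 Hr] := near_box x y s1.1 e2.
have [s s0 Hs] := near_box x y s2.1 e2.
(* One square in which both mixed derivatives are close to their values at (x, y). *)
pose h := Num.min r s.
have h0 : 0 < h by rewrite lt_min r0 s0.
have hr : h <= r by rewrite ge_min lexx.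
have hs : h <= s by rewrite ge_min lexx orbT.
have [a [b [c [d [xa yb xc yd E]]]]] := schwarz_box x y sf h0.
have A : `|rpder true (rpder false f) x y - rpder true (rpder false f) a b| < e / 2.
  apply: Hr; [move: xa|move: yb] => /andP[-> /=] l; apply: (lt_le_trans l); by rewrite lerD2l.
have B : `|rpder false (rpder true f) x y - rpder false (rpder true f) c d| < e / 2.
  apply: Hs; [move: xc|move: yd] => /andP[-> /=] l; apply: (lt_le_trans l); by rewrite lerD2l.
rewrite E in A; move: A B.
move: (rpder true _ _ _) (rpder false _ x y) (rpder false _ c d) => p q m A B.
rewrite (_ : p - q = (p - m) - (q - m)); last by ring.
apply: (le_trans (ler_normB _ _)); rewrite [e]splitr.
by apply: lerD; exact: ltW.
Qed.
End Schwarz.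

(** * Taylor series *)
Section TaylorReal.
Variable R : realType.
Implicit Types (f g h : R -> R -> R) (x y : R) (i : bool).

Definition rtaylor f (a b : nat) : R := iter a (rpder false) (iter b (rpder true) f) 0 0.

Lemma rsmooth_iter n i f : rsmooth f -> rsmooth (iter n (rpder i) f).
Proof.
move=> sf; elim: n => [|n IH]; first exact: sf.
by rewrite iterS; exact: rsmooth_rpder.
Qed.

Lemma iter_lin n i f g (a b : R) : rsmooth f -> rsmooth g ->
  iter n (rpder i) (fun x y => a * f x y + b * g x y) =
  (fun x y => a * iter n (rpder i) f x y + b * iter n (rpder i) g x y).
Proof.
move=> sf sg; elim: n => [|n IH]; first by [].
have rf := rsmooth_regular (rsmooth_iter n i sf).
have rg := rsmooth_regular (rsmooth_iter n i sg).
by rewrite iterS IH (rpder_lin _ _ _ rf rg).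
Qed.

Lemma iter_coord_eq n i f : rsmooth f ->
  iter n (rpder i) (fun x y => coordfun i x y * f x y) =
  (fun x y => 1 * (coordfun i x y * iter n (rpder i) f x y) + n%:R * iter n.-1 (rpder i) f x y).
Proof.
move=> sf; elim: n => [|n IH].
  by apply/funext => x; apply/funext => y /=; rewrite mul0r addr0 mul1r.
have sn := rsmooth_iter n i sf; have sn1 := rsmooth_iter n.-1 i sf.
rewrite iterS IH (rpder_lin _ _ _ (rsmooth_regular (rsmooth_coord_mul i sn)) (rsmooth_regular sn1)).
rewrite (rpder_coord_mul _ _ (rsmooth_regular sn)) eqxx.
apply/funext => x; apply/funext => y.
case: n {IH sn sn1} => [|n] /=; first by ring.
by rewrite -[in RHS]natr1; ring.
Qed.

Lemma iter_coord_neq n i j f : i != j -> rsmooth f ->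
  iter n (rpder i) (fun x y => coordfun j x y * f x y) =
  (fun x y => coordfun j x y * iter n (rpder i) f x y).
Proof.
move=> ij sf; elim: n => [|n IH]; first by [].
rewrite iterS IH (rpder_coord_mul _ _ (rsmooth_regular _)).
  by apply/funext => x; apply/funext => y; rewrite (negPf ij) addr0.
exact: rsmooth_iter.
Qed.

Lemma iter_swap n f : rsmooth f ->
  iter n (rpder true) (rpder false f) = rpder false (iter n (rpder true) f).
Proof.
move=> sf; elim: n => [|n IH]; first by [].
by rewrite iterS IH (schwarz (rsmooth_iter n true sf)).
Qed.

Lemma rtaylor_lin f g (k l : R) a b : rsmooth f -> rsmooth g ->
  rtaylor (fun x y => k * f x y + l * g x y) a b = k * rtaylor f a b + l * rtaylor g a b.
Proof.
move=> sf sg; rewrite /rtaylor (iter_lin _ _ _ _ sf sg).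
by rewrite (iter_lin _ _ _ _ (rsmooth_iter b true sf) (rsmooth_iter b true sg)).
Qed.

Lemma rtaylor_x f a b : rsmooth f -> rtaylor (fun x y => x * f x y) a b = a%:R * rtaylor f a.-1 b.
Proof.
move=> sf; rewrite /rtaylor (iter_coord_neq b (i := true) (j := false) isT sf).
rewrite (iter_coord_eq a false (rsmooth_iter b true sf)).
by rewrite /coordfun mul0r mulr0 add0r.
Qed.

Lemma rtaylor_y f a b : rsmooth f -> rtaylor (fun x y => y * f x y) a b = b%:R * rtaylor f a b.-1.
Proof.
move=> sf; rewrite /rtaylor (iter_coord_eq b true sf).
have s1 := rsmooth_iter b true sf; have s2 := rsmooth_iter b.-1 true sf.
rewrite (iter_lin a false 1 b%:R (rsmooth_coord_mul true s1) s2).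
rewrite (iter_coord_neq a (i := false) (j := true) isT s1).
by rewrite /coordfun mul0r mulr0 add0r.
Qed.

(** The derivatives in the second variable are taken first in [rtaylor], so the
new derivative in the first variable has to be moved past them. *)
Lemma rtaylor_dx f a b : rsmooth f -> rtaylor (rpder false f) a b = rtaylor f a.+1 b.
Proof. by move=> sf; rewrite /rtaylor (iter_swap b sf) -iterSr. Qed.

Lemma rtaylor_dy f a b : rtaylor (rpder true f) a b = rtaylor f a b.+1.
Proof. by rewrite /rtaylor -iterSr. Qed.

Lemma rtaylor_gauss a b : rtaylor (@gauss R) a b = (- 2) ^+ (a + b).
Proof.
have it n i (k : R) : iter n (rpder i) (fun x y => k * gauss x y) =
    (fun x y => ((- 2) ^+ n * k) * gauss x y).
  elim: n => [|n IH]; first by rewrite /= expr0 mul1r.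
  by rewrite iterS IH rpder_gauss exprS mulrA.
have e : @gauss R = (fun x y => 1 * gauss x y).
  by apply/funext => x; apply/funext => y; rewrite mul1r.
rewrite /rtaylor e !it mulr1 -exprD /gauss addr0 mulr0 expR0 mulr1 //.
Qed.
End TaylorReal.

Section TaylorComplex.
Variable R : realType.
Local Notation C := (R[i]).
Local Notation S := (super (serE R)).
Local Notation F := (R -> R -> C).
Implicit Types (f g : F).

Definition reF f : R -> R -> R := fun x y => complex.Re (f x y).
Definition imF f : R -> R -> R := fun x y => complex.Im (f x y).

Lemma csmoothE f : csmooth f <-> rsmooth (reF f) /\ rsmooth (imF f).
Proof. by []. Qed.

Lemma iter_cpder n i f : iter n (cpder i) f =
  (fun x y => iter n (rpder i) (reF f) x y +i* iter n (rpder i) (imF f) x y).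
Proof.
elim: n => [|n IH]; last by rewrite iterS IH.
by apply/funext => x; apply/funext => y; rewrite /= /reF /imF; case: (f x y).
Qed.

Definition ctaylor (f : smoothE R) : serE R := fun a b =>
  (iter a (cpder false) (iter b (cpder true) f)) 0 0 / (a`! * b`!)%:R.

Lemma ctaylorE f a b : ctaylor f a b =
  (rtaylor (reF f) a b +i* rtaylor (imF f) a b) / (a`! * b`!)%:R.
Proof. by rewrite /ctaylor iter_cpder (iter_cpder b true). Qed.

(** The combination has complex coefficients, so its real and imaginary parts
mix those of the two functions. *)
Lemma csmooth_comb (z w : C) f g : csmooth f -> csmooth g ->
  csmooth (fun x y => z * f x y + w * g x y) /\
  forall a b, ctaylor (fun x y => z * f x y + w * g x y) a b =
    z * ctaylor f a b + w * ctaylor g a b.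
Proof.
case: z => zr zi; case: w => wr wi [fr fi] [gr gi].
have sr := rsmooth_lin 1 1 (rsmooth_lin zr (- zi) fr fi) (rsmooth_lin wr (- wi) gr gi).
have si := rsmooth_lin 1 1 (rsmooth_lin zr zi fi fr) (rsmooth_lin wr wi gi gr).
have er : reF (fun x y => (zr +i* zi) * f x y + (wr +i* wi) * g x y) =
   (fun x y => 1 * (zr * reF f x y + - zi * imF f x y) + 1 * (wr * reF g x y + - wi * imF g x y)).
  apply/funext => x; apply/funext => y; rewrite /reF /imF.
  by case: (f x y) => ? ?; case: (g x y) => ? ? /=; ring.
have ei : imF (fun x y => (zr +i* zi) * f x y + (wr +i* wi) * g x y) =
   (fun x y => 1 * (zr * imF f x y + zi * reF f x y) + 1 * (wr * imF g x y + wi * reF g x y)).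
  apply/funext => x; apply/funext => y; rewrite /reF /imF.
  by case: (f x y) => ? ?; case: (g x y) => ? ? /=; ring.
split; first by apply/csmoothE; rewrite er ei; split.
move=> a b; rewrite !ctaylorE er ei.
rewrite (rtaylor_lin _ _ _ _ (rsmooth_lin zr (- zi) fr fi) (rsmooth_lin wr (- wi) gr gi)).
rewrite (rtaylor_lin _ _ _ _ (rsmooth_lin zr zi fi fr) (rsmooth_lin wr wi gi gr)).
rewrite (rtaylor_lin _ _ _ _ fr fi) (rtaylor_lin _ _ _ _ gr gi).
rewrite (rtaylor_lin _ _ _ _ fi fr) (rtaylor_lin _ _ _ _ gi gr).
rewrite !mulrA -mulrDl; congr (_ * _).
by apply/eqP; rewrite eq_complex /= ; apply/andP; split; apply/eqP; rewrite /=; ring.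
Qed.
End TaylorComplex.

Section TaylorMorphism.
Variable R : realType.
Local Notation C := (R[i]).
Local Notation S := (super (serE R)).
Local Notation P := (super (polyE R)).
Local Notation F := (R -> R -> C).
Implicit Types (f g : smoothE R).

Lemma csmooth_add f g : csmooth f -> csmooth g ->
  csmooth (f + g) /\ ctaylor (f + g) = ctaylor f + ctaylor g.
Proof.
move=> sf sg; have [s t] := csmooth_comb 1 1 sf sg.
have e : f + g = (fun x y => 1 * f x y + 1 * g x y : C).
  by apply/funext => x; apply/funext => y; rewrite !mul1r.
rewrite e; split=> //; apply/funext => a; apply/funext => b.
by rewrite t !mul1r.
Qed.

Lemma csmooth_scale (k : C) f : csmooth f ->
  csmooth (k *: f) /\ ctaylor (k *: f) = k *: ctaylor f.
Proof.
move=> sf; have [s t] := csmooth_comb k 0 sf sf.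
have e : k *: f = (fun x y => k * f x y + 0 * f x y : C).
  by apply/funext => x; apply/funext => y; rewrite mul0r addr0.
rewrite e; split=> //; apply/funext => a; apply/funext => b.
by rewrite t mul0r addr0.
Qed.

Lemma reF_realmul (c : R -> R -> R) (f : F) :
  reF (fun x y => (c x y)%:C * f x y) = (fun x y => c x y * reF f x y) /\
  imF (fun x y => (c x y)%:C * f x y) = (fun x y => c x y * imF f x y).
Proof.
split; apply/funext => x; apply/funext => y; rewrite /reF /imF;
  by case: (f x y) => u v /=; ring.
Qed.

Lemma fact_pred_ratio (a b : nat) : a.+1%:R / ((a.+1)`! * b)%:R = (a`! * b)%:R^-1 :> C.
Proof.
by rewrite factS -mulnA natrM invfM mulrA divff ?mul1r ?pnatr_eq0.
Qed.

Lemma complex_scale (k u v : R) : ((k * u) +i* (k * v)) = k%:C * (u +i* v) :> C.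
Proof. by apply/eqP; rewrite eq_complex /=; apply/andP; split; apply/eqP; ring. Qed.

Lemma csmooth_mulx1 f : csmooth f ->
  csmooth (mulx1 (smoothE R) f) /\ ctaylor (mulx1 (smoothE R) f) = mulx1 (serE R) (ctaylor f).
Proof.
move=> [sr si]; have [er ei] := reF_realmul (fun x y => x) f.
split; first by apply/csmoothE; split; [rewrite er|rewrite ei]; exact: (rsmooth_coord_mul false).
apply/funext => a; apply/funext => b; rewrite ctaylorE er ei.
rewrite (rtaylor_x _ _ sr) (rtaylor_x _ _ si) complex_scale.
case: a => [|a]; first by rewrite !mul0r.
rewrite -[RHS]/(ctaylor f a b) ctaylorE mulrAC complex_natr /= fact_pred_ratio mulrC.
by [].
Qed.

Lemma csmooth_mulx2 f : csmooth f ->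
  csmooth (mulx2 (smoothE R) f) /\ ctaylor (mulx2 (smoothE R) f) = mulx2 (serE R) (ctaylor f).
Proof.
move=> [sr si]; have [er ei] := reF_realmul (fun x y => y) f.
split; first by apply/csmoothE; split; [rewrite er|rewrite ei]; exact: (rsmooth_coord_mul true).
apply/funext => a; apply/funext => b; rewrite ctaylorE er ei.
rewrite (rtaylor_y _ _ sr) (rtaylor_y _ _ si) complex_scale.
case: b => [|b]; first by rewrite !mul0r.
rewrite -[RHS]/(ctaylor f a b) ctaylorE mulrAC complex_natr /= mulnC fact_pred_ratio mulnC mulrC.
by [].
Qed.

Lemma csmooth_der1 f : csmooth f ->
  csmooth (der1 (smoothE R) f) /\ ctaylor (der1 (smoothE R) f) = der1 (serE R) (ctaylor f).
Proof.
move=> [sr si]; split.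
  by apply/csmoothE; split; [exact: (rsmooth_rpder false sr)|exact: (rsmooth_rpder false si)].
apply/funext => a; apply/funext => b.
rewrite -[RHS]/(ctaylor f a.+1 b *+ a.+1) !ctaylorE.
rewrite -[reF _]/(rpder false (reF f)) -[imF _]/(rpder false (imF f)).
rewrite (rtaylor_dx _ _ sr) (rtaylor_dx _ _ si) -mulrnAr -[_ *+ a.+1]mulr_natl.
by rewrite fact_pred_ratio.
Qed.

Lemma csmooth_der2 f : csmooth f ->
  csmooth (der2 (smoothE R) f) /\ ctaylor (der2 (smoothE R) f) = der2 (serE R) (ctaylor f).
Proof.
move=> [sr si]; split.
  by apply/csmoothE; split; [exact: (rsmooth_rpder true sr)|exact: (rsmooth_rpder true si)].
apply/funext => a; apply/funext => b.
rewrite -[RHS]/(ctaylor f a b.+1 *+ b.+1) !ctaylorE.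
rewrite -[reF _]/(rpder true (reF f)) -[imF _]/(rpder true (imF f)).
rewrite (rtaylor_dy _ _ _) (rtaylor_dy _ _ _) -mulrnAr -[_ *+ b.+1]mulr_natl.
by rewrite [(a`! * b.+1`!)%N]mulnC fact_pred_ratio mulnC.
Qed.

Lemma rsmooth_cst0 : rsmooth (fun _ _ : R => 0 : R).
Proof.
have e : (fun _ _ : R => 0 : R) = (fun x y => 0 * gauss x y).
  by apply/funext => x; apply/funext => y; rewrite mul0r.
rewrite e; exact: rsmooth_gauss.
Qed.

Lemma csmooth0 : csmooth (0 : smoothE R).
Proof. by apply/csmoothE; split; exact: rsmooth_cst0. Qed.

Definition smooth_super (f : super (smoothE R)) := forall c d, csmooth (f c d).

Lemma transports_taylor al lam (X : tkk al) (f : super (smoothE R)) : smooth_super f ->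
  smooth_super (piact lam X f) /\ taylor (piact lam X f) = piact lam X (taylor f).
Proof.
move=> sf; have H : transports (@ctaylor R) (piact lam X (E := smoothE R)) (piact lam X).
  apply: transports_piact.
  - exact: csmooth0.
  - by move=> x y sx sy; have [] := csmooth_add sx sy.
  - by move=> k x sx; have [] := csmooth_scale k sx.
  - by move=> x sx; have [] := csmooth_mulx1 sx.
  - by move=> x sx; have [] := csmooth_mulx2 sx.
  - by move=> x sx; have [] := csmooth_der1 sx.
  - by move=> x sx; have [] := csmooth_der2 sx.
  - by move=> x y sx sy; have [] := csmooth_add sx sy.
  - by move=> k x sx; have [] := csmooth_scale k sx.
  - by move=> x sx; have [] := csmooth_mulx1 sx.
  - by move=> x sx; have [] := csmooth_mulx2 sx.
  - by move=> x sx; have [] := csmooth_der1 sx.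
  - by move=> x sx; have [] := csmooth_der2 sx.
exact: (H f sf).
Qed.

Lemma ideal_taylor al lam (f : super (smoothE R)) : ideal al lam f ->
  smooth_super f /\ ideal al lam (taylor f).
Proof.
move=> If; apply: (ideal_super_map (phi := @ctaylor R)); last exact: If.
- exact: csmooth0.
- by move=> x y sx sy; have [] := csmooth_add sx sy.
- by move=> k x sx; have [] := csmooth_scale k sx.
- by move=> x sx; have [] := csmooth_mulx1 sx.
- by move=> x sx; have [] := csmooth_mulx2 sx.
- by move=> x y sx sy; have [] := csmooth_add sx sy.
- by move=> k x sx; have [] := csmooth_scale k sx.
- by move=> x sx; have [] := csmooth_mulx1 sx.
- by move=> x sx; have [] := csmooth_mulx2 sx.
- by [].
Qed.

Local Notation i0 := (ord0 : 'I_2).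
Local Notation i1 := (ord_max : 'I_2).
Definition cexp : smoothE R := fun x y => (expR (- 2 * (x + y)))%:C.
Definition evalexp (m : polyE R) : smoothE R := fun x y =>
  mpoly.meval (fun k : 'I_2 => if k == i0 then x%:C else y%:C) m
    * (expR (- 2 * (x + y)))%:C.

Lemma expfunE (p : P) : expfun p = super_map evalexp p. Proof. by []. Qed.

Lemma evalexpD m n : evalexp (m + n) = evalexp m + evalexp n.
Proof.
by apply/funext => x; apply/funext => y; rewrite /evalexp mpoly.mevalD mulrDl.
Qed.
Lemma evalexpZ k m : evalexp (k *: m) = k *: evalexp m.
Proof.
apply/funext => x; apply/funext => y; rewrite /evalexp mpoly.mevalZ -mulrA.
by [].
Qed.
Lemma evalexp_X1 m : evalexp (mulx1 (polyE R) m) = mulx1 (smoothE R) (evalexp m).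
Proof.
by apply/funext => x; apply/funext => y; rewrite /evalexp /= mpoly.mevalM mpoly.mevalXU -mulrA.
Qed.
Lemma evalexp_X2 m : evalexp (mulx2 (polyE R) m) = mulx2 (smoothE R) (evalexp m).
Proof.
by apply/funext => x; apply/funext => y; rewrite /evalexp /= mpoly.mevalM mpoly.mevalXU -mulrA.
Qed.

Lemma expfunD (p q : P) : expfun (p + q) = expfun p + expfun q.
Proof. by apply/funext => c; apply/funext => d; exact: evalexpD. Qed.
Lemma expfunZ k (p : P) : expfun (k *: p) = k *: expfun p.
Proof. by apply/funext => c; apply/funext => d; exact: evalexpZ. Qed.

Lemma expfun_Xop i (p : P) : expfun (Xop i p) = Xop i (expfun p).
Proof.
have ev0 : evalexp 0 = 0 by rewrite -(scale0r 0) evalexpZ scale0r.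
move: i; apply: forall_ord4; rewrite ?Xop_o.
- by apply/funext => c; apply/funext => d; exact: evalexp_X1.
- by apply/funext => c; apply/funext => d; exact: evalexp_X2.
- by apply/funext => -[]; apply/funext => d; rewrite expfunE /super_map /X3 /= ?ev0.
- by apply/funext => c; apply/funext => -[]; rewrite expfunE /super_map /X4 /= ?ev0 ?evalexpZ.
Qed.

Lemma expfun_pone c d : expfun (pone R) c d = if c || d then 0 else cexp.
Proof.
rewrite /expfun /pone /polymono; case: c; case: d; apply/funext => x; apply/funext => y;
  rewrite /= ?mpoly.meval0 ?mul0r //.
have -> : mono 0 0 = mpoly.mnm0.
  by apply/mpoly.mnmP; apply: forall_ord2; rewrite ?mono_i0 ?mono_i1 mpoly.mnm0E.
by rewrite mpoly.mpolyX0 mpoly.meval1 mul1r.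
Qed.

Lemma csmooth_cexp : csmooth cexp.
Proof.
apply/csmoothE; split; last exact: rsmooth_cst0.
have e : reF cexp = (fun x y => 1 * gauss x y).
  by apply/funext => x; apply/funext => y; rewrite mul1r.
by rewrite e; exact: rsmooth_gauss.
Qed.

Lemma smooth_Xop i (f : super (smoothE R)) : smooth_super f ->
  smooth_super (Xop i f) /\ taylor (Xop i f) = Xop i (taylor f).
Proof.
move=> sf; have H : transports (@ctaylor R) (Xop (E := smoothE R) i) (Xop i).
  apply: transports_Xop.
  - exact: csmooth0.
  - by move=> k x sx; have [] := csmooth_scale k sx.
  - by move=> x sx; have [] := csmooth_mulx1 sx.
  - by move=> x sx; have [] := csmooth_mulx2 sx.
  - by move=> k x sx; have [] := csmooth_scale k sx.
  - by move=> x sx; have [] := csmooth_mulx1 sx.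
  - by move=> x sx; have [] := csmooth_mulx2 sx.
exact: (H f sf).
Qed.

Lemma smooth_add (f g : super (smoothE R)) : smooth_super f -> smooth_super g ->
  smooth_super (f + g) /\ taylor (f + g) = taylor f + taylor g.
Proof.
move=> sf sg; split; first by move=> c d; have [] := csmooth_add (sf c d) (sg c d).
by apply/funext => c; apply/funext => d; have [] := csmooth_add (sf c d) (sg c d).
Qed.

Lemma smooth_scale k (f : super (smoothE R)) : smooth_super f ->
  smooth_super (k *: f) /\ taylor (k *: f) = k *: taylor f.
Proof.
move=> sf; split; first by move=> c d; have [] := csmooth_scale k (sf c d).
by apply/funext => c; apply/funext => d; have [] := csmooth_scale k (sf c d).
Qed.

Lemma smooth_expfun (p : P) : smooth_super (expfun p).
Proof.
elim/super_poly_ind : p => [|p q sp sq|k p sp|i p sp].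
- move=> c d; rewrite expfun_pone; case: ifP => _; [exact: csmooth0|exact: csmooth_cexp].
- by rewrite expfunD; have [] := smooth_add sp sq.
- by rewrite expfunZ; have [] := smooth_scale k sp.
- by rewrite expfun_Xop; have [] := smooth_Xop i sp.
Qed.

Lemma taylor_expfun_pone : taylor (expfun (pone R)) = exp_m2 R.
Proof.
apply: superP => c d a b; rewrite -[LHS]/(ctaylor (expfun (pone R) c d) a b) expfun_pone /exp_m2.
rewrite -negb_or; case: (c || d) => /=.
  have := csmooth_scale 0 csmooth0 => -[_]; rewrite scale0r => ->.
  by rewrite scale0r.
rewrite ctaylorE.
have -> : reF cexp = @gauss R by [].
have -> : imF cexp = (fun x y => 0 * gauss x y).
  by apply/funext => x; apply/funext => y; rewrite mul0r.
have -> : rtaylor (fun x y => 0 * gauss x y) a b = 0 :> R.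
  have s : rsmooth (@gauss R).
    have := rsmooth_gauss (R := R) 1.
    have -> : (fun x y => 1 * gauss x y) = @gauss R; last by [].
    by apply/funext => x; apply/funext => y; rewrite mul1r.
  have e : (fun x y => 0 * gauss x y) = (fun x y => 0 * gauss x y + 0 * gauss x y) :> (R -> R -> R).
    by apply/funext => x; apply/funext => y; rewrite !mul0r addr0.
  by rewrite e (rtaylor_lin 0 0 a b s s) !mul0r addr0.
rewrite rtaylor_gauss; congr (_ / _).
by rewrite -[LHS]/(((-2) ^+ (a + b))%:C) rmorphXn rmorphN rmorph_nat.
Qed.
End TaylorMorphism.

(** * The Segal-Bargmann transform *)
Section Transform.
Variable R : realType.
Local Notation C := (R[i]).
Local Notation S := (super (serE R)).
Local Notation P := (super (polyE R)).
Variables (al lam : R) (sw : bool).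
Hypothesis al0 : al != 0.
Hypothesis hsw : if sw then lam = al else lam = 1 /\ al != 1.
Hypothesis mu_nat : ~ exists n : nat, main_param al sw = n%:R.

Lemma eqmod_poly (p q : P) : eqmod al lam p q <-> nullclass al sw (toser p - toser q).
Proof.
have e : toser (p - q) = toser p - toser q.
  by rewrite -scaleN1r toserD toserZ scaleN1r.
split=> [h|h]; first by rewrite -e; exact: (ideal_nullclass hsw (toser_ideal h)).
by apply: (nullclass_toser_ideal hsw); rewrite e.
Qed.

Lemma eqmod_poly_trans (p q r : P) : eqmod al lam p q -> eqmod al lam q r -> eqmod al lam p r.
Proof.
move=> /eqmod_poly a /eqmod_poly b; apply/eqmod_poly.
have -> : toser p - toser r = (toser p - toser q) + (toser q - toser r).
  by rewrite addrA subrK.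
exact: (nullclass_add a b).
Qed.

Lemma eqmod_poly_sym (p q : P) : eqmod al lam p q -> eqmod al lam q p.
Proof.
move=> /eqmod_poly a; apply/eqmod_poly.
by rewrite -opprB -scaleN1r; exact: (nullclass_scale _ a).
Qed.

Lemma rhoact_linear (X : tkk al) : linear_map (rhoact lam X : S -> S).
Proof.
have lz u := (descends_zmul hsw u).1; have lp u := (descends_piL al0 hsw u).1.
have lb u := (descends_bessel al0 hsw u).1.
have ld := (descends_derT hsw (tkk_derP X)).1.
apply: (proj1 (_ : lincont (rhoact lam X))).
apply: lincont_add; last first.
  apply: lincont_add; last by apply/lincont_opp/lincont_scale/lp.
  by apply/lincont_scale/lincont_add; [exact: lz|exact: lb].
apply: lincont_add; last exact: ld.
apply: lincont_add; last first.
  by apply/lincont_scale/lincont_add; [exact: lz|apply: lincont_opp; exact: lb].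
apply: lincont_add; last by apply/lincont_scale/lp.
by apply/lincont_scale/lincont_add; [exact: lz|exact: lb].
Qed.

Lemma rhoact_nullclass (X : tkk al) (f : S) : nullclass al sw f -> nullclass al sw (rhoact lam X f).
Proof.
move=> f0.
have kz u := (descends_zmul hsw u).2 f f0; have kp u := (descends_piL al0 hsw u).2 f f0.
have kb u := (descends_bessel al0 hsw u).2 f f0.
have kd := (descends_derT hsw (tkk_derP X)).2 f f0.
have kopp g : nullclass al sw g -> nullclass al sw (- g).
  by move=> g0; rewrite -scaleN1r; exact: nullclass_scale.
apply: nullclass_add; last first.
  apply: nullclass_add; last by apply: kopp; exact: (nullclass_scale _ (kp _)).
  by apply: nullclass_scale; exact: (nullclass_add (kz _) (kb _)).
apply: nullclass_add; last exact: kd.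
apply: nullclass_add; last first.
  by apply: nullclass_scale; exact: (nullclass_add (kz _) (kopp _ (kb _))).
apply: nullclass_add; last exact: (nullclass_scale _ (kp _)).
by apply: nullclass_scale; exact: (nullclass_add (kz _) (kb _)).
Qed.

Lemma rhoact_eqmod (X : tkk al) (p q : P) : eqmod al lam p q ->
  eqmod al lam (rhoact lam X p) (rhoact lam X q).
Proof.
move=> /eqmod_poly pq; apply/eqmod_poly.
have e : toser (rhoact lam X p) - toser (rhoact lam X q) =
    rhoact lam X (toser p - toser q).
  exact: (etrans (congr2 (fun x y : S => x - y) (toser_rhoact lam X p)
    (toser_rhoact lam X q)) (esym (linear_mapB _ _ (rhoact_linear X)))).
by rewrite e; exact: (rhoact_nullclass X pq).
Qed.

Lemma Cinv_target (p : P) (s t : S) : nullclass al sw (s - t) -> Cinv al lam p s -> Cinv al lam p t.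
Proof.
rewrite !(CinvE al lam) => st /(qcvgP hsw) ps; apply/(qcvgP hsw) => c d k.
have := st c d k; rewrite qcoord_add qcoord_opp => /eqP; rewrite subr_eq0 => /eqP <-.
exact: ps.
Qed.

(** An element of W differs from some p e^(- 2 (x1 + x2)) by the ideal of smooth
superfunctions, whose Taylor series are null classes. *)
Lemma inW_Cinv (f : super (smoothE R)) : inW al lam f ->
  smooth_super f /\ exists p, Cinv al lam p (taylor f).
Proof.
move=> [q /ideal_taylor[sd Id]].
have sq := smooth_expfun q.
have e : f = (f - expfun q) + expfun q by rewrite subrK.
have [sf tf] := smooth_add sd sq; rewrite -e in sf tf; split=> //.
have [||||p hp] := Cinv_surjective al0 hsw (Phi := fun p => taylor (expfun p)) _ _ _ _ q.
- by move=> p r; rewrite expfunD; have [] := smooth_add (smooth_expfun p) (smooth_expfun r).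
- by move=> k p; rewrite expfunZ; have [] := smooth_scale k (smooth_expfun p).
- by move=> i p; rewrite expfun_Xop; have [] := smooth_Xop i (smooth_expfun p).
- exact: taylor_expfun_pone.
exists p; apply: (Cinv_target _ hp); rewrite tf.
rewrite opprD addrCA subrr addr0 -scaleN1r; apply: nullclass_scale.
exact: (ideal_nullclass hsw Id).
Qed.

Lemma piCP (f : super (smoothE R)) : (exists p, Cinv al lam p (taylor f)) ->
  Cinv al lam (piC al lam f) (taylor f).
Proof.
move=> [p hp]; have := @xgetPex _ 0 [set p | inF al lam p /\ Cinv al lam p (taylor f)].
by case; [exists p; split=> //; exact: inF_all|].
Qed.

Lemma Cinv_eqmod_unique (p q : P) s : Cinv al lam p s -> Cinv al lam q s -> eqmod al lam p q.
Proof.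
move=> ps qs; have := Cinv_add hsw ps (Cinv_scale hsw (-1) qs).
rewrite !scaleN1r subrr => /(Cinv_injective al0 hsw mu_nat).
exact: (nullclass_toser_ideal hsw).
Qed.

(** The inverse transform intertwines rho with pi, and it is injective modulo the
ideal. *)
Lemma piC_intertwines (X : tkk al) (f : super (smoothE R)) : inW al lam f ->
  eqmod al lam (piC al lam (piact lam X f)) (rhoact lam X (piC al lam f)).
Proof.
move=> /inW_Cinv[sf /piCP h].
have [_ t] := transports_taylor lam X sf.
have r := Cinv_rhoact al0 hsw X h; rewrite -t in r.
apply: (Cinv_eqmod_unique _ r); apply: piCP.
by exists (rhoact lam X (piC al lam f)).
Qed.

Lemma SB_piC (f : super (smoothE R)) : (exists K, reproducing al lam K) ->
  eqmod al lam (SB al lam f) (piC al lam f).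
Proof.
move=> eK; have rK : reproducing al lam (repker al lam).
  by case: eK => K hK; exact: (xgetPex _ (ex_intro _ K hK)).
exact: (rK _ (inF_all al lam _)).
Qed.

(** If there is no reproducing kernel, [repker] is the zero kernel. *)
Lemma SB_trivial (f : super (smoothE R)) : ~ (exists K, reproducing al lam K) ->
  SB al lam f = 0.
Proof.
move=> nK; rewrite /SB.
have -> : repker al lam = (fun=> 0).
  by apply: xgetPN => K hK; apply: nK; exists K.
rewrite /BFkernel fsbig1 // => m _.
have -> : pconj (0 : P) = 0.
  apply/funext => c; apply/funext => d; apply/mpoly.mpolyP => n.
  by rewrite /pconj mpoly.mcoeff_map_mpoly /= mpoly.mcoeff0 rmorph0.
by rewrite scaler0.
Qed.

Lemma SB_intertwines (X : tkk al) (f : super (smoothE R)) : inW al lam f ->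
  eqmod al lam (SB al lam (piact lam X f)) (rhoact lam X (SB al lam f)).
Proof.
move=> fW; have [eK|nK] := pselect (exists K, reproducing al lam K).
  apply: (eqmod_poly_trans (SB_piC _ eK)).
  apply: (eqmod_poly_trans (piC_intertwines X fW)).
  exact/rhoact_eqmod/eqmod_poly_sym/SB_piC.
rewrite !(SB_trivial _ nK); apply/eqmod_poly; rewrite (toser_rhoact lam X).
have -> : toser (0 : P) = 0.
  by have := toserZ 0 (0 : P); rewrite !scale0r.
rewrite (linear_map0 (rhoact_linear X)) subrr; exact: nullclass0.
Qed.
End Transform.

Theorem theorem7p5 (R : realType) (al lam : R)
    (al_neq0 : al != 0) (al_neq1 : al != 1)
    (hlam : (lam = al /\ ~ (exists n : nat, al = n%:R)) \/
            (lam = 1 /\ ~ (exists n : nat, al^-1 = n%:R)))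
    (X : tkk al) (f : super (smoothE R)) (fW : inW al lam f) :
  eqmod al lam (SB al lam (piact lam X f)) (rhoact lam X (SB al lam f)).
Proof.
case: hlam => -[lamE mu_nat].
- exact: (SB_intertwines (sw := true) al_neq0 lamE mu_nat).
- exact: (SB_intertwines (sw := false) al_neq0 (conj lamE al_neq1) mu_nat).
Qed.
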